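(* Let $J$ be a proper, convex, lower semi-continuous, absolutely one-homogeneous functional on $\mathbb{R}^n$ with values in $\mathbb{R}^+\cup\{\infty\}$, and let $f\in\mathbb{R}^n$. If $J$ induces a polyhedral seminorm, i.e. there exists a finite set whose convex hull equals $\partial J(0)$, then the scale space flow (gradient flow, $GF$), the inverse scale space flow ($IS$) and the variational method ($VM$) have a well-defined spectral representation, which consists of finitely many $\delta$-peaks. In other words, the spectral representation is given by $$\phi_*(t)=\sum_{i=0}^{N_*}\phi_*^i\,\delta(t-t_i),\qquad *\in\{VM,GF,IS\},$$ and the reconstruction formula $f=P_0(f)+\int_0^\infty\phi_*(t)\,dt$ of the respective method yields a decomposition of $f$ as $$f=\sum_{i=0}^{N_*}\phi_*^i,\qquad *\in\{VM,GF,IS\},$$ where the $t_i$ are the finite number of times at which the piecewise behavior of the variational method, the gradient flow, or the inverse scale space flow, respectively, changes. The corresponding $\phi_*^i$ can be seen as multiples of $\psi_*(t)$ arising from the polar decomposition of the spectral frequency representation. They are given by $$\phi_{GF}^i=t_i\,\big(p_{GF}(t_i)-p_{GF}(t_{i+1})\big),$$ $$\phi_{VM}^i=t_i\,\big(u_{VM}(t_{i+1})-2u_{VM}(t_i)+u_{VM}(t_{i-1})\big),$$ $$\phi_{IS}^i=u_{IS}(t_i)-u_{IS}(t_{i+1}),$$ with $u_{IS}(t_0)=u_{VM}(t_0)=u_{VM}(t_{-1})=f$, $p_{GF}(t_0)=0$, $t_0=0$.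
   Context: Absolutely one-homogeneous means $J(su)=|s|J(u)$ for all $s\in\mathbb{R}$, $u\in\mathbb{R}^n$. $\partial J$ is the convex subdifferential, and $P_0$ is the orthogonal projection onto the linear subspace $\mathcal{N}(J)=\{u\in\mathbb{R}^n: J(u)=0\}$. Variational method: $u_{VM}(t)=\arg\min_u\frac12\|u-f\|_2^2+tJ(u)$. Gradient flow: $\partial_tu_{GF}(t)=-p_{GF}(t)$, $p_{GF}(t)\in\partial J(u_{GF}(t))$, $u_{GF}(0)=f$. Inverse scale space flow: $\partial_sq_{IS}(s)=f-v_{IS}(s)$, $q_{IS}(s)\in\partial J(v_{IS}(s))$, $q_{IS}(0)=0$; in the wavelength variable $t=1/s$ one writes $u_{IS}(t)=v_{IS}(1/t)$. Piecewise behavior when $J$ induces a polyhedral seminorm (each with finitely many pieces): $u_{GF}$ is piecewise linear and $p_{GF}$ piecewise constant in $t$, with $u_{GF}(t)=u_{GF}(t_i)-(t-t_i)p_{GF}(t_{i+1})$ for $t\in[t_i,t_{i+1}]$, so $p_{GF}(t_{i+1})$ is the subgradient used on that interval; $q_{IS}$ is piecewise linear and $v_{IS}$ piecewise constant in $s$ (so $u_{IS}$ is piecewise constant in $t$); $u_{VM}$ is affinely linear in $t$ on each interval $[t_i,t_{i+1}]$. The times $t_i$ and their number depend on the method $*$. The spectral (wavelength) representations are the vector-valued distributions $\phi_{VM}(t)=t\,\partial_{tt}u_{VM}(t)$, $\phi_{GF}(t)=t\,\partial_{tt}u_{GF}(t)$, and $\phi_{IS}(t)=-\partial_sv_{IS}(1/t)=t^2\,\partial_tu_{IS}(t)$,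 the last being the wavelength counterpart, under $s=1/t$, of the frequency representation $\tilde\phi_{IS}(s)=\partial_sv_{IS}(s)$. Integrals of $\phi_*$ are understood as duality products with test functions in $W^{1,1}_{loc}(\mathbb{R}_+;\mathbb{R}^n)$. Polar decomposition: a spectral frequency representation given by a vector-valued Radon measure $\tilde\Phi_s$ is written $d\tilde\Phi_s=\tilde\psi(s)\,d\|\tilde\Phi_s\|$ with $\|\tilde\psi(s)\|=1$ for $\|\tilde\Phi_s\|$-almost every $s$; likewise, the corresponding wavelength representation $\Phi_t$ (change of variable $s=1/t$) gives rise to normalized functions $\psi(t)$. The subscript $*$ on $\psi_*$ indicates the method.
   Formalization: φ_VM^i uses differences of difference quotients of u_VM over [t_i,t_{i+1}] and [t_{i-1},t_i], not the plain second difference; f=Σφ^i is replaced by f=P_0(f)+Σφ^i; φ_IS is the image measure of ∂_s v_IS under s=1/t instead of t²∂_t u_IS. The printed formulas fail for J=|·|, f=1/2, or for J(f)=0. *)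

(* Defs.v *)
From HB Require Import structures.
From mathcomp Require Import all_boot all_order all_algebra.
From mathcomp Require Import all_classical all_reals all_analysis.

Set Implicit Arguments.
Unset Strict Implicit.
Unset Printing Implicit Defensive.

Import Order.TTheory GRing.Theory Num.Theory numFieldNormedType.Exports.

Local Open Scope classical_set_scope.
Local Open Scope ring_scope.

Section Functionals.
Variables (R : realType) (n : nat).
Notation V := 'rV[R]_n.
Implicit Types (J : V -> \bar R) (u v w f : V).

(* The library norm on row vectors is the sup norm, hence these two. *)
Definition dotp u v : R := \sum_(j < n) u 0 j * v 0 j.
Definition enorm u : R := Num.sqrt (dotp u u).

Definition proper_ereal J := (forall u, J u != -oo%E) /\ exists u, J u != +oo%E.

Definition convex_ereal J := forall u v (a : R), 0 <= a <= 1 ->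
  (J (a *: u + (1 - a) *: v)%R <= a%:E * J u + (1 - a)%:E * J v)%E.

(* For s = 0 this reads J 0 = 0, since 0 * +oo = 0. *)
Definition abs_one_homogeneous J := forall (s : R) u,
  J (s *: u) = (`|s|%:E * J u)%E.

Definition subdiff J u : set V :=
  [set p | forall w, (J u + (dotp p (w - u)%R)%:E <= J w)%E].

Definition conv_hull (S : seq V) : set V :=
  [set p | exists a : 'I_(size S) -> R,
     [/\ forall i, 0 <= a i, \sum_i a i = 1 & p = \sum_i a i *: S`_i]].

Definition polyhedral J := exists S : seq V, conv_hull S = subdiff J 0.

(* Orthogonal projection onto {J = 0}; w is the only element of this set with
   f - w orthogonal to it. *)
Definition P0 J f : V :=
  xget 0 [set w | J w = 0%E /\ forall z, J z = 0%E -> dotp (f - w) z = 0].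

End Functionals.

Section Evolutions.
Variables (R : realType) (n : nat).
Notation V := 'rV[R]_n.
Notation lambda := (@lebesgue_measure R).
Implicit Types (J : V -> \bar R) (f : V).

(* v belongs to W^{1,1}_loc(I; R^n) with weak derivative dv, v being the
   absolutely continuous representative. *)
Definition W11loc (I : set R) (v dv : R -> V) := forall a b, I a -> I b ->
  a <= b -> forall j,
  lambda.-integrable `[a, b] (fun r => (dv r 0 j)%:E) /\
  v b 0 j - v a 0 j = \int[lambda]_(r in `[a, b]) dv r 0 j.

Definition variational_method J f (u : R -> V) := forall t, 0 <= t -> forall w,
  ((2^-1 * enorm (u t - f) ^+ 2)%:E + t%:E * J (u t)
    <= (2^-1 * enorm (w - f) ^+ 2)%:E + t%:E * J w)%E.

Definition gradient_flow J f (u p : R -> V) :=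
  [/\ u 0 = f, W11loc `[0, +oo[ u (fun t => - p t) &
      {ae lambda, forall t, 0 < t -> subdiff J (u t) (p t)}].

Definition inverse_scale_space J f (v q : R -> V) :=
  [/\ q 0 = 0, W11loc `[0, +oo[ q (fun s => f - v s) &
      {ae lambda, forall s, 0 < s -> subdiff J (v s) (q s)}].

End Evolutions.

Section Distributions.
Variables (R : realType) (n : nat).
Notation V := 'rV[R]_n.
Notation lambda := (@lebesgue_measure R).

(* A vector-valued distribution on ]0, +oo[ maps a test function, given with
   its weak derivative, to the value of the pairing. *)
Definition vdistribution := (R -> V) -> (R -> V) -> R.

Implicit Types (L : vdistribution) (t : nat -> R) (phi : nat -> V).

(* Test functions: W^{1,1}_loc(]0, +oo[; R^n) with compact support. *)
Definition test (w dw : R -> V) := W11loc `]0, +oo[ w dw /\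
  exists a b, [/\ 0 < a, a <= b &
    forall r, 0 < r -> ~~ (a <= r <= b) -> w r = 0 /\ dw r = 0].

(* The distribution t u''(t), for u locally Lipschitz:
   <t u'', w> = <u'', t w> = - int (t w)' . u' *)
Definition t_second_derivative (u : R -> V) : vdistribution := fun w dw =>
  - \int[lambda]_(t in `]0, +oo[) dotp (w t + t *: dw t) (derive1 u t).

(* The distribution v'(s). *)
Definition distr_derivative (v : R -> V) : vdistribution := fun w dw =>
  - \int[lambda]_(s in `]0, +oo[) dotp (v s) (dw s).

(* Image of L under the change of variable s = 1/t (an involution), so that
   delta(s - a) becomes delta(t - 1/a):  <invert L, w> = <L, w(1/s)>. *)
Definition invert L : vdistribution := fun w dw =>
  L (fun s => w s^-1) (fun s => - (s ^- 2) *: dw s^-1).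

(* For L with compact support in ]0, +oo[ and v in W^{1,1}_loc: the duality
   product <L, v> equals c. *)
Definition duality L (v : R -> V) (c : R) :=
  exists a b, [/\ 0 < a, a <= b & forall w dw, test w dw ->
    (forall r, a <= r <= b -> w r = v r) -> L w dw = c].

(* m is the integral of L over ]0, +oo[, i.e. the duality products of L with
   the constant unit vectors. *)
Definition integral_is L (m : V) :=
  forall j, duality L (fun=> delta_mx 0 j) (m 0 j).

(* L = sum_(i <= N) phi_i delta(t - t_i), on all of W^{1,1}_loc *)
Definition delta_peaks L (N : nat) t phi :=
  forall v dv, W11loc `]0, +oo[ v dv ->
    duality L v (\sum_(i < N.+1) dotp (phi i) (v (t i))).

(* L is the vector-valued Radon measure psi mu on ]0, +oo[, with mu its total
   variation. *)
Definition polar_decomposition L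
    (mu : {measure set (measurableTypeR R) -> \bar R}) (psi : R -> V) :=
  [/\ mu [set s | s <= 0] = 0%E /\
        (forall a b : R, 0 < a -> (mu `[a, b]%classic < +oo)%E),
      forall j, measurable_fun (`]0, +oo[ : set (measurableTypeR R))
        (fun s => psi s 0 j),
      {ae mu, forall s, enorm (psi s) = 1} &
      forall w dw, test w dw ->
        L w dw = \int[mu]_(s in `]0, +oo[) dotp (w s) (psi s)].

(* 0 = t_0 < t_1 < ... < t_N; t_(N+1) stands for an arbitrary time > t_N. *)
Definition times (N : nat) t :=
  t 0%N = 0 /\ forall i, (i <= N)%N -> t i < t i.+1.

(* ]t_i, t_(i+1)] for i < N, and ]t_N, +oo[ for i = N *)
Definition piece (N : nat) t (i : nat) (r : R) :=
  t i < r /\ ((i < N)%N -> r <= t i.+1).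

Definition locally_affine (u : R -> V) (r : R) :=
  exists b, \forall s \near r, u s = u r + (s - r) *: b.

Definition locally_constant (u : R -> V) (r : R) :=
  \forall s \near r, u s = u r.

(* t_1, ..., t_N are exactly the positive times without property P *)
Definition change_times (N : nat) t (P : R -> Prop) :=
  forall r : R, 0 < r -> (~ P r <-> exists2 i, (0 < i <= N)%N & r = t i).

Definition slope (u : R -> V) (a b : R) : V := (b - a)^-1 *: (u b - u a).

(* L and Lfreq are the wavelength and the frequency representation of the same
   method; s |-> psi s normalizes Lfreq, hence t |-> psi t^-1 normalizes L. *)
Definition spectral_decomposition (J : V -> \bar R) (f : V) L Lfreq
    (N : nat) t phi :=
  [/\ delta_peaks L N t phi,
      exists2 m, integral_is L m & f = P0 J f + m,
      f = P0 J f + \sum_(i < N.+1) phi i,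
      exists mu psi, polar_decomposition Lfreq mu psi &
      forall mu psi, polar_decomposition Lfreq mu psi ->
        forall i, (i <= N)%N -> exists c : R, phi i = c *: psi (t i)^-1].

End Distributions.

(* Main.v *)
Require Import Defs.
From HB Require Import structures.
From mathcomp Require Import all_boot all_order all_algebra.
From mathcomp Require Import all_classical all_reals all_analysis.
From mathcomp Require Import measurable_realfun ring lra.

Set Implicit Arguments.
Unset Strict Implicit.
Unset Printing Implicit Defensive.

Import Order.TTheory GRing.Theory Num.Theory numFieldNormedType.Exports.

Local Open Scope classical_set_scope.
Local Open Scope ring_scope.

(** Let S be a finite set whose convex hull is [subdiff J 0]. Lower
semicontinuity makes J the support function of S, that is, J u is the maximum
of the <s, u> for s in S ([seminorm_active]). Hence p is a subgradient at u if
and only if it is a convex combination of elements of S that are maximal in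
direction u, and the graph of the subdifferential is a finite union of
products of convex sets ([subdiff_cells]).

Two facts hold for every monotone operator A with such a graph. Its resolvent
u(r), defined by w = u(r) + r p with p in A(u(r)), is continuous in r, and is
affine on the set of all r for which (u(r), p) belongs to a given product.
These sets are intervals, finitely many, and they cover the half-line, so that
u is a broken line ([resolvent_broken_line]). Secondly, A has trajectories
u' = - p with p in A(u) that are broken lines: the first piece of a resolvent
curve gives an initial direction, which is the element of A(u) of least norm;
when it leaves A(u), an element of smaller norm takes over; and A(u) depends
only on the set of cells that contain u, so that finitely many norms occur
([trajectory_exists]).

The three methods are instances. The variational method is the resolvent of
the subdifferential at f, by first-order optimality. The gradient flow is the
trajectory of the subdifferential from f, and the inverse scale space flow is
the trajectory from 0 of the operator q |-> { v - f | q in subdiff J v }. Any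
other solution of one of the flows agrees with the broken line, because the
distance of two solutions of a monotone evolution does not increase
([monotone_flow_unique]).

The last slope of each of the three broken lines is 0, and P_0 f is the final
value of u for the first two methods and the initial value of v for the third:
subgradients are orthogonal to the kernel of J. The distributional derivative
of a step function is a finite sum of peaks ([step_pairing]), and summation by
parts evaluates the sum of the phi_i to f - P_0 f. Such a sum of peaks is a
vector measure carried by finitely many points, which has an evident polar
decomposition ([point_masses_polar]); in an arbitrary one, pairing with narrow
tents around a point shows that phi_i is the mass of 1/t_i times psi(1/t_i)
([polar_point]). The substitution s = 1/t preserves absolute continuity
([primitive_inversion]) and exchanges the wavelength and the frequency
representation. *)

(** * The Euclidean scalar product *)

Section EuclideanSpace.
Variables (R : realType) (n : nat).
Notation V := 'rV[R]_n.
Implicit Types (u v w : V) (a : R).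

Lemma dotpC u v : dotp u v = dotp v u.
Proof. by apply: eq_bigr => j _; rewrite mulrC. Qed.

Lemma dotpDl u v w : dotp (u + v) w = dotp u w + dotp v w.
Proof. by rewrite -big_split; apply: eq_bigr => j _; rewrite mxE mulrDl. Qed.

Lemma dotpZl a u v : dotp (a *: u) v = a * dotp u v.
Proof. by rewrite mulr_sumr; apply: eq_bigr => j _; rewrite mxE mulrA. Qed.

Lemma dotpNl u v : dotp (- u) v = - dotp u v.
Proof. by rewrite -scaleN1r dotpZl mulN1r. Qed.

Lemma dotpDr u v w : dotp u (v + w) = dotp u v + dotp u w.
Proof. by rewrite dotpC dotpDl !(dotpC u). Qed.

Lemma dotpZr a u v : dotp u (a *: v) = a * dotp u v.
Proof. by rewrite dotpC dotpZl dotpC. Qed.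

Lemma dotpNr u v : dotp u (- v) = - dotp u v.
Proof. by rewrite dotpC dotpNl dotpC. Qed.

Lemma dotp0l v : dotp 0 v = 0.
Proof. by rewrite -(scale0r (0 : V)) dotpZl mul0r. Qed.

Lemma dotp0r v : dotp v 0 = 0.
Proof. by rewrite dotpC dotp0l. Qed.

Definition dotpE := (dotpDl, dotpDr, dotpNl, dotpNr, dotpZl, dotpZr,
                     dotp0l, dotp0r).

Lemma dotp_suml I (r : seq I) (P : pred I) (F : I -> V) v :
  dotp (\sum_(i <- r | P i) F i) v = \sum_(i <- r | P i) dotp (F i) v.
Proof.
by elim/big_rec2: _ => [|i y1 y2 _ <-]; rewrite ?dotp0l // dotpDl.
Qed.

Lemma dotp_ge0 u : 0 <= dotp u u.
Proof. by apply: sumr_ge0 => j _; rewrite -expr2 sqr_ge0. Qed.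

Lemma sqr_coord_le u j : u 0 j ^+ 2 <= dotp u u.
Proof.
rewrite /dotp (bigD1 j) //= -expr2 lerDl sumr_ge0 // => i _.
by rewrite -expr2 sqr_ge0.
Qed.

Lemma dotp_le0 u : dotp u u <= 0 -> u = 0.
Proof.
move=> u0; apply/rowP => j; rewrite mxE; apply/eqP.
rewrite -sqrf_eq0 eq_le sqr_ge0 andbT.
exact: le_trans (sqr_coord_le u j) u0.
Qed.

Lemma enorm_sqr u : enorm u ^+ 2 = dotp u u.
Proof. by rewrite sqr_sqrtr // dotp_ge0. Qed.

Lemma dotp_delta v j : dotp v (delta_mx 0 j) = v 0 j.
Proof.
rewrite /dotp (bigD1 j) //= mxE !eqxx mulr1 big1 ?addr0 // => i ij.
by rewrite mxE (negbTE ij) andbF mulr0.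
Qed.

End EuclideanSpace.

(** * Proximal points *)

Section Minimisers.
Variables (R : realType) (n : nat).
Notation V := 'rV[R]_n.
Implicit Types (u v w f : V) (J F : V -> \bar R).

(** A minimising sequence stays in a compact sublevel set, and a cluster point
of it lies in each closed sublevel set that contains a tail. *)
Lemma closed_sublevel_minimiser F : (forall u, 0 <= F u)%E ->
  (forall a : R, closed [set u | (F u <= a%:E)%E]) ->
  (forall a : R, bounded_set [set u | (F u <= a%:E)%E]) ->
  (exists u, F u < +oo)%E -> exists u, forall w, (F u <= F w)%E.
Proof.
move=> F_ge0 Fcl Fbd [u0 Fu0].
set m := ereal_inf (range F).
have m_ge0 : (0 <= m)%E by apply/ereal_infP => _ [u _ <-].
have m_fin : m \is a fin_num.
  rewrite ge0_fin_numE //; apply: le_lt_trans Fu0.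
  by apply: ereal_inf_lbound; exists u0.
have /choice[x xP] : forall k : nat, exists u, (F u <= (fine m + k.+1%:R^-1)%:E)%E.
  move=> k; have : (m < (fine m + k.+1%:R^-1)%:E)%E.
    by rewrite -{1}(fineK m_fin) lte_fin ltrDl invr_gt0.
  by move=> /ereal_inf_lt[_ [u _ <-] /ltW]; exists u.
pose A k := [set u | (F u <= (fine m + k.+1%:R^-1)%:E)%E].
have Adec k l : (k <= l)%N -> A l `<=` A k.
  move=> kl u /le_trans; apply; rewrite lee_fin lerD2l lef_pV2 ?posrE //.
  by rewrite ler_nat.
have A0_compact : compact (A 0%N).
  by apply: bounded_closed_compact; [exact: Fbd|exact: Fcl].
have [|u [_ clu]] := A0_compact (x @ \oo) _.
  by exists 0%N => // k _; apply: (Adec 0%N k) => //; exact: xP.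
exists u => w.
have uA k : A k u.
  rewrite (closure_id (A k)).1; last exact: Fcl.
  move=> B nB; have [] := clu (A k) B _ nB.
    by exists k => // l kl; apply: (Adec k l) => //; exact: xP.
  by move=> y yP; exists y.
suff Fum : (F u <= m)%E.
  by apply: le_trans Fum _; apply: ereal_inf_lbound; exists w.
apply/lee_addgt0Pr => e e0; rewrite -(fineK m_fin).
have [k _ ke] := near_infty_natSinv_lt (PosNum e0).
apply: le_trans (uA k) _; rewrite -EFinD lee_fin lerD2l ltW //.
by have := ke k (leqnn k).
Qed.

Lemma continuous_sqdist f : continuous (fun u : V => dotp (u - f) (u - f)).
Proof.
have cj j : continuous (fun v : V => (v - f) 0 j).
  have -> : (fun v : V => (v - f) 0 j) = (fun v => v 0 j - f 0 j).
    by apply/funext => v; rewrite !mxE.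
  move=> u; apply: (@continuousB _ R^o); last exact: cst_continuous.
  exact: coord_continuous.
apply: (continuous_big (op := +%R)) => [|j _ u]; first exact: add_continuous.
by apply: continuousM; exact: cj.
Qed.

Lemma lsc_proximal J f (t : R) : (forall u, 0 <= J u)%E ->
  lower_semicontinuous J -> 0 < t ->
  lower_semicontinuous
    (fun u => (2^-1 * dotp (u - f) (u - f))%:E + t%:E * J u)%E.
Proof.
move=> J_ge0 J_lsc t0 x a.
set D := fun u : V => 2^-1 * dotp (u - f) (u - f).
have Dc : {for x, continuous D}.
  by apply: continuousM; [exact: cst_continuous|exact: continuous_sqdist].
have D0 u : 0 <= D u by rewrite mulr_ge0 ?dotp_ge0 ?invr_ge0.
(* Near x, the quadratic part stays above b and J above r. *)
have lb r b : (r%:E < J x)%E -> a <= b + t * r -> b < D x ->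
  exists2 B, nbhs x B & forall y, B y -> (a%:E < (D y)%:E + t%:E * J y)%E.
  move=> /J_lsc[B nB rB] ab bD.
  exists (B `&` [set y | b < D y]).
    by apply: filterI => //; exact: (cvgr_gt _ Dc).
  move=> y [/rB rJ /= bDy]; apply: (@lt_le_trans _ _ ((D y)%:E + (t * r)%:E)%E).
    rewrite -EFinD lte_fin; lra.
  by rewrite leeD2lE // EFinM lee_pmul2l // ltW.
case Jx: (J x) => [r| |]; last by have := J_ge0 x; rewrite Jx.
- rewrite -EFinM -EFinD lte_fin -/(D x) => ad.
  have [d [d0 dE]] : exists d, 0 < d /\ 2 * d = D x + t * r - a.
    by exists ((D x + t * r - a) / 2); split; lra.
  apply: (lb (r - d / t) (D x - d)); last by lra.
    by rewrite Jx lte_fin ltrBlDr ltrDl divr_gt0.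
  have -> : D x - d + t * (r - d / t) = D x + t * r - 2 * d.
    by field; rewrite gt_eqF.
  lra.
- move=> _; apply: (lb ((a + 1) / t) (D x - 1)); rewrite ?Jx ?ltry //; last lra.
  rewrite mulrCA divff ?gt_eqF // mulr1; have := D0 x; lra.
Qed.

Lemma proximal_minimiser J f (t : R) : (forall u, 0 <= J u)%E ->
  J 0 = 0%E -> lower_semicontinuous J -> 0 < t ->
  exists u, forall w,
    ((2^-1 * dotp (u - f) (u - f))%:E + t%:E * J u <=
     (2^-1 * dotp (w - f) (w - f))%:E + t%:E * J w)%E.
Proof.
move=> J_ge0 J0 J_lsc t0.
have tJ0 u : (0 <= t%:E * J u)%E by rewrite mule_ge0 // lee_fin ltW.
apply: (@closed_sublevel_minimiser
  (fun u => (2^-1 * dotp (u - f) (u - f))%:E + t%:E * J u)%E).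
- by move=> u; rewrite adde_ge0 // lee_fin mulr_ge0 ?dotp_ge0 ?invr_ge0.
- move=> a; rewrite -openC.
  have := (lower_semicontinuousP _).1 (lsc_proximal (f := f) J_ge0 J_lsc t0) a.
  congr (open _); apply/seteqP; split=> u /=; rewrite ltNge; first by move/negP.
  by move=> ?; apply/negP.
- move=> a.
  exists (`|f| + Num.sqrt (2 * a)); split; first exact: num_real.
  move=> M ltM u /= ua; apply: ltW; apply: le_lt_trans ltM.
  rewrite -[u](subrK f) addrC; apply: (le_trans (ler_normD _ _)).
  rewrite lerD2l.
  have ga : dotp (u - f) (u - f) <= 2 * a.
    suff : 2^-1 * dotp (u - f) (u - f) <= a by lra.
    rewrite -lee_fin; apply: le_trans ua.
    by rewrite leeDl.
  rewrite -[leLHS]/(mx_norm _) mx_normrE; apply/bigmax_leP; split.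
    by rewrite sqrtr_ge0.
  move=> [i j] _ /=; rewrite ord1 -sqrtr_sqr ler_wsqrtr //.
  exact: le_trans (sqr_coord_le _ _) ga.
- by exists 0; rewrite J0 mule0 adde0 ltry.
Qed.

Lemma le_small_slope (x y c : R) :
  (forall a, 0 < a <= 1 -> x <= y + a * c) -> x <= y.
Proof.
move=> H; rewrite leNgt; apply/negP => yx.
have [c0|c0] := leP c 0; first by have := H 1; rewrite ltr01 lexx => /(_ isT); lra.
pose a := Num.min 1 ((x - y) / (2 * c)).
have a0 : 0 < a by rewrite lt_min ltr01 divr_gt0 //; lra.
have a1 : a <= 1 by rewrite ge_min lexx.
have ac : a * c <= (x - y) / 2.
  have : a <= (x - y) / (2 * c) by rewrite ge_min lexx orbT.
  rewrite -(ler_pM2r c0) => /le_trans; apply.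
  by rewrite le_eqVlt; apply/orP; left; apply/eqP; field; rewrite gt_eqF.
have := H a; rewrite a0 a1 => /(_ isT); lra.
Qed.

(** First-order optimality: compare the minimiser with a point of the segment
to the competitor, close to the minimiser. *)
Lemma proximal_subdiff J f (t : R) u : (forall u, 0 <= J u)%E ->
  J 0 = 0%E -> convex_ereal J -> 0 < t ->
  (forall w, ((2^-1 * dotp (u - f) (u - f))%:E + t%:E * J u <=
     (2^-1 * dotp (w - f) (w - f))%:E + t%:E * J w)%E) ->
  subdiff J u (t^-1 *: (f - u)).
Proof.
move=> J_ge0 J0 J_cvx t0 umin w.
have Ju_fin : J u \is a fin_num.
  rewrite ge0_fin_numE // ltey; apply/eqP => Ju.
  by have := umin 0; rewrite Ju J0 mule0 adde0 gt0_muley.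
have [Jw|] := eqVneq (J w) +oo%E; first by rewrite Jw leey.
rewrite -ltey => Jw; have Jw_fin : J w \is a fin_num by rewrite ge0_fin_numE.
rewrite -(fineK Ju_fin) -(fineK Jw_fin) -EFinD lee_fin dotpZl.
set a := fine (J u); set b := fine (J w).
suff H : t * (a - b) <= dotp (u - f) (w - u).
  rewrite -(ler_pM2l t0) mulrDr mulrA divff ?gt_eqF // mul1r.
  have -> : f - u = - (u - f) by rewrite opprB.
  rewrite dotpNl; lra.
apply: (@le_small_slope _ _ (2^-1 * dotp (w - u) (w - u))) => s /andP[s0 s1].
have := umin (s *: w + (1 - s) *: u).
have := J_cvx w u s; rewrite ltW // s1 => /(_ isT).
rewrite -(fineK Ju_fin) -(fineK Jw_fin) -/a -/b -!EFinM -EFinD => Jz.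
have Jz_fin : J (s *: w + (1 - s) *: u) \is a fin_num.
  by rewrite ge0_fin_numE //; apply: le_lt_trans Jz (ltry _).
move: Jz; rewrite -(fineK Jz_fin) -!EFinM -!EFinD !lee_fin.
set c := fine _ => Jz.
have -> : s *: w + (1 - s) *: u - f = (u - f) + s *: (w - u).
  by apply/rowP => j; rewrite !mxE; ring.
move: (u - f) (w - u) => x y; rewrite !dotpE (dotpC y x) => H.
rewrite -(ler_pM2l s0); have : t * c <= t * (s * b + (1 - s) * a).
  by rewrite ler_pM2l.
move=> H2; lra.
Qed.

(** The value at w exceeds the value at u by at least half the squared
distance of u and w: add the subgradient inequality to the expansion of the
quadratic part at u. *)
Lemma subdiff_proximal J f (t : R) u p w : (forall u, 0 <= J u)%E ->
  J 0 = 0%E -> 0 < t -> subdiff J u p -> f = u + t *: p ->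
  ((2^-1 * dotp (u - f) (u - f))%:E + t%:E * J u <=
   (2^-1 * dotp (w - f) (w - f))%:E + t%:E * J w)%E.
Proof.
move=> J_ge0 J0 t0 up ->.
have := up w; have := up 0; rewrite J0.
have := J_ge0 w; have := J_ge0 u.
case: (J u) => [a| |] //; case: (J w) => [b| |] //.
  rewrite -!EFinM -!EFinD !lee_fin => _ _ _.
  rewrite (_ : u - (u + t *: p) = - (t *: p)); last by rewrite opprD addNKr.
  rewrite (_ : w - (u + t *: p) = (w - u) - t *: p); last by rewrite opprD addrA.
  move: (w - u) => d; rewrite !dotpE (dotpC d p) => H.
  have := dotp_ge0 d.
  have : t * (a + dotp p d) <= t * b by rewrite ler_pM2l.
  lra.
by move=> _ _ _ _; rewrite gt0_muley ?lte_fin // addey // leey.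
Qed.

Lemma resolvent_exists J f (t : R) : (forall u, 0 <= J u)%E ->
  J 0 = 0%E -> convex_ereal J -> lower_semicontinuous J -> 0 < t ->
  exists u p, subdiff J u p /\ f = u + t *: p.
Proof.
move=> J_ge0 J0 J_cvx J_lsc t0.
have [u umin] := proximal_minimiser f J_ge0 J0 J_lsc t0.
exists u, (t^-1 *: (f - u)); split; first exact: proximal_subdiff.
by rewrite scalerA divff ?gt_eqF // scale1r addrC subrK.
Qed.

End Minimisers.

(** * Polyhedral seminorms *)

Section PolyhedralSeminorm.
Variables (R : realType) (n : nat) (J : 'rV[R]_n -> \bar R) (S : seq 'rV[R]_n).
Notation V := 'rV[R]_n.
Hypothesis J_ge0 : forall u, (0 <= J u)%E.
Hypothesis J_convex : convex_ereal J.
Hypothesis J_lsc : lower_semicontinuous J.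
Hypothesis J_homogeneous : abs_one_homogeneous J.
Hypothesis J_hull : conv_hull S = subdiff J 0.
Implicit Types (u v w p q : V).
Local Notation m := (size S).

Lemma seminorm0 : J 0 = 0%E.
Proof. by rewrite -(scale0r (0 : V)) J_homogeneous normr0 mul0e. Qed.

Lemma subdiff0P p : subdiff J 0 p <-> forall w, ((dotp p w)%:E <= J w)%E.
Proof. by split=> pw w; have := pw w; rewrite seminorm0 add0e subr0. Qed.

(** The subgradient inequality at 0 and at 2 u bounds J u from both sides. *)
Lemma subdiff_homogeneousP u p :
  subdiff J u p <-> subdiff J 0 p /\ J u = (dotp p u)%:E.
Proof.
split=> [up|[/subdiff0P pK Ju] w]; last first.
  by rewrite Ju -EFinD dotpDr dotpNr addrC subrK.
have Ju : J u = (dotp p u)%:E.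
  have := up 0; have := up (2 *: u); rewrite seminorm0 J_homogeneous.
  have -> : 2 *: u - u = u by rewrite scaler_nat mulr2n addrK.
  rewrite normr_nat sub0r dotpNr; have := J_ge0 u; case: (J u) => [a| |] //.
  rewrite -!EFinM -!EFinD !lee_fin => _ ap pa; congr EFin; lra.
split=> //; apply/subdiff0P => w; have := up w; rewrite Ju dotpDr dotpNr -EFinD.
by rewrite addrC subrK.
Qed.

Lemma subdiff_ge0 u p : subdiff J u p -> 0 <= dotp p u.
Proof. by case/subdiff_homogeneousP => _ Ju; have := J_ge0 u; rewrite Ju. Qed.

Lemma subdiff_monotone u v p q : subdiff J u p -> subdiff J v q ->
  0 <= dotp (p - q) (u - v).
Proof.
move=> /subdiff_homogeneousP[/subdiff0P pK Ju].
move=> /subdiff_homogeneousP[/subdiff0P qK Jv].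
have := pK v; have := qK u; rewrite Ju Jv !lee_fin !dotpE; lra.
Qed.

Lemma generator_subdiff0 (i : 'I_m) : subdiff J 0 S`_i.
Proof.
rewrite -J_hull; exists (fun k => (k == i)%:R); split.
- by move=> k; rewrite ler0n.
- by rewrite (bigD1 i) //= eqxx big1 ?addr0 // => k /negbTE ->.
- rewrite (bigD1 i) //= eqxx scale1r big1 ?addr0 // => k /negbTE ->.
  by rewrite scale0r.
Qed.

Lemma subdiff00 : subdiff J 0 0.
Proof. by apply/subdiff0P => w; rewrite dotp0l. Qed.

Lemma active_generator u :
  exists i : 'I_m, forall k : 'I_m, dotp S`_k u <= dotp S`_i u.
Proof.
have : (0 < m)%N.
  rewrite lt0n; apply/eqP => m0; have := subdiff00; rewrite -J_hull.
  case=> a [_ a1 _]; have := a1; rewrite big1.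
    by move/eqP; rewrite eq_sym oner_eq0.
  by move=> [i im] _; exfalso; move: im; rewrite m0.
move=> m0; have i0 : 'I_m := Ordinal m0.
have [i _ iP] := @arg_maxP _ _ _ i0 xpredT (fun i : 'I_m => dotp S`_i u) isT.
by exists i => k; exact: iP.
Qed.

Lemma dotp_hull_le u p (c : R) : subdiff J 0 p ->
  (forall k : 'I_m, dotp S`_k u <= c) -> dotp p u <= c.
Proof.
rewrite -J_hull => -[a [a0 a1 ->]] Sc; rewrite dotp_suml -[c]mul1r -a1 mulr_suml.
by apply: ler_sum => i _; rewrite dotpZl ler_wpM2l.
Qed.

(** Coordinates, being linear, are bounded on conv S by their values on S. *)
Lemma hull_bounded : exists2 B : R, 0 < B &
  forall p j, subdiff J 0 p -> `|p 0 j| <= B.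
Proof.
pose B : R := \sum_(k < m) \sum_(j < n) `|S`_k 0 j|.
have B0 : 0 <= B by apply: sumr_ge0 => k _; apply: sumr_ge0.
have SB (k : 'I_m) j : `|S`_k 0 j| <= B.
  rewrite /B (bigD1 k) //= (bigD1 j) //= -addrA lerDl addr_ge0 ?sumr_ge0 //.
  by move=> i _; apply: sumr_ge0.
exists (B + 1); first by rewrite ltr_wpDl.
move=> p j pK; apply: (@le_trans _ _ B); last by rewrite lerDl.
rewrite ler_norml -dotp_delta (dotp_hull_le pK); last first.
  by move=> k; rewrite dotp_delta; apply: le_trans (ler_norm _) (SB k j).
rewrite lerNl -dotpNr (dotp_hull_le pK) // => k.
by rewrite dotpNr dotp_delta; apply: le_trans (SB k j); rewrite -normrN ler_norm.
Qed.

(** The functional is the support function of its subdifferential at 0: with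
u_t the proximal points of u and p_t = (u - u_t) / t, boundedness of p_t in
conv S gives u_t -> u as t -> 0, J u_t = <p_t, u_t> is at most the maximum of
the <s, u>, and lower semicontinuity passes this bound to the limit. *)
Lemma seminorm_active u (i : 'I_m) :
  (forall k : 'I_m, dotp S`_k u <= dotp S`_i u) -> J u = (dotp S`_i u)%:E.
Proof.
move=> iP; apply/eqP; rewrite eq_le; apply/andP; split; last first.
  by move/subdiff0P: (generator_subdiff0 i); exact.
rewrite leNgt; apply/negP => /J_lsc[U /nbhs_ballP[e /= e0 eU] UJ].
have [B B0 KB] := hull_bounded.
pose t := e / (2 * B).
have t0 : 0 < t by rewrite divr_gt0 // mulr_gt0.
have [v [p [/subdiff_homogeneousP[pK Jv] uE]]] :=
  resolvent_exists u J_ge0 seminorm0 J_convex J_lsc t0.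
have vE : v = u - t *: p by rewrite uE addrK.
have : ((dotp S`_i u)%:E < J v)%E.
  apply/UJ/eU; split=> // k j; rewrite /ball /= ord1 vE !mxE opprB addrCA subrr addr0.
  rewrite normrM gtr0_norm //; apply: (@le_lt_trans _ _ (t * B)).
    by rewrite ler_pM2l // KB.
  rewrite /t invfM mulrA -mulrA mulVf ?gt_eqF // mulr1 ltr_pdivrMr //; lra.
rewrite Jv lte_fin vE dotpDr dotpNr dotpZr ltNge => /negP; apply.
rewrite lerBlDr; apply: le_trans (dotp_hull_le pK iP) _.
by rewrite lerDl mulr_ge0 ?dotp_ge0 // ltW.
Qed.

Lemma seminorm_hull_le u (c : R) : (forall k : 'I_m, dotp S`_k u <= c) ->
  (J u <= c%:E)%E.
Proof.
by have [i iP] := active_generator u => Sc; rewrite (seminorm_active iP) lee_fin.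
Qed.

Lemma subdiff_nonempty u : exists p, subdiff J u p.
Proof.
have [i iP] := active_generator u; exists S`_i; apply/subdiff_homogeneousP.
by split; [exact: generator_subdiff0|exact: seminorm_active].
Qed.

Definition hull_cell (I : {set 'I_m}) p := exists a : 'I_m -> R,
  [/\ forall i, 0 <= a i, \sum_i a i = 1, forall i, a i != 0 -> i \in I &
      p = \sum_i a i *: S`_i].

Definition active_cell (I : {set 'I_m}) u :=
  forall i k : 'I_m, i \in I -> dotp S`_k u <= dotp S`_i u.

(** The graph of the subdifferential is a finite union of products of convex
sets: in <p, u> = sum a_i <S_i, u> only maximal generators can have a_i > 0. *)
Lemma subdiff_cells u p :
  subdiff J u p <-> exists I, active_cell I u /\ hull_cell I p.
Proof.
split=> [/subdiff_homogeneousP[pK Ju]|[I [uI [a [a0 a1 aI pE]]]]].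
  have : conv_hull S p by rewrite J_hull.
  move=> [a [a0 a1 pE]].
  have [i0 i0P] := active_generator u.
  have gap0 (i : 'I_m) : 0 <= a i * (dotp S`_i0 u - dotp S`_i u).
    by rewrite mulr_ge0 // subr_ge0.
  have : \sum_i a i * (dotp S`_i0 u - dotp S`_i u) = 0.
    have : dotp p u = dotp S`_i0 u.
      by have := Ju; rewrite (seminorm_active i0P) => -[].
    rewrite pE dotp_suml => pu.
    transitivity (\sum_i (a i * dotp S`_i0 u - dotp (a i *: S`_i) u)).
      by apply: eq_bigr => i _; rewrite dotpZl mulrBr.
    by rewrite sumrB pu -mulr_suml a1 mul1r subrr.
  move/eqP; rewrite psumr_eq0 // => /allP gap.
  exists [set i | a i != 0]%SET; split; last by exists a; split=> // i; rewrite inE.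
  move=> i k; rewrite inE => ai.
  have := gap i; rewrite mem_index_enum => /(_ isT).
  by rewrite mulf_eq0 (negbTE ai) /= subr_eq0 => /eqP <-.
have pK : subdiff J 0 p by rewrite -J_hull; exists a.
apply/subdiff_homogeneousP; split => //.
have [i0 i0P] := active_generator u; rewrite (seminorm_active i0P); congr EFin.
rewrite pE dotp_suml -[LHS]mul1r -a1 mulr_suml; apply: eq_bigr => i _.
rewrite dotpZl; have [->|ai] := eqVneq (a i) 0; first by rewrite !mul0r.
by congr (_ * _); apply/eqP; rewrite eq_le i0P uI // aI.
Qed.

Lemma active_cell_convex I u v (a : R) : 0 <= a <= 1 ->
  active_cell I u -> active_cell I v -> active_cell I (a *: u + (1 - a) *: v).
Proof.
move=> /andP[a0 a1] uI vI i k iI; rewrite !dotpDr !dotpZr lerD //.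
  by rewrite ler_wpM2l // uI.
by rewrite ler_wpM2l ?subr_ge0 // vI.
Qed.

Lemma hull_cell_convex I p q (c : R) : 0 <= c <= 1 ->
  hull_cell I p -> hull_cell I q -> hull_cell I (c *: p + (1 - c) *: q).
Proof.
move=> /andP[c0 c1] [a [a0 a1 aI ->]] [b [b0 b1 bI ->]].
exists (fun i => c * a i + (1 - c) * b i); split.
- by move=> i; rewrite addr_ge0 // mulr_ge0 // subr_ge0.
- by rewrite big_split /= -!mulr_sumr a1 b1 !mulr1 addrC subrK.
- move=> i; apply: contraR => iI.
  have [ai|/aI] := eqVneq (a i) 0; last by rewrite (negbTE iI).
  have [bi|/bI] := eqVneq (b i) 0; last by rewrite (negbTE iI).
  by rewrite ai bi !mulr0 addr0.
- rewrite !scaler_sumr -big_split; apply: eq_bigr => i _.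
  by rewrite !scalerA scalerDl.
Qed.

End PolyhedralSeminorm.

(** * Broken lines *)

Section BrokenLines.
Variables (R : realType) (n : nat).
Notation V := 'rV[R]_n.
Implicit Types (u : R -> V) (t : nat -> R) (c : nat -> V).

Definition increasing_times (N : nat) t := forall i, (i <= N)%N -> t i < t i.+1.

Definition closed_piece (N : nat) t (i : nat) (r : R) :=
  t i <= r /\ ((i < N)%N -> r <= t i.+1).

Definition broken_line u (N : nat) t c := forall i r, (i <= N)%N ->
  closed_piece N t i r -> u r = u (t i) + (r - t i) *: c i.

Lemma increasing_times_mono N t i k : increasing_times N t ->
  (i < k <= N.+1)%N -> t i < t k.
Proof.
move=> tP; elim: k => // k IHk; rewrite ltnS => /andP[].
rewrite leq_eqVlt => /orP[/eqP-> kN|ik kN]; first exact: tP.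
by apply: lt_trans (tP _ _) => //; apply: IHk; rewrite ik ltnW.
Qed.

Lemma increasing_times_le N t i k : increasing_times N t ->
  (i <= k <= N.+1)%N -> t i <= t k.
Proof.
move=> tP /andP[]; rewrite leq_eqVlt => /orP[/eqP-> //|ik kN].
by rewrite ltW // (increasing_times_mono tP) // ik.
Qed.

Lemma closed_piece_exists N t (r : R) : t 0%N <= r ->
  exists2 i, (i <= N)%N & closed_piece N t i r.
Proof.
move=> tr; suff H k : (k <= N)%N -> t k <= r \/
    exists2 i, (i <= N)%N & closed_piece N t i r.
  have [//|tNr|//] := H N; by exists N => //; split=> //; rewrite ltnn.
elim: k => [|k IHk] kN; first by left.
have [tkr|] := IHk (ltnW kN); last by right.
have [rk|kr] := leP r (t k.+1); last by left; exact: ltW.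
by right; exists k; [exact: ltnW|split].
Qed.

Lemma piece_exists N t (r : R) : t 0%N < r ->
  exists2 i, (i <= N)%N & piece N t i r.
Proof.
move=> tr; suff H k : (k <= N)%N -> t k < r \/
    exists2 i, (i <= N)%N & piece N t i r.
  have [//|tNr|//] := H N; by exists N => //; split=> //; rewrite ltnn.
elim: k => [|k IHk] kN; first by left.
have [tkr|] := IHk (ltnW kN); last by right.
have [rk|kr] := leP r (t k.+1); last by left.
by right; exists k; [exact: ltnW|split].
Qed.

Lemma piece_closed N t i (r : R) : piece N t i r -> closed_piece N t i r.
Proof. by case=> /ltW. Qed.

(** Merge adjacent pieces of equal slope; each merger lowers N. *)
Lemma broken_line_reduced u N t c : increasing_times N t ->
  broken_line u N t c ->
  exists N' t' c', [/\ t' 0%N = t 0%N, increasing_times N' t',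
    broken_line u N' t' c' & forall i, (i < N')%N -> c' i != c' i.+1].
Proof.
move: N t c; elim=> [|N IHN] t c tP uP.
  by exists 0%N, t, c; split.
have [[i iN ci]|cP] := pselect (exists2 i, (i < N.+1)%N & c i = c i.+1);
    last first.
  exists N.+1, t, c; split=> // i iN; apply/eqP => ci; apply: cP; by exists i.
pose t' j := if (j <= i)%N then t j else t j.+1.
pose c' j := if (j <= i)%N then c j else c j.+1.
have [] := IHN t' c'.
- move=> j jN; rewrite /t'; case: (ltngtP j i) => [ji|ij|->].
  + by apply: tP; exact: leqW.
  + by apply: tP.
  + by apply: (increasing_times_mono tP); rewrite ltnS leqnSn ltnS.
- move=> j r jN; rewrite /closed_piece /t' /c'; case: (ltngtP j i) => [ji|ij|->].
  + move=> [tr rt]; apply: uP; first exact: leqW.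
    by split=> // _; apply: rt; exact: leq_trans ji _.
  + by move=> [tr rt]; apply: uP.
  + move=> [tr rt].
    have [rs|sr] := leP r (t i.+1); first by apply: uP; [exact: ltnW|split].
    have -> : u r = u (t i.+1) + (r - t i.+1) *: c i.+1.
      by apply: uP => //; split; [exact: ltW|move=> ?; apply: rt].
    rewrite (uP i (t i.+1)) ?(ltnW iN) //; last by split=> //; rewrite ltW ?tP // ltnW.
    by rewrite -addrA -ci -scalerDl; congr (_ + _ *: _); ring.
- by move=> N' [t'' [c'' [t0 ? ? ?]]]; exists N', t'', c''.
Qed.

(** Truncated powers: the formula exhibits a broken line as an element of a
vector space, which reduces its calculus to that of r |-> max (r - a) 0. *)
Definition polyline (u0 : V) (N : nat) t c (r : R) : V :=
  u0 + (r - t 0%N) *: c 0%N +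
  \sum_(k < N) Num.max (r - t k.+1) 0 *: (c k.+1 - c k).

Lemma telescope_lt (N i : nat) c : (i <= N)%N ->
  \sum_(k < N | (k < i)%N) (c k.+1 - c k) = c i - c 0%N.
Proof.
move=> iN; rewrite -(big_ord_widen N (fun k => c k.+1 - c k) iN).
by rewrite -(big_mkord xpredT (fun k => c k.+1 - c k)) telescope_sumr.
Qed.

Lemma polyline_broken_line (u0 : V) N t c : increasing_times N t ->
  broken_line (polyline u0 N t c) N t c.
Proof.
move=> tP i r iN [tir rti].
have E s : t i <= s -> ((i < N)%N -> s <= t i.+1) ->
    polyline u0 N t c s = u0 + (s - t 0%N) *: c 0%N +
      \sum_(k < N | (k < i)%N) (s - t k.+1) *: (c k.+1 - c k).
  move=> tis sti; rewrite /polyline [in RHS]big_mkcond; congr (_ + _).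
  apply: eq_bigr => k _; case: ltnP => ki.
    rewrite max_l // subr_ge0; apply: le_trans tis.
    by apply: (increasing_times_le tP); rewrite ki leqW.
  have iN' : (i < N)%N := leq_ltn_trans ki (ltn_ord k).
  rewrite max_r ?scale0r // subr_le0; apply: le_trans (sti iN') _.
  by apply: (increasing_times_le tP); rewrite !ltnS ki ltnW.
rewrite (E r) // (E (t i)) //; last by move=> /ltnW/tP/ltW.
apply/eqP; rewrite -subr_eq0; apply/eqP.
transitivity ((r - t i) *: (c 0%N + \sum_(k < N | (k < i)%N) (c k.+1 - c k)
   - c i)); last first.
  by rewrite telescope_lt // (addrC (c 0%N)) subrK subrr scaler0.
rewrite scalerBr scalerDr scaler_sumr.
have -> : \sum_(k < N | (k < i)%N) (r - t i) *: (c k.+1 - c k) =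
    \sum_(k < N | (k < i)%N) (r - t k.+1) *: (c k.+1 - c k) -
    \sum_(k < N | (k < i)%N) (t i - t k.+1) *: (c k.+1 - c k).
  rewrite -sumrB; apply: eq_bigr => k _; rewrite -scalerBl.
  by congr (_ *: _); ring.
move: (\sum_(k < N | _) _) (\sum_(k < N | _) _) => x y.
by apply/rowP => j; rewrite !mxE; ring.
Qed.

Lemma polyline0 (u0 : V) N t c : increasing_times N t ->
  polyline u0 N t c (t 0%N) = u0.
Proof.
move=> tP; rewrite /polyline subrr scale0r addr0 big1 ?addr0 // => k _.
rewrite max_r ?scale0r // subr_le0 (increasing_times_le tP) //.
by rewrite /= ltnS ltnW.
Qed.

Lemma broken_line_ext u v N t c : increasing_times N t ->
  broken_line u N t c -> broken_line v N t c -> u (t 0%N) = v (t 0%N) ->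
  forall r, t 0%N <= r -> u r = v r.
Proof.
move=> tP uP vP uv.
have {}uv i : (i <= N)%N -> u (t i) = v (t i).
  elim: i => [//|i IHi] iN.
  have ti : closed_piece N t i (t i.+1) by split=> //; rewrite ltW // tP // ltnW.
  by rewrite (uP i) ?(ltnW iN) // (vP i) ?(ltnW iN) // IHi // ltnW.
move=> r /(closed_piece_exists N)[i iN ri].
by rewrite (uP i) // (vP i) // uv.
Qed.

End BrokenLines.

(** * Curves that are affine on finitely many sets of parameters *)

Section AffineCover.
Variables (R : realType) (n : nat) (I : finType).
Notation V := 'rV[R]_n.
Variables (u : R -> V) (T : I -> R -> Prop) (a0 : R).
Hypothesis T_convex : forall i x y r, T i x -> T i y -> x <= r <= y -> T i r.
Hypothesis u_affine : forall i x y r, T i x -> T i y -> x <= r <= y ->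
  (y - x) *: (u r - u x) = (r - x) *: (u y - u x).
Hypothesis u_lipschitz : forall x, a0 <= x ->
  exists L : R, forall y j, a0 <= y -> `|u y 0 j - u x 0 j| <= L * `|y - x|.

(** The slope is read off at two interior points; the Lipschitz bound extends
the affine formula to the end points. *)
Lemma affine_closure (i : I) (a : R) (b : R) : a0 <= a -> a < b ->
  (forall r, a < r < b -> T i r) ->
  exists c, forall r, a <= r <= b -> u r = u a + (r - a) *: c.
Proof.
move=> a0a ab Tab.
pose x := a + (b - a) / 3; pose y := a + 2 * (b - a) / 3.
have [ax [xy yb]] : a < x /\ x < y /\ y < b by rewrite /x /y; split; [|split]; lra.
clearbody x y.
pose c := (y - x)^-1 *: (u y - u x).
have yx0 : y - x != 0 by rewrite subr_eq0 gt_eqF.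
have lin j r : a < r < b -> u r 0 j = u x 0 j + (r - x) * c 0 j.
  move=> /andP[ar rb].
  have E p q s : a < p -> q < b -> p <= s -> s <= q ->
      (q - p) * (u s 0 j - u p 0 j) = (s - p) * (u q 0 j - u p 0 j).
    move=> ap qb ps sq.
    have := @u_affine i p q s; move=> /(_ _ _ _)/(congr1 (fun v : V => v 0 j)).
    rewrite !mxE; apply; rewrite ?ps //; apply: Tab; apply/andP; split; lra.
  rewrite /c !mxE; apply: (mulfI yx0); rewrite mulrDr (mulrCA (y - x)) mulVKf //.
  have [rx|xr] := leP r x.
    have := E r y x; rewrite ar yb rx (ltW xy) => /(_ isT isT isT isT); lra.
  have [ry|yr] := leP r y.
    have := E x y r; rewrite ax yb ry (ltW xr) => /(_ isT isT isT isT); lra.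
  have := E x r y; rewrite ax rb (ltW xy) (ltW yr) => /(_ isT isT isT isT); lra.
have lim r j : a <= r <= b -> u r 0 j = u x 0 j + (r - x) * c 0 j.
  move=> /andP[ar rb].
  have [L Lr] := u_lipschitz (le_trans a0a ar).
  apply/eqP; rewrite -subr_eq0 -normr_le0.
  pose m := (a + b) / 2; pose C := `|L * (m - r)| + `|(m - r) * c 0 j|.
  apply: (@le_small_slope _ _ _ C) => s /andP[s0 s1]; rewrite add0r.
  have sE : a < r + s * (m - r) < b.
    have -> : r + s * (m - r) = (1 - s) * r + s * m by ring.
    have sm1 : s * a < s * m by rewrite ltr_pM2l // /m; lra.
    have sm2 : s * m < s * b by rewrite ltr_pM2l // /m; lra.
    have sr1 : (1 - s) * a <= (1 - s) * r by rewrite ler_wpM2l // subr_ge0.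
    have sr2 : (1 - s) * r <= (1 - s) * b by rewrite ler_wpM2l // subr_ge0.
    apply/andP; split; lra.
  have := Lr (r + s * (m - r)) j; rewrite (lin j _ sE) => H.
  have {}H : `|u x 0 j + (r + s * (m - r) - x) * c 0 j - u r 0 j| <=
      L * `|s * (m - r)|.
    have -> : s * (m - r) = r + s * (m - r) - r by ring.
    rewrite [in X in `|X + _|](_ : r + (_ - r) = r + s * (m - r)); last by ring.
    by apply: H; apply: (le_trans a0a); rewrite ltW //; case/andP: sE.
  rewrite distrC.
  have -> : u x 0 j + (r - x) * c 0 j - u r 0 j =
    (u x 0 j + (r + s * (m - r) - x) * c 0 j - u r 0 j) -
    s * ((m - r) * c 0 j) by ring.
  apply: le_trans (ler_normB _ _) _.
  rewrite /C [leRHS]mulrDr; apply: lerD.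
    apply: le_trans H _; rewrite !normrM (gtr0_norm s0) mulrCA ler_pM2l //.
    by rewrite ler_wpM2r // ler_norm.
  by rewrite normrM (gtr0_norm s0).
exists c => r rab; apply/rowP => j; rewrite !mxE (lim r) // (lim a) ?lexx ?ltW //.
rewrite /c !mxE; ring.
Qed.

(** One of the sets accumulates at a from the right; being convex, it contains
]a, b[ for its supremum b, possibly infinite, and the first piece ends at b.
Beyond b the other sets form a cover. *)
Lemma affine_cover_broken_line (k : nat) (A : {set I}) (a : R) : #|A| = k ->
  a0 <= a -> (forall r, a < r -> exists2 i, i \in A & T i r) ->
  exists N t c, [/\ t 0%N = a, increasing_times N t & broken_line u N t c].
Proof.
elim: k A a => [|k IHk] A a.
  move/eqP; rewrite cards_eq0 => /eqP -> _ /(_ (a + 1)).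
  by rewrite ltrDl ltr01 => /(_ isT)[i]; rewrite inE.
move=> Ak a0a cov.
have [i iA iacc] : exists2 i, i \in A &
    forall e, 0 < e -> exists2 r, T i r & a < r < a + e.
  apply: contrapT => H.
  have /choice[e eP] : forall i, exists e : R, 0 < e /\
      (i \in A -> forall r, T i r -> ~ (a < r < a + e)).
    move=> i; have [iA|iA] := boolP (i \in A); last by exists 1; split.
    apply: contrapT => He; apply: H; exists i => // e e0.
    apply: contrapT => Hr; apply: He; exists e; split=> // _ r Tr are.
    by apply: Hr; exists r.
  pose e' := \big[Num.min/1]_i e i.
  have e'0 : 0 < e' by apply: lt_bigmin => // i _; case: (eP i).
  have [|i iA Ti] := cov (a + e' / 2); first by lra.
  have [_ /(_ iA _ Ti)] := eP i; apply.
  have : e' <= e i by exact: bigmin_le_cond.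
  lra.
have [[M TM]|Tunb] := pselect (exists M, forall r, T i r -> r <= M); last first.
  have Ta r : a < r -> T i r.
    move=> ar; have [|x Tx /andP[ax xr]] := iacc (r - a); first by rewrite subr_gt0.
    have [y Ty ry] : exists2 y, T i y & r < y.
      apply: contrapT => H; apply: Tunb; exists r => y Ty; rewrite leNgt.
      by apply/negP => ry; apply: H; exists y.
    by apply: (T_convex Tx Ty); lra.
  have [||c cP] := @affine_closure i a (a + 1) a0a.
  - by rewrite ltrDl.
  - by move=> r /andP[/Ta].
  exists 0%N, (fun k => a + k%:R), (fun=> c); split.
  - by rewrite addr0.
  - by move=> [|//] _; rewrite ltrD2l ltr_nat.
  - move=> [|//] r _ [/=]; rewrite addr0 => ar _.
    have [||d dP] := @affine_closure i a (r + 1) a0a.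
    + lra.
    + by move=> x /andP[/Ta].
    pose h := Num.min 1 (r + 1 - a).
    have h0 : 0 < h by rewrite lt_min ltr01 /=; lra.
    have [h1 h2] : h <= 1 /\ h <= r + 1 - a by rewrite !ge_min !lexx orbT.
    suff -> : c = d by apply: dP; lra.
    have := dP (a + h); rewrite cP; last by lra.
    move=> /(_ _)/addrI; rewrite addrAC subrr add0r => H.
    apply: (@scalerI _ _ h); rewrite ?gt_eqF //; apply: H; lra.
have [r1 Tr1 /andP[ar1 _]] := iacc 1 ltr01.
pose b := sup [set r | T i r].
have Tsup : has_sup [set r | T i r] by split; [exists r1|exists M => r /TM].
have Tb r : T i r -> r <= b by move=> Tr; apply: sup_ubound => //; exact: Tsup.2.
have ab : a < b by apply: lt_le_trans ar1 (Tb _ Tr1).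
have [|c cP] := @affine_closure i a b a0a ab.
  move=> r /andP[ar rb].
  have [|x Tx /andP[ax xr]] := iacc (r - a); first by rewrite subr_gt0.
  have br0 : 0 < b - r by rewrite subr_gt0.
  have [y Ty] := sup_adherent br0 Tsup; rewrite subKr => ry.
  by apply: (T_convex Tx Ty); lra.
have [||| N [t [d [t0 tP dP]]]] := IHk (A :\ i) b.
- by move: Ak; rewrite (cardsD1 i) iA => -[].
- lra.
- move=> r br; have [|k' k'A Tk'] := cov r; first by lra.
  exists k' => //; rewrite !inE k'A andbT; apply/eqP => E.
  by move: Tk'; rewrite E => /Tb; rewrite leNgt br.
exists N.+1, (fun j => if j is k.+1 then t k else a),
  (fun j => if j is k.+1 then d k else c); split=> //.
- by move=> [_|j jN]; [rewrite t0|exact: tP].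
- move=> [|j] r jN [/= tr rt]; last by apply: dP.
  by apply: cP; rewrite tr -t0 rt.
Qed.

End AffineCover.

(** * Monotone operators whose graph is a finite union of products *)

Section PolyhedralOperator.
Variables (R : realType) (n : nat) (I : finType).
Notation V := 'rV[R]_n.
Variables (A : V -> V -> Prop) (Q X : I -> V -> Prop).
Hypothesis A_cells : forall w x, A w x <-> exists i, Q i w /\ X i x.
Hypothesis Q_convex : forall i x y (a : R), 0 <= a <= 1 ->
  Q i x -> Q i y -> Q i (a *: x + (1 - a) *: y).
Hypothesis X_convex : forall i x y (a : R), 0 <= a <= 1 ->
  X i x -> X i y -> X i (a *: x + (1 - a) *: y).
Hypothesis A_monotone : forall w z x y, A w x -> A z y ->
  0 <= dotp (x - y) (w - z).
Hypothesis A_closed : forall w z x,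
  (forall s : R, 0 < s < 1 -> A (w + s *: (z - w)) x) -> A w x.
Hypothesis A_resolvent : forall w p (t : R), 0 < t -> A w p ->
  exists x q, A x q /\ w = x + t *: q.
Implicit Types (u : R -> V) (w x y z p q m : V) (t : nat -> R) (c : nat -> V).

Lemma resolvent_unique x y p q (t : R) : 0 <= t ->
  A x p -> A y q -> x + t *: p = y + t *: q -> x = y.
Proof.
move=> t0 xp yq E; apply/eqP; rewrite -subr_eq0; apply/eqP/dotp_le0.
have xyE : x - y = - (t *: (p - q)).
  by apply/rowP => j; move/rowP/(_ j): E; rewrite !mxE; lra.
rewrite {1}xyE dotpNl dotpZl oppr_le0 mulr_ge0 //; exact: A_monotone.
Qed.

(** If x and y belong to a cell, with values p and q, then so does any convex
combination of x and y, with a convex combination of p and q as value. The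
weights b and 1 - b of p and q are those for which r s = a x p + (1 - a) y q. *)
Lemma resolvent_cell_mid w u i (x y a : R) :
  (forall r, 0 <= r -> exists p, A (u r) p /\ w = u r + r *: p) ->
  0 < x -> 0 < y -> 0 <= a <= 1 ->
  (exists p, [/\ Q i (u x), X i p & w = u x + x *: p]) ->
  (exists p, [/\ Q i (u y), X i p & w = u y + y *: p]) ->
  let r := a * x + (1 - a) * y in
  u r = a *: u x + (1 - a) *: u y /\
  (exists p, [/\ Q i (u r), X i p & w = u r + r *: p]).
Proof.
move=> uP x0 y0 a01 [p [Qx Xp wx]] [q [Qy Xq wy]] r.
have [a0 a1] := andP a01.
have r0 : 0 < r.
  rewrite /r; have [->|an0] := eqVneq a 0; first by rewrite mul0r add0r subr0 mul1r.
  have ax : 0 < a * x by rewrite mulr_gt0 // lt0r an0.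
  apply: ltr_pwDl => //; apply: mulr_ge0; [by rewrite subr_ge0|exact: ltW].
pose b := a * x / r.
have b01 : 0 <= b <= 1.
  rewrite divr_ge0 ?mulr_ge0 ?(ltW x0) ?(ltW r0) //= ler_pdivrMr // mul1r lerDl.
  by rewrite mulr_ge0 ?subr_ge0 // ltW.
pose v := a *: u x + (1 - a) *: u y; pose s := b *: p + (1 - b) *: q.
have Qv : Q i v by exact: Q_convex.
have Xs : X i s by exact: X_convex.
have wE : w = v + r *: s.
  have -> : r *: s = (a * x) *: p + ((1 - a) * y) *: q.
    have rb : r * b = a * x by rewrite /b mulrCA divff ?gt_eqF ?mulr1.
    by rewrite /s scalerDr !scalerA mulrBr mulr1 rb /r [_ + _ - _]addrAC subrr add0r.
  apply/rowP => j; move/rowP/(_ j): wx; move/rowP/(_ j): wy; rewrite !mxE.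
  move=> hy hx; rewrite -[LHS]mul1r -{1}(subrK a 1) mulrDl {1}hy hx; ring.
have urv : u r = v.
  have [z [Az wz]] := uP r (ltW r0).
  apply: (resolvent_unique (ltW r0) Az); last by rewrite -wz; exact: wE.
  by apply/A_cells; exists i.
by split=> //; exists s; split=> //; rewrite urv.
Qed.

(** With p the value at x, monotonicity gives |d|^2 <= (x - y) <p, d> for the
increment d, whence |d| <= |p| |y - x|. *)
Lemma resolvent_lipschitz w u (x : R) :
  (forall r, 0 <= r -> exists p, A (u r) p /\ w = u r + r *: p) ->
  0 <= x -> exists L : R, forall (y : R) j, 0 <= y ->
    `|u y 0 j - u x 0 j| <= L * `|y - x|.
Proof.
move=> uP x0; have [p [Ap wp]] := uP x x0.
exists (Num.sqrt (dotp p p)) => y j y0; have [q [Aq wq]] := uP y y0.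
have -> : u y 0 j - u x 0 j = (u y - u x) 0 j by rewrite !mxE.
have := A_monotone Aq Ap; set d := u y - u x => qpd.
have dE : d = y *: (p - q) + (x - y) *: p.
  apply/rowP => k; move/rowP/(_ k): wp; move/rowP/(_ k): wq.
  by rewrite /d !mxE; lra.
clearbody d.
have dd : dotp d d <= (x - y) ^+ 2 * dotp p p.
  have : dotp d d <= (x - y) * dotp p d.
    rewrite {1}dE dotpDl !dotpZl gerDr -opprB dotpNl mulrN oppr_le0.
    exact: mulr_ge0.
  have := dotp_ge0 ((x - y) *: p - d); rewrite !dotpE (dotpC d p) expr2; lra.
rewrite -sqrtr_sqr -(sqrtr_sqr (y - x)) -sqrtrM ?dotp_ge0 // ler_wsqrtr //.
rewrite mulrC -[y - x]opprB sqrrN; apply: le_trans dd; exact: sqr_coord_le.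
Qed.

Lemma resolvent_broken_line w u :
  (forall r : R, 0 <= r -> exists p, A (u r) p /\ w = u r + r *: p) ->
  exists N t c, [/\ t 0%N = 0, increasing_times N t & broken_line u N t c].
Proof.
move=> uP.
pose T i (r : R) := 0 < r /\ (exists p, [/\ Q i (u r), X i p & w = u r + r *: p]).
have mid i (x y r : R) : T i x -> T i y -> x <= r <= y -> x < y ->
    T i r /\ (y - x) *: (u r - u x) = (r - x) *: (u y - u x).
  move=> [x0 Tx] [y0 Ty] /andP[xr ry] xy.
  pose a := (y - r) / (y - x).
  have yx0 : 0 < y - x by rewrite subr_gt0.
  have aE : a * (y - x) = y - r by rewrite /a mulrAC mulfK ?gt_eqF.
  have a01 : 0 <= a <= 1.
    by rewrite divr_ge0 ?subr_ge0 ?(ltW xy) //= ler_pdivrMr // mul1r lerB.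
  have := resolvent_cell_mid uP x0 y0 a01 Tx Ty.
  have -> : a * x + (1 - a) * y = r by lra.
  move=> [ur Tr]; split; first by split=> //; exact: lt_le_trans xr.
  apply/rowP => j; rewrite ur !mxE.
  have -> : r - x = (y - x) - a * (y - x) by rewrite aE; ring.
  by ring.
have [||||N [t [c [t0 tP bl]]]] := @affine_cover_broken_line R n I u T 0 _ _ _
  #|[set: I]%SET| [set: I]%SET 0 erefl (lexx 0).
- move=> i x y r Tx Ty /[dup] /andP[xr ry] xry.
  have [xy|yx] := ltP x y; first by have [] := mid i x y r Tx Ty xry xy.
  suff -> : r = x by []. lra.
- move=> i x y r Tx Ty /[dup] /andP[xr ry] xry.
  have [xy|yx] := ltP x y; first by have [] := mid i x y r Tx Ty xry xy.
  have [-> ->] : r = x /\ y = x by split; lra.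
  by rewrite !subrr.
- by move=> x x0; exact: resolvent_lipschitz uP x0.
- move=> r r0; have [p [/A_cells[i [Qi Xi]] wE]] := uP r (ltW r0).
  by exists i; rewrite ?inE //; split=> //; exists p.
- by exists N, t, c.
Qed.

(** m is the initial speed, up to sign, of a trajectory from w with constant
speed on some interval. By monotonicity it is the element of A w of minimal
norm. *)
Definition initial_speed w m :=
  exists2 e : R, 0 < e & forall s, 0 <= s <= e -> A (w - s *: m) m.

(** The resolvent curve of w starts with a segment w + s c; on it, - c is a
value of the operator. *)
Lemma initial_speed_exists w p : A w p -> exists m, initial_speed w m.
Proof.
move=> Awp.
have /choice[u uP] : forall r : R, exists x, 0 <= r ->
    exists p, A x p /\ w = x + r *: p.
  move=> r; have [r0|r0|<-] := ltgtP 0 r.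
  - by have [x [q [Aq ->]]] := A_resolvent r0 Awp; exists x => _; exists q.
  - by exists w.
  - by exists w => _; exists p; rewrite scale0r addr0.
have u0 : u 0 = w by have [q [_]] := uP 0 (lexx 0); rewrite scale0r addr0 => ->.
have [N [t [c [t0 tP bl]]]] := resolvent_broken_line uP.
have t1 : 0 < t 1%N by rewrite -t0 tP.
have As s : 0 < s <= t 1%N -> A (w - s *: - c 0%N) (- c 0%N).
  move=> /andP[s0 s1]; have [q [Aq wE]] := uP s (ltW s0).
  have us : u s = w + s *: c 0%N.
    by rewrite (bl 0%N) // ?t0 ?subr0 ?u0 //; split=> //; rewrite t0 ltW.
  rewrite scalerN opprK -us; suff -> : - c 0%N = q by [].
  apply: (@scalerI _ _ s); first by rewrite gt_eqF.
  by apply/rowP => j; move/rowP/(_ j): wE; rewrite us !mxE; lra.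
exists (- c 0%N), (t 1%N) => // s /andP[s0 s1].
move: s0; rewrite le_eqVlt => /orP[/eqP<-|s0]; last by apply: As; rewrite s0.
rewrite scale0r subr0; apply: (@A_closed w (w - t 1%N *: - c 0%N)) => a /andP[a0 a1].
rewrite addrAC subrr add0r scalerN scalerA -scalerN.
rewrite -{1}[_ *: _]opprK -scalerN opprK; apply: As.
by rewrite mulr_gt0 //= ger_pMl // ltW.
Qed.

Lemma initial_speed_value w m : initial_speed w m -> A w m.
Proof. by case=> e e0 /(_ 0); rewrite lexx ltW // scale0r subr0; apply. Qed.

(** Monotonicity, applied to w and to a later point of the trajectory. *)
Lemma initial_speed_minimal w m x : initial_speed w m -> A w x ->
  dotp m m <= dotp x m.
Proof.
move=> [e e0 /(_ e)]; rewrite lexx ltW // => /(_ isT) Am Ax.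
have := A_monotone Ax Am.
rewrite subKr dotpZr pmulr_rge0 // dotpDl dotpNl; lra.
Qed.

Lemma initial_speed_norm w m x : initial_speed w m -> A w x ->
  dotp m m <= dotp x x.
Proof.
move=> wm /(initial_speed_minimal wm) mx.
have := dotp_ge0 (x - m); rewrite !dotpE (dotpC m x); lra.
Qed.

Lemma initial_speed_eq w m x : initial_speed w m -> A w x ->
  dotp x x <= dotp m m -> x = m.
Proof.
move=> wm /(initial_speed_minimal wm) mx xm.
apply/eqP; rewrite -subr_eq0; apply/eqP/dotp_le0.
rewrite !dotpE (dotpC m x); lra.
Qed.

(** A trajectory keeps its speed until a value of smaller norm appears. *)
Lemma trajectory_step w p : A w p -> exists m (b : R),
  [/\ initial_speed w m, 0 < b, forall s, 0 <= s <= b -> A (w - s *: m) m &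
   (forall s, 0 <= s -> A (w - s *: m) m) \/
   (forall m', initial_speed (w - b *: m) m' -> dotp m' m' < dotp m m)].
Proof.
move=> /initial_speed_exists[m wm]; exists m.
have [e e0 Ae] := wm.
pose E := [set b | 0 < b /\ forall s, 0 <= s <= b -> A (w - s *: m) m].
have Ee : E e by split.
have [[M EM]|Eunb] := pselect (exists M, forall r, E r -> r <= M); last first.
  exists e; split=> //; left=> s s0.
  have [b [_ Ab] sb] : exists2 b, E b & s < b.
    apply: contrapT => H; apply: Eunb; exists s => b Eb; rewrite leNgt.
    by apply/negP => sb; apply: H; exists b.
  by apply: Ab; rewrite s0 ltW.
have Esup : has_sup E by split; [exists e|exists M => r /EM].
pose b := sup E.
have eb : e <= b by apply: sup_ubound => //; exact: Esup.2.
have b0 : 0 < b := lt_le_trans e0 eb.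
have Alt s : 0 <= s < b -> A (w - s *: m) m.
  move=> /andP[s0]; rewrite -subr_gt0 => bs.
  have [b' [_ Ab']] := sup_adherent bs Esup; rewrite subKr => sb'.
  by apply: Ab'; rewrite s0 ltW.
have Ab : A (w - b *: m) m.
  apply: (@A_closed _ w) => s /andP[s0 s1].
  have -> : w - b *: m + s *: (w - (w - b *: m)) = w - (b - s * b) *: m.
    by apply/rowP => j; rewrite !mxE; ring.
  apply: Alt; rewrite subr_ge0 ger_pMl // ltW //= gtrBl mulr_gt0 //.
have Ale s : 0 <= s <= b -> A (w - s *: m) m.
  by move=> /andP[s0]; rewrite le_eqVlt => /orP[/eqP->//|sb]; apply: Alt; rewrite s0.
exists b; split=> //; right=> m' wm'; rewrite ltNge; apply/negP => mm'.
have mE := initial_speed_eq wm' Ab mm'; move: wm'; rewrite -mE => -[d d0 Ad].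
suff : E (b + d).
  by move=> /(sup_ubound Esup.2); rewrite -/b gerDl leNgt d0.
split; first by rewrite addr_gt0.
move=> s /andP[s0 sbd]; have [sb|bs] := leP s b; first by apply: Ale; rewrite s0.
have -> : w - s *: m = w - b *: m - (s - b) *: m.
  by apply/rowP => j; rewrite !mxE; ring.
by apply: Ad; rewrite subr_ge0 ltW //= lerBlDl.
Qed.

Definition cell_key w : {set I} := [set i | `[< Q i w >]]%SET.

(** A w depends only on the cells that w belongs to, so that there are finitely
many initial speeds. *)
Lemma initial_speed_key w z m m' : initial_speed w m -> initial_speed z m' ->
  cell_key w = cell_key z -> m = m'.
Proof.
move=> wm zm' E.
have Awz x : A w x <-> A z x.
  have Qwz i : Q i w <-> Q i z.
    move/setP/(_ i): E; rewrite !inE => E.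
    by split=> /asboolP; [rewrite E|rewrite -E] => /asboolP.
  by rewrite !A_cells; split=> -[i [Qi Xi]]; exists i; split=> //; exact/Qwz.
have Am := initial_speed_value wm; have Am' := initial_speed_value zm'.
apply: (initial_speed_eq zm'); first exact/Awz.
by apply: (initial_speed_norm wm); exact/Awz.
Qed.

(** The norm of the speed decreases strictly from one piece to the next, and
takes finitely many values: after finitely many pieces the speed is constant. *)
Lemma trajectory_exists w p : A w p -> exists N t c u,
  [/\ t 0%N = 0, increasing_times N t, u 0 = w, broken_line u N t c &
   (forall i r, (i <= N)%N -> closed_piece N t i r -> A (u r) (- c i)) /\
   forall i, (i < N)%N -> c i != c i.+1].
Proof.
move=> Awp.
have /choice[mb mbP] : forall z, exists mb : V * R, (exists q, A z q) ->
  [/\ initial_speed z mb.1, 0 < mb.2,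
    forall s, 0 <= s <= mb.2 -> A (z - s *: mb.1) mb.1 &
    (forall s, 0 <= s -> A (z - s *: mb.1) mb.1) \/
    (forall m', initial_speed (z - mb.2 *: mb.1) m' ->
      dotp m' m' < dotp mb.1 mb.1)].
  move=> z; have [[q /trajectory_step[m [b mbP]]]|H] := pselect (exists q, A z q).
    by exists (m, b).
  by exists (0, 0) => /H.
pose M z := (mb z).1; pose B z := (mb z).2.
pose x := fun k => iter k (fun z => z - B z *: M z) w.
have xS k : x k.+1 = x k - B (x k) *: M (x k) by [].
have xA k : exists q, A (x k) q.
  elim: k => [|k /mbP[_ b0 Ab _]]; first by exists p.
  by exists (M (x k)); apply: Ab; rewrite lexx ltW.
pose stop k := `[< forall s, 0 <= s -> A (x k - s *: M (x k)) (M (x k)) >].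
have [K stopK] : exists k, stop k.
  apply: contrapT => nostop.
  have dec k : dotp (M (x k.+1)) (M (x k.+1)) < dotp (M (x k)) (M (x k)).
    have [_ _ _ [H|H]] := mbP _ (xA k).
      by exfalso; apply: nostop; exists k; exact/asboolP.
    by apply: H; have [] := mbP _ (xA k.+1).
  have dec2 k l : (k < l)%N ->
      dotp (M (x l)) (M (x l)) < dotp (M (x k)) (M (x k)).
    elim: l => // l IHl; rewrite ltnS leq_eqVlt => /orP[/eqP->//|kl].
    exact: lt_trans (dec l) (IHl kl).
  pose key (k : 'I_(#|{set I}|.+1)) := cell_key (x k).
  have key_inj : injective key.
    move=> k l kl.
    have [kP _ _ _] := mbP _ (xA k); have [lP _ _ _] := mbP _ (xA l).
    have E := initial_speed_key kP lP kl.
    apply: val_inj; case: (ltngtP (val k) (val l)) => // /dec2;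
      by rewrite /M E ltxx.
  by have := leq_card key key_inj; rewrite card_ord ltnn.
pose N := ex_minn (ex_intro _ K stopK).
have [stopN nostop] : stop N /\ forall k, (k < N)%N -> ~~ stop k.
  rewrite /N; case: ex_minnP => k sk kmin; split=> // l lk.
  by apply: contraTN lk => /kmin; rewrite -leqNgt.
pose t k := \sum_(i < k) B (x i).
pose c k := - M (x k).
have tS k : t k.+1 = t k + B (x k) by rewrite /t big_ord_recr.
have t0 : t 0%N = 0 by rewrite /t big_ord0.
have tP : increasing_times N t.
  by move=> k _; rewrite tS ltrDl; have [] := mbP _ (xA k).
pose u := polyline w N t c.
have bl : broken_line u N t c by exact: polyline_broken_line.
have u0 : u 0 = w by rewrite -t0; exact: polyline0.
have ut k : (k <= N)%N -> u (t k) = x k.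
  elim: k => [|k IHk] kN; first by rewrite t0 u0.
  rewrite (bl k) ?(ltnW kN) //; last by split=> //; rewrite ltW // tP // ltnW.
  rewrite xS (IHk (ltnW kN)); congr (_ + _).
  by rewrite tS /c scalerN; congr (- (_ *: _)); rewrite addrAC subrr add0r.
exists N, t, c, u; split=> //; split.
- move=> i r iN /[dup] ri [tr rt]; rewrite (bl i) // ut // /c scalerN opprK.
  move: iN; rewrite leq_eqVlt => /orP[/eqP iN|iN].
    by rewrite iN; move/asboolP: stopN; apply; rewrite subr_ge0 -iN.
  have [_ _ + _] := mbP _ (xA i); apply.
  by rewrite subr_ge0 tr lerBlDl -tS rt.
- move=> i iN; apply/eqP => /oppr_inj cE.
  have [_ _ _ [H|H]] := mbP _ (xA i).
    by move: (nostop i iN) => /negP; apply; exact/asboolP.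
  have [lt _ _ _] := mbP _ (xA i.+1).
  by have := H _ lt; rewrite -/(M _) -/(M (x i)) cE ltxx.
Qed.

End PolyhedralOperator.

(** * Absolutely continuous functions *)

Section Primitives.
Variable R : realType.
Notation lambda := (@lebesgue_measure R).
Implicit Types (a b c x y r : R) (f g v dv w dw : R -> R).

Definition primitive a b v dv :=
  lambda.-integrable `[a, b] (EFin \o dv) /\
  forall x y, a <= x -> x <= y -> y <= b ->
    v y - v x = \int[lambda]_(r in `[x, y]) dv r.

Lemma integrable_segment a b x y f : a <= x -> y <= b ->
  lambda.-integrable `[a, b] (EFin \o f) ->
  lambda.-integrable `[x, y] (EFin \o f).
Proof.
move=> ax yb; apply: integrableS => //; apply: subset_itv; by rewrite bnd_simp.
Qed.

Lemma Rintegral_segment_split a b c f : a <= b -> b <= c ->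
  lambda.-integrable `[a, c] (EFin \o f) ->
  \int[lambda]_(r in `[a, c]) f r =
  \int[lambda]_(r in `[a, b]) f r + \int[lambda]_(r in `[b, c]) f r.
Proof.
move=> ab bc fi; apply/eqP; rewrite addrC -subr_eq.
rewrite Rintegral_itvB ?bnd_simp // Rintegral_itv_obnd_cbnd //.
apply: integrableS fi => //; apply: subset_itv; rewrite bnd_simp //.
Qed.

Lemma primitive_continuous a b v dv : a <= b -> primitive a b v dv ->
  {within `[a, b], continuous v}.
Proof.
move=> ab [dvi vE].
pose F x := \int[lambda]_(r in `[a, x]) dv r.
have Fc : {within `[a, b], continuous F} by exact: parameterized_integral_continuous.
have : {within `[a, b], continuous (fun x => v a + F x)}.
  move=> x; apply: (@continuousD _ R^o); first exact: cst_continuous.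
  exact: Fc.
apply: subspace_eq_continuous => x; rewrite inE /= in_itv /= => /andP[ax xb].
by change (v a + F x = v x); rewrite /F -vE // addrC subrK.
Qed.

Lemma primitive_measurable a b v dv : a <= b -> primitive a b v dv ->
  measurable_fun `[a, b] v.
Proof.
by move=> ab /(primitive_continuous ab); exact: subspace_continuous_measurable_fun.
Qed.

Lemma primitive_bounded a b v dv : primitive a b v dv ->
  forall x y, a <= x -> x <= y -> y <= b ->
  `|v y - v x| <= \int[lambda]_(r in `[x, y]) `|dv r|.
Proof.
move=> [dvi vE] x y ax xy yb; rewrite vE //.
by apply: le_normr_Rintegral => //; exact: integrable_segment dvi.
Qed.

Lemma integrable_cst_segment a b c :
  lambda.-integrable `[a, b] (EFin \o cst c).
Proof.
apply: continuous_compact_integrable; first exact: segment_compact.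
by apply: continuous_subspaceT => x; exact: cst_continuous.
Qed.

Lemma integrable_primitiveM a b v dv f : a <= b -> primitive a b v dv ->
  lambda.-integrable `[a, b] (EFin \o f) ->
  lambda.-integrable `[a, b] (EFin \o (fun r => v r * f r)).
Proof.
move=> ab vp fi.
have := @integrableMr _ _ _ lambda `[a, b] _ v (EFin \o f) _ _ fi.
apply=> //; first exact: primitive_measurable vp.
pose M := `|v a| + \int[lambda]_(r in `[a, b]) `|dv r|.
exists M; split; first exact: num_real.
move=> m Mm r; rewrite /= in_itv /= => /andP[ar rb].
apply/ltW/(le_lt_trans _ Mm).
rewrite -[v r](subrK (v a)) addrC; apply: (le_trans (ler_normD _ _)).
rewrite lerD2l; apply: (le_trans (primitive_bounded vp _ ar rb)) => //.
have dvi : lambda.-integrable `[a, b] (EFin \o (fun r => `|dv r|)).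
  by apply: integrable_norm; case: vp.
rewrite (Rintegral_segment_split ar rb dvi) lerDl.
by apply: Rintegral_ge0.
Qed.

Lemma integrableD_segment a b f g : lambda.-integrable `[a, b] (EFin \o f) ->
  lambda.-integrable `[a, b] (EFin \o g) ->
  lambda.-integrable `[a, b] (EFin \o (fun r => f r + g r)).
Proof.
by move=> fi gi; apply: eq_integrable (integrableD _ fi gi) => // r _ /=; rewrite EFinD.
Qed.

Lemma integrableZ_segment a b c f : lambda.-integrable `[a, b] (EFin \o f) ->
  lambda.-integrable `[a, b] (EFin \o (fun r => c * f r)).
Proof.
by move=> fi; apply: eq_integrable (integrableZl _ c fi) => // r _ /=; rewrite EFinM.
Qed.

Lemma integrableB_segment a b f g : lambda.-integrable `[a, b] (EFin \o f) ->
  lambda.-integrable `[a, b] (EFin \o g) ->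
  lambda.-integrable `[a, b] (EFin \o (fun r => f r - g r)).
Proof.
move=> fi /(integrableZ_segment (-1)) gi.
by apply: eq_integrable (integrableD_segment fi gi) => // r _ /=; rewrite mulN1r.
Qed.

Lemma primitiveD a b v dv w dw : primitive a b v dv -> primitive a b w dw ->
  primitive a b (fun r => v r + w r) (fun r => dv r + dw r).
Proof.
move=> [dvi vE] [dwi wE]; split; first exact: integrableD_segment.
move=> x y ax xy yb; rewrite RintegralD //; first last.
- exact: integrable_segment dwi.
- exact: integrable_segment dvi.
by rewrite -vE // -wE //; ring.
Qed.

Lemma primitiveZ a b c v dv : primitive a b v dv ->
  primitive a b (fun r => c * v r) (fun r => c * dv r).
Proof.
move=> [dvi vE]; split; first exact: integrableZ_segment.
move=> x y ax xy yb; rewrite RintegralZl //; last exact: integrable_segment dvi.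
by rewrite -vE //; ring.
Qed.

Lemma primitive_cst a b c : primitive a b (fun=> c) (fun=> 0).
Proof.
split; first exact: (integrable_cst_segment a b 0).
by move=> x y *; rewrite subrr Rintegral_cst // mul0r.
Qed.

Lemma primitive_id a b : primitive a b id (fun=> 1).
Proof.
split; first exact: (integrable_cst_segment a b 1).
move=> x y _ xy _; rewrite Rintegral_cst // mul1r /= lebesgue_measure_itv /=.
by case: ifP => [_ //|]; rewrite lte_fin; case: ltgtP xy => // -> _ _; rewrite subrr.
Qed.

Lemma primitive_eq a b v dv v' dv' :
  (forall r, a <= r <= b -> v r = v' r /\ dv r = dv' r) ->
  primitive a b v dv -> primitive a b v' dv'.
Proof.
move=> E [dvi vE]; split.
  apply: eq_integrable dvi => // r; rewrite inE /= in_itv /= => /E[_ ->] //.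
move=> x y ax xy yb.
have [<- _] : v x = v' x /\ dv x = dv' x by apply: E; rewrite ax (le_trans xy).
have [<- _] : v y = v' y /\ dv y = dv' y by apply: E; rewrite yb (le_trans ax).
rewrite vE //; apply: eq_Rintegral => r; rewrite inE /= in_itv /= => /andP[xr ry].
by case: (E r) => //; rewrite (le_trans ax) // (le_trans ry).
Qed.

Lemma primitive_sum a b (I : Type) (s : seq I) (P : pred I) (v dv : I -> R -> R) :
  (forall i, primitive a b (v i) (dv i)) ->
  primitive a b (fun r => \sum_(i <- s | P i) v i r)
    (fun r => \sum_(i <- s | P i) dv i r).
Proof.
move=> vp; elim: s => [|i s IHs].
  by apply: primitive_eq (primitive_cst a b 0) => r _; rewrite !big_nil.
have [Pi|Pi] := boolP (P i).
  apply: primitive_eq (primitiveD (vp i) IHs) => r _.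
  by rewrite !big_cons Pi.
by apply: primitive_eq IHs => r _; rewrite !big_cons (negbTE Pi).
Qed.

Lemma primitive_ramp a b c :
  primitive a b (fun r => Num.max (r - c) 0) (fun r => (c < r)%R%:R).
Proof.
have E r : (c < r)%R%:R = \1_`]c, +oo[ r :> R.
  by rewrite indicE; case: ltP => cr; [rewrite mem_set|rewrite memNset] => //=;
    rewrite in_itv /= andbT // ltNge cr.
split.
  apply: measurable_bounded_integrable => //.
  - by rewrite /= lebesgue_measure_itv /=; case: ifP => // _; rewrite ltry.
  - rewrite (_ : (fun r => _) = \1_`]c, +oo[); last by apply/funext => r; exact: E.
    exact: measurable_funTS.
  - exists 1; split; first exact: num_real.
    by move=> M M1 r _ /=; apply: le_trans (ltW M1); case: (c < r); rewrite ?normr1 ?normr0.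
move=> x y _ xy _.
rewrite /Rintegral; under eq_integral do rewrite E.
rewrite integral_indic //.
have [cx|xc] := ltP c x.
  rewrite (_ : _ `&` _ = `[x, y]%classic); last first.
    apply/seteqP; split=> r /=; first by case.
    by rewrite !in_itv /= andbT => /[dup] ? /andP[xr _]; split => //; exact: lt_le_trans xr.
  rewrite /= lebesgue_measure_itv /= !max_l; try lra.
  rewrite lte_fin; case: ltgtP xy => //= [_ _|-> _]; lra.
have [cy|yc] := ltP c y.
  rewrite (_ : _ `&` _ = `]c, y]%classic); last first.
    apply/seteqP; split=> r /=; rewrite !in_itv /= andbT.
      by move=> [-> /andP[_ ->]].
    by move=> /andP[cr ->]; rewrite cr andbT; split=> //; apply/ltW/(le_lt_trans xc).
  rewrite /= lebesgue_measure_itv /= lte_fin cy /= max_l ?max_r; lra.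
rewrite (_ : _ `&` _ = set0) ?measure0 /=; first by rewrite !max_r ?subrr; lra.
apply/seteqP; split=> r //=; rewrite !in_itv /= andbT => -[cr /andP[_ ry]].
by have := lt_le_trans cr (le_trans ry yc); rewrite ltxx.
Qed.

(** Product rule. With A and B the variations of v and w on a segment, the
defect of the formula on that segment is at most 2AB; cutting the segment into
pieces of equal variation of v divides this bound by the number of pieces. *)
Lemma primitiveM a b v dv w dw : a <= b ->
  primitive a b v dv -> primitive a b w dw ->
  primitive a b (fun r => v r * w r) (fun r => v r * dw r + w r * dv r).
Proof.
move=> ab vp wp; have [dvi vE] := vp; have [dwi wE] := wp.
have di : lambda.-integrable `[a, b]
    (EFin \o (fun r => v r * dw r + w r * dv r)).
  apply: integrableD_segment; first exact: integrable_primitiveM vp dwi.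
  exact: integrable_primitiveM wp dvi.
split=> //.
pose A x y := \int[lambda]_(r in `[x, y]) `|dv r|.
pose B x y := \int[lambda]_(r in `[x, y]) `|dw r|.
have dvn : lambda.-integrable `[a, b] (EFin \o (fun r => `|dv r|)).
  exact: integrable_norm.
have dwn : lambda.-integrable `[a, b] (EFin \o (fun r => `|dw r|)).
  exact: integrable_norm.
have A0 x y : 0 <= A x y by apply: Rintegral_ge0.
have B0 x y : 0 <= B x y by apply: Rintegral_ge0.
pose G x y := v y * w y - v x * w x -
  \int[lambda]_(r in `[x, y]) (v r * dw r + w r * dv r).
have bound k : forall x y, a <= x -> x <= y -> y <= b ->
    `|G x y| <= 2 * 2^-1 ^+ k * (A x y * B x y).
  elim: k => [|k IHk] x y ax xy yb.
    rewrite expr0 mulr1.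
    have dvi' := integrable_segment ax yb dvi.
    have dwi' := integrable_segment ax yb dwi.
    have di' := integrable_segment ax yb di.
    have i1 := integrableZ_segment (v x) dwi'.
    have i2 := integrableZ_segment (w y) dvi'.
    have i12 := integrableD_segment i1 i2.
    have -> : G x y = \int[lambda]_(r in `[x, y])
        ((v x * dw r + w y * dv r) - (v r * dw r + w r * dv r)).
      rewrite RintegralB // RintegralD // !RintegralZl // -vE // -wE // /G.
      by ring.
    apply: (le_trans (le_normr_Rintegral _ _)) => //.
      exact: integrableB_segment i12 di'.
    have an := integrable_segment ax yb dvn; have bn := integrable_segment ax yb dwn.
    have -> : 2 * (A x y * B x y) = \int[lambda]_(r in `[x, y])
        (A x y * `|dw r| + B x y * `|dv r|).
      rewrite RintegralD ?RintegralZl //; first last.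
      - exact: (integrableZ_segment (B x y) an).
      - exact: (integrableZ_segment (A x y) bn).
      by rewrite -/(A x y) -/(B x y); ring.
    apply: le_Rintegral => //.
    - by apply: integrable_norm; exact: integrableB_segment i12 di'.
    - apply: integrableD_segment; exact: integrableZ_segment.
    move=> r; rewrite /= in_itv /= => /andP[xr ry].
    have -> : v x * dw r + w y * dv r - (v r * dw r + w r * dv r) =
      (w y - w r) * dv r - (v r - v x) * dw r by ring.
    apply: (le_trans (ler_normB _ _)); rewrite addrC !normrM; apply: lerD.
      apply: ler_wpM2r => //; apply: (le_trans (primitive_bounded vp _ xr _)) => //.
        exact: le_trans ry yb.
      rewrite /A (Rintegral_segment_split xr ry) // lerDl.
      exact: A0.
    apply: ler_wpM2r => //; apply: (le_trans (primitive_bounded wp _ ry _)) => //.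
      exact: le_trans ax xr.
    rewrite /B (Rintegral_segment_split xr ry) // lerDr.
    exact: B0.
  have an := integrable_segment ax yb dvn; have bn := integrable_segment ax yb dwn.
  have [m mxy Am] : exists2 m, m \in `[x, y] & A x m = A x y / 2.
    apply: (@IVT R (A x)) => //.
      exact: parameterized_integral_continuous.
    have -> : A x x = 0 by rewrite /A set_itv1 Rintegral_set1.
    rewrite min_l ?A0 // max_r ?A0 //.
    have := A0 x y; lra.
  move: mxy; rewrite in_itv /= => /andP[xm my].
  have AE : A x y = A x m + A m y by exact: Rintegral_segment_split.
  have BE : B x y = B x m + B m y by exact: Rintegral_segment_split.
  have -> : G x y = G x m + G m y.
    rewrite /G (Rintegral_segment_split xm my) ?(integrable_segment ax yb) //.
    by ring.
  apply: (le_trans (ler_normD _ _)).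
  have -> : 2 * 2^-1 ^+ k.+1 * (A x y * B x y) =
      2 * 2^-1 ^+ k * (A x m * B x m) + 2 * 2^-1 ^+ k * (A m y * B m y).
    have -> : A m y = A x m by lra.
    have -> : A x y = 2 * A x m by lra.
    by rewrite BE exprS; field.
  by apply: lerD; apply: IHk => //; [exact: le_trans my yb|exact: le_trans ax xm].
move=> x y ax xy yb; apply/eqP; rewrite -subr_eq0 -normr_le0 -/(G x y).
rewrite leNgt; apply/negP => G0.
pose C := 2 * (A x y * B x y).
have GC k : `|G x y| <= 2^-1 ^+ k * C.
  by rewrite /C mulrCA mulrA; exact: bound.
have C0 : 0 < C by have := GC 0%N; rewrite expr0 mul1r; exact: lt_le_trans.
have cv : (fun k => 2^-1 ^+ k * C) @ \oo --> (0 : R).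
  rewrite -[0](mul0r C); apply: cvgMl.
  by apply: cvg_expr; rewrite gtr0_norm ?invr_gt0 // invf_lt1 // ltr1n.
have : `|G x y| <= 0.
  rewrite -[leRHS](cvg_lim _ cv) //; apply: limr_ge; first by apply/cvg_ex; exists 0.
  exact: nearW.
by rewrite leNgt G0.
Qed.

End Primitives.

Section PrimitivesAe.
Variable R : realType.
Notation lambda := (@lebesgue_measure R).
Implicit Types (a b c x y r : R) (f g v dv w dw : R -> R).

Lemma aeS (P Q : R -> Prop) : (forall r, P r -> Q r) ->
  {ae lambda, forall r, P r} -> {ae lambda, forall r, Q r}.
Proof.
by move=> PQ; apply: filterS; first exact: (ae_filter_ringOfSetsType lambda).
Qed.

Lemma aeI (P Q : R -> Prop) : {ae lambda, forall r, P r} ->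
  {ae lambda, forall r, Q r} -> {ae lambda, forall r, P r /\ Q r}.
Proof. by apply: filterI; exact: (ae_filter_ringOfSetsType lambda). Qed.

Lemma ae_forall_ord n (P : 'I_n -> R -> Prop) :
  (forall j, {ae lambda, forall r, P j r}) ->
  {ae lambda, forall r, forall j, P j r}.
Proof.
move=> Pj; have H : {ae lambda, forall r, forall k : nat, forall kn : (k < n)%N,
    P (Ordinal kn) r}.
  apply: ae_foralln => k; have [kn|nk] := pselect (k < n)%N.
    apply: aeS (Pj (Ordinal kn)) => r Pr kn'.
    by rewrite (bool_irrelevance kn' kn).
  by apply: aeW => r kn; exfalso; exact: nk.
by apply: aeS H => r Pr [k kn]; exact: Pr.
Qed.

Lemma ae_Rintegral_le0 a b f : lambda.-integrable `[a, b] (EFin \o f) ->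
  {ae lambda, forall r, a <= r <= b -> f r <= 0} ->
  \int[lambda]_(r in `[a, b]) f r <= 0.
Proof.
move=> fi f0; pose g r := Num.max (f r) 0.
have mf : measurable_fun `[a, b] f by apply/measurable_EFinP; exact: measurable_int fi.
have gi : lambda.-integrable `[a, b] (EFin \o g).
  apply: le_integrable fi => //.
    by apply/measurable_EFinP; apply: measurable_maxr.
  move=> r _ /=; rewrite lee_fin /g; case: (leP (f r) 0) => [|/ltW] fr.
    by rewrite normr0.
  by [].
apply: (@le_trans _ _ (\int[lambda]_(r in `[a, b]) g r)).
  by apply: le_Rintegral => // r _; rewrite /g le_max lexx.
suff -> : \int[lambda]_(r in `[a, b]) g r = 0 by [].
rewrite /Rintegral (@ae_eq_integral _ _ _ lambda `[a, b]%classic (cst 0%E)) //.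
- by rewrite integral0.
- by apply/measurable_EFinP; apply: measurable_maxr.
- apply: aeS f0 => r fr; rewrite /= in_itv /= => /fr ?.
  by rewrite /g max_r.
Qed.

Lemma primitive_nonincreasing a b v dv : a <= b -> primitive a b v dv ->
  {ae lambda, forall r, a <= r <= b -> dv r <= 0} -> v b <= v a.
Proof.
move=> ab [dvi vE] dv0; rewrite -subr_le0 vE //.
exact: ae_Rintegral_le0.
Qed.

(** By the Lebesgue differentiation theorem. *)
Lemma primitive0_ae a b v dv : primitive a b v dv ->
  (forall r, a <= r <= b -> v r = 0) ->
  {ae lambda, forall r, a <= r <= b -> dv r = 0}.
Proof.
move=> [dvi vE] v0.
pose f := dv \_ `[a, b].
have fE r : a <= r <= b -> f r = dv r.
  by move=> rab; rewrite /f patchE mem_set //= in_itv.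
have fi : lambda.-integrable setT (EFin \o f).
  rewrite /f -restrict_EFin; apply/integrable_restrict => //.
  by rewrite setTI.
have := @FTC1Ny R f; rewrite /=.
have -> : (fun x => \int[lambda]_(t in `]-oo, x]) f t) = cst 0.
  apply/funext => x; rewrite /f -Rintegral_mkcondr.
  have [xa|ax] := ltP x a.
    rewrite (_ : _ `&` _ = set0) ?Rintegral_set0 //.
    apply/seteqP; split=> r //=; rewrite !in_itv /= => -[rx /andP[ar _]].
    by have := le_lt_trans (le_trans ar rx) xa; rewrite ltxx.
  pose y := Num.min x b.
  rewrite (_ : _ `&` _ = `[a, y]%classic); last first.
    apply/seteqP; split=> r /=; rewrite !in_itv /= le_min.
      by move=> [-> /andP[-> ->]].
    by move=> /andP[-> /andP[-> ->]].
  have [ab|ba] := leP a b; last first.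
    rewrite set_itv_ge ?Rintegral_set0 // bnd_simp -ltNge.
    by rewrite /y gt_min ba orbT.
  have ay : a <= y by rewrite le_min ax ab.
  have yb : y <= b by rewrite ge_min lexx orbT.
  by rewrite -vE // !v0 ?subrr // ?lexx ?ay ?yb ?ab.
have int0 : forall y, lambda.-integrable `]-oo, y] (EFin \o f).
  by move=> y; apply: integrableS fi.
move=> /(_ int0); have locf : locally_integrable setT f.
  exact: integrable_locally.
move=> /(_ locf); apply: aeS => r [_ fr] rab.
by rewrite -fE // -fr derive1_cst.
Qed.

End PrimitivesAe.

(** * Monotone evolutions and step functions *)

Section VectorPrimitives.
Variables (R : realType) (n : nat).
Notation V := 'rV[R]_n.
Notation lambda := (@lebesgue_measure R).
Implicit Types (I : set R) (u v w du dv dw : R -> V) (t : nat -> R) (c : nat -> V).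

Lemma primitive_W11loc I v dv : (forall a b j, I a -> I b -> a <= b ->
    primitive a b (fun r => v r 0 j) (fun r => dv r 0 j)) -> W11loc I v dv.
Proof.
move=> vp a b Ia Ib ab j; have [dvi vE] := vp a b j Ia Ib ab.
by split=> //; exact: vE.
Qed.

Lemma W11loc_primitive I v dv a b j : (forall r, a <= r <= b -> I r) ->
  a <= b -> W11loc I v dv ->
  primitive a b (fun r => v r 0 j) (fun r => dv r 0 j).
Proof.
move=> Iab ab vp; split.
  by have [] := vp a b _ _ ab j; [apply: Iab; rewrite lexx|apply: Iab; rewrite lexx andbT|].
move=> x y ax xy yb.
have Ix : I x by apply: Iab; rewrite ax (le_trans xy).
have Iy : I y by apply: Iab; rewrite yb andbT (le_trans ax).
by have [] := vp x y Ix Iy xy j.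
Qed.

Lemma primitive_dotp a b v dv w dw : a <= b ->
  (forall j, primitive a b (fun r => v r 0 j) (fun r => dv r 0 j)) ->
  (forall j, primitive a b (fun r => w r 0 j) (fun r => dw r 0 j)) ->
  primitive a b (fun r => dotp (v r) (w r))
    (fun r => dotp (v r) (dw r) + dotp (w r) (dv r)).
Proof.
move=> ab vp wp.
have := primitive_sum (index_enum 'I_n) xpredT
  (fun j => primitiveM ab (vp j) (wp j)).
by apply: primitive_eq => r _; split=> //; rewrite big_split.
Qed.

Lemma ae_neq (x : R) : {ae lambda, forall r, r != x}.
Proof.
exists [set x]; split=> //; first exact: lebesgue_measure_set1.
by move=> r /= /negP; rewrite negbK => /eqP.
Qed.

Lemma ae_right_of (x : R) (P : R -> Prop) :
  (forall k : nat, {ae lambda, forall r, x <= r <= x + k%:R -> P r}) ->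
  {ae lambda, forall r, x < r -> P r}.
Proof.
move=> H; have := ae_foralln H; apply: aeS => r Pr xr.
have rx0 : 0 <= r - x by rewrite subr_ge0 ltW.
apply: (Pr (Num.bound (r - x))).
by rewrite ltW //= -lerBlDl ltW // archi_boundP.
Qed.

(** The squared distance of two solutions of a monotone evolution does not
increase; once the solutions agree, so do their derivatives, by Lebesgue
differentiation. *)
Lemma monotone_flow_unique u1 du1 u2 du2 :
  W11loc `[0, +oo[ u1 du1 -> W11loc `[0, +oo[ u2 du2 -> u1 0 = u2 0 ->
  {ae lambda, forall r, 0 < r -> dotp (u1 r - u2 r) (du1 r - du2 r) <= 0} ->
  (forall r, 0 <= r -> u1 r = u2 r) /\
  {ae lambda, forall r, 0 < r -> du1 r = du2 r}.
Proof.
move=> W1 W2 u12 mono.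
have ep b j : 0 <= b -> primitive 0 b (fun r => (u1 r - u2 r) 0 j)
    (fun r => (du1 r - du2 r) 0 j).
  move=> b0.
  have Iab r : 0 <= r <= b -> [set` `[0, +oo[] r.
    by rewrite /= in_itv /= andbT => /andP[].
  have := primitiveD (W11loc_primitive j Iab b0 W1)
    (primitiveZ (-1) (W11loc_primitive j Iab b0 W2)).
  by apply: primitive_eq => r _; rewrite !mxE !mulN1r.
have E b : 0 <= b -> u1 b = u2 b.
  move=> b0; apply/eqP; rewrite -subr_eq0; apply/eqP/dotp_le0.
  have pp := primitive_dotp b0 (fun j => ep b j b0) (fun j => ep b j b0).
  have := primitive_nonincreasing b0 pp; rewrite u12 subrr dotp0l; apply.
  apply: aeS (aeI mono (ae_neq 0)) => r [mr r0] /andP[r_ge0 _].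
  have {}mr := mr _; rewrite lt0r r0 r_ge0 in mr; have {}mr := mr isT.
  lra.
split=> //.
have : {ae lambda, forall r, forall j, 0 < r -> (du1 r - du2 r) 0 j = 0}.
  apply: ae_forall_ord => j; apply: ae_right_of => k; rewrite add0r.
  by apply: primitive0_ae (ep _ j _) _ => // r /andP[r0 _]; rewrite E // subrr mxE.
apply: aeS => r H r0; apply/eqP; rewrite -subr_eq0; apply/eqP/rowP => j.
by rewrite H // mxE.
Qed.

(** The derivative of a broken line, continuous from the left. *)
Definition step (N : nat) t c (r : R) : V :=
  c 0%N + \sum_(k < N) (t k.+1 < r)%R%:R *: (c k.+1 - c k).

Lemma step_piece N t c i r : increasing_times N t -> (i <= N)%N ->
  piece N t i r -> step N t c r = c i.
Proof.
move=> tP iN [tir rti].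
have E : \sum_(k < N) (t k.+1 < r)%R%:R *: (c k.+1 - c k) =
    \sum_(k < N | (k < i)%N) (c k.+1 - c k).
  rewrite [in RHS]big_mkcond; apply: eq_bigr => k _; case: ltnP => ki.
    suff -> : t k.+1 < r by rewrite scale1r.
    apply: le_lt_trans tir.
    by apply: (increasing_times_le tP); rewrite ki leqW.
  have iN' : (i < N)%N := leq_ltn_trans ki (ltn_ord k).
  suff /negbTE -> : ~~ (t k.+1 < r) by rewrite scale0r.
  rewrite -leNgt; apply: le_trans (rti iN') _.
  by apply: (increasing_times_le tP); rewrite !ltnS ki ltnW.
by rewrite /step E telescope_lt // addrC subrK.
Qed.

Lemma primitive_polyline (u0 : V) N t c a b j :
  primitive a b (fun r => polyline u0 N t c r 0 j) (fun r => step N t c r 0 j).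
Proof.
have p1 := primitiveD (primitive_cst a b (u0 0 j))
  (primitiveZ (c 0%N 0 j) (primitiveD (primitive_id a b)
     (primitive_cst a b (- t 0%N)))).
have p2 := primitive_sum (index_enum 'I_N) xpredT (fun k : 'I_N =>
  primitiveZ ((c k.+1 - c k) 0 j) (primitive_ramp a b (t k.+1))).
apply: primitive_eq (primitiveD p1 p2) => r _; split.
  rewrite /polyline !mxE summxE; congr (_ + _ + _); first by rewrite mulrC.
  by apply: eq_bigr => k _; rewrite !mxE mulrC.
rewrite /step !mxE summxE addr0 mulr1 add0r; congr (_ + _).
by apply: eq_bigr => k _; rewrite !mxE mulrC.
Qed.

Lemma polyline_W11loc I (u0 : V) N t c :
  W11loc I (polyline u0 N t c) (step N t c).
Proof. by apply: primitive_W11loc => a b j *; exact: primitive_polyline. Qed.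

Lemma measurable_step (D : set R) N t c j : measurable D ->
  measurable_fun D (fun r => step N t c r 0 j).
Proof.
move=> mD; rewrite /step.
under eq_fun do rewrite !mxE summxE.
apply: measurable_funD; first exact: measurable_cst.
apply: measurable_sum => k; under eq_fun do rewrite !mxE.
apply: measurable_funM; last exact: measurable_cst.
rewrite (_ : (fun r => _) = \1_`]t k.+1, +oo[).
  exact: measurable_funTS.
apply/funext => r; rewrite indicE.
by case: ltP => cr; [rewrite mem_set|rewrite memNset] => //=;
  rewrite in_itv /= andbT // ltNge cr.
Qed.

End VectorPrimitives.

(** * Measures with a density *)

Section WeightedMeasure.
Context d (T : measurableType d) (R : realType).
Variables (mu : {measure set T -> \bar R}) (h : T -> R).
Hypotheses (h_ge0 : forall x, 0 <= h x) (mh : measurable_fun setT h).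

(** The measure h mu. The conditions on h are arguments, for the measure
structure below to be found by unification. *)
Definition weighted of (forall x, 0 <= h x) & measurable_fun setT h :=
  fun A : set T => (\int[mu]_(x in A) (h x)%:E)%E.

Local Notation nu := (weighted h_ge0 mh).

Let weighted0 : nu set0 = 0%E.
Proof. by rewrite /weighted integral_set0. Qed.

Let weighted_ge0 A : (0 <= nu A)%E.
Proof. by apply: integral_ge0 => x _; rewrite lee_fin. Qed.

Let weighted_sigma_additive : semi_sigma_additive nu.
Proof.
move=> F mF tF mUF; rewrite /weighted ge0_integral_bigcup //.
- by apply: is_cvg_ereal_nneg_natsum_cond => k _ _; exact: weighted_ge0.
- by apply/measurable_EFinP; exact: measurable_funTS.
- by move=> x _; rewrite lee_fin.
Qed.

HB.instance Definition _ := isMeasure.Build _ _ _ nu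
  weighted0 weighted_ge0 weighted_sigma_additive.

Import HBNNSimple.

(** Both sides commute with increasing limits, and simple functions are sums of
multiples of indicators. *)
Lemma integral_weighted (f : T -> R) : (forall x, 0 <= f x) ->
  measurable_fun setT f ->
  (\int[nu]_x (f x)%:E = \int[mu]_x (f x * h x)%:E)%E.
Proof.
move=> f0 mf; have mF : measurable_fun setT (EFin \o f) by exact/measurable_EFinP.
pose g := nnsfun_approx measurableT mF.
have gnd x : nondecreasing_seq (fun k => (g k x)%:E).
  by move=> k l kl; rewrite lee_fin; exact/lefP/nd_nnsfun_approx.
have gcv x : (fun k => (g k x)%:E) @ \oo --> (f x)%:E.
  by apply: cvg_nnsfun_approx => // y _; rewrite lee_fin.
have mg k : measurable_fun setT (g k) by exact: measurable_funP.
have -> : (\int[nu]_x (f x)%:E = limn (fun k => \int[nu]_x (g k x)%:E))%E.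
  rewrite -monotone_convergence //.
  - by apply: eq_integral => x _; apply/esym/cvg_lim => //; exact: gcv.
  - by move=> k; exact/measurable_EFinP.
  - by move=> k x _; rewrite lee_fin.
have -> : (\int[mu]_x (f x * h x)%:E = limn (fun k => \int[mu]_x (g k x * h x)%:E))%E.
  rewrite -monotone_convergence //.
  - apply: eq_integral => x _; apply/esym/cvg_lim => //.
    under eq_fun do rewrite EFinM; rewrite EFinM.
    by apply: cvgeZr => //; exact: gcv.
  - by move=> k; apply/measurable_EFinP; exact: measurable_funM.
  - by move=> k x _; rewrite lee_fin mulr_ge0.
  - by move=> x _ k l kl; rewrite lee_fin ler_wpM2r // -lee_fin; exact: gnd.
congr (lim (_ @ \oo)); apply/funext => k; rewrite integralT_nnsfun sintegralE.
under [RHS]eq_integral.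
  move=> x _; rewrite fimfunE EFinM -fsumEFin //.
  rewrite ge0_mule_fsuml; last by move=> y; exact: nnfun_muleindic_ge0.
  over.
rewrite ge0_integral_fsum //; last 2 first.
- move=> y; apply: emeasurable_funM; apply/measurable_EFinP => //.
  exact: measurable_funM.
- by move=> y x _; apply: mule_ge0; [exact: nnfun_muleindic_ge0|rewrite lee_fin].
apply: eq_fsbigr => y; rewrite inE => -[x0 _ <-].
under [RHS]eq_integral do rewrite EFinM -muleA.
rewrite ge0_integralZl ?lee_fin //; last 2 first.
- by apply: emeasurable_funM; apply/measurable_EFinP.
- by move=> x _; rewrite mule_ge0 ?lee_fin.
congr (_ * _)%E.
transitivity (\int[mu]_(x in g k @^-1` [set g k x0]) (h x)%:E)%E; first by [].
rewrite integral_mkcond; apply: eq_integral => x _.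
rewrite patchE indicE; case: ifPn => _; first by rewrite mul1e.
by rewrite mul0e.
Qed.

End WeightedMeasure.

(** * The substitution s = 1/r *)

Section Inversion.
Variable R : realType.
Notation lambda := (@lebesgue_measure R).
Implicit Types (a b c x y r s : R) (f v dv w dw : R -> R).

Lemma continuous_inverse_square x : 0 < x ->
  {for x, continuous (fun r : R => r ^- 2)}.
Proof.
move=> x0; apply: continuousV; first by rewrite expf_neq0 // gt_eqF.
exact: exprn_continuous.
Qed.

Lemma measurable_inverse_square :
  measurable_fun (`]0, +oo[ : set (measurableTypeR R)) (fun s : R => s ^- 2).
Proof.
apply: measurable_realfun.open_continuous_measurable_fun.
  exact: interval_open.
move=> s; rewrite inE /= in_itv /= andbT => s0.
exact: continuous_inverse_square.
Qed.

Lemma integral_inverse_square x y : 0 < x -> x <= y ->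
  (\int[lambda]_(s in `[x, y]) (s ^- 2)%:E = (x^-1 - y^-1)%:E)%E.
Proof.
move=> x0; rewrite le_eqVlt => /orP[/eqP <-|xy].
  by rewrite set_itv1 integral_set1 subrr.
have F'E s : 0 < s -> is_derive s 1 (fun r : R => - r^-1) (s ^- 2).
  move=> s0; have -> : s ^- 2 = - (- s ^- 2 *: 1).
    by rewrite /GRing.scale /= mulr1 opprK.
  apply: (@is_deriveN _ _ _ (fun r : R => r^-1)).
  by apply: (@is_deriveV _ id); rewrite /= gt_eqF.
have F_cont s : 0 < s -> {for s, continuous (fun r : R => - r^-1)}.
  by move=> s0; apply: continuousN; apply: inv_continuous; rewrite gt_eqF.
rewrite (@continuous_FTC2 _ _ (fun r => - r^-1)) //.
- by rewrite -EFinB opprK addrC.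
- apply: continuous_in_subspaceT => s; rewrite inE /= in_itv /= => /andP[xs _].
  exact: (continuous_inverse_square (lt_le_trans x0 xs)).
- split.
  + move=> s; rewrite in_itv /= => /andP[xs _].
    by have [] := F'E s (lt_trans x0 xs).
  + by apply: cvg_at_right_filter; exact: F_cont.
  + by apply: cvg_at_left_filter; apply: F_cont; exact: lt_trans xy.
- move=> s; rewrite in_itv /= => /andP[xs _].
  by have [_ <-] := F'E s (lt_trans x0 xs); rewrite derive1E.
Qed.

Variables (a b : R).
Hypotheses (a_gt0 : 0 < a) (ab : a <= b).
(** [phi] is s |-> 1/s, made constant to the left of 1/b, where it would not be
continuous; [rho] is the image under it of the measure ds/s^2 on [1/b, 1/a[.
It is compared to Lebesgue measure on ]a, b]. *)
Let phi : measurableTypeR R -> measurableTypeR R :=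
  fun s : R => (Num.max b^-1 s)^-1.
Let h : measurableTypeR R -> R :=
  fun s : R => (Num.max b^-1 s) ^- 2 * \1_`[b^-1, a^-1[ s.

Let max_gt0 s : 0 < Num.max b^-1 s.
Proof. by rewrite lt_max invr_gt0 (lt_le_trans a_gt0 ab). Qed.

Let mphi : measurable_fun setT phi.
Proof.
apply: measurable_realfun.continuous_measurable_fun => s.
apply: continuousV; first by rewrite gt_eqF.
by apply: (@continuous_max _ _ (cst b^-1) id); [exact: cst_continuous|exact: cvg_id].
Qed.

Let h_ge0 s : 0 <= h s.
Proof. by rewrite mulr_ge0 ?invr_ge0 ?exprn_ge0 // ltW. Qed.

Let mh : measurable_fun setT h.
Proof.
apply: measurable_funM => //.
rewrite (_ : (fun s => _) = (fun s => phi s ^+ 2)).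
  exact: measurable_funX.
by apply/funext => s; rewrite exprVn.
Qed.

Let rho : {measure set (measurableTypeR R) -> \bar R} :=
  measure_function_pushforward__canonical__measure_function_Measure
    (weighted lambda h_ge0 mh) mphi.

Let clamp x := Num.max a (Num.min x b).

Let clamp_bounds x : a <= clamp x <= b.
Proof. by rewrite le_max lexx /= ge_max ab ge_min lexx orbT. Qed.

Let clampP x y : a < y <= b -> (x < y) = (clamp x < y).
Proof.
move=> /andP[ay yb]; rewrite gt_max ay gt_min /=.
by rewrite (ltNge b) yb orbF.
Qed.

(** Both sides are the length of the part of ]x, y] in ]a, b]. *)
Lemma inversion_ocitv x y : x <= y ->
  rho `]x, y]%classic = lambda (`]x, y] `&` `]a, b])%classic.
Proof.
move=> xy; have /andP[ax xb] := clamp_bounds x; have /andP[ay yb] := clamp_bounds y.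
have cxy : clamp x <= clamp y.
  rewrite /clamp ge_max le_max lexx /= le_max; apply/orP; right.
  by rewrite le_min ge_min xy /= ge_min lexx orbT.
have cx0 : 0 < clamp x by exact: lt_le_trans ax.
have cy0 : 0 < clamp y by exact: lt_le_trans ay.
have inE1 r : a < r <= b -> (x < r <= y) = (clamp x < r <= clamp y).
  by move=> rab; rewrite -(clampP _ rab) !(leNgt r) -(clampP _ rab).
transitivity (clamp y - clamp x)%:E; last first.
  rewrite (_ : _ `&` _ = `]clamp x, clamp y]%classic).
    rewrite lebesgue_measure_itv /= lte_fin EFinB.
    by case: ltgtP cxy => // -> _; rewrite subee.
  apply/seteqP; split=> r /=; rewrite !in_itv /=.
    by move=> [rxy rab]; rewrite -inE1.
  move=> /[dup] rc /andP[r1 r2].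
  have rab : a < r <= b by rewrite (le_lt_trans ax r1) (le_trans r2).
  by rewrite inE1.
rewrite /rho /= /pushforward /weighted.
pose l := (clamp y)^-1; pose r := (clamp x)^-1.
transitivity (\int[lambda]_(s in `[l, r[) (s ^- 2)%:E)%E; last first.
  have lr : l <= r by rewrite lef_pV2.
  rewrite integral_itv_bndo_bndc; last first.
    apply/measurable_EFinP; apply: measurable_funS measurable_inverse_square => //.
    move=> s /=; rewrite !in_itv /= andbT => /andP[+ _].
    by apply: lt_le_trans; rewrite invr_gt0.
  by rewrite integral_inverse_square ?invr_gt0 // !invrK.
rewrite [LHS]integral_mkcond [RHS]integral_mkcond; apply: eq_integral => s _.
rewrite !patchE /h indicE.
have lrs : (s \in `[l, r[) = (s \in `[b^-1, a^-1[) && (x < phi s <= y).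
  rewrite !in_itv /=; have [/andP[bs sa]|] := boolP (b^-1 <= s < a^-1).
    have s0 : 0 < s by apply: lt_le_trans bs; rewrite invr_gt0 (lt_le_trans a_gt0).
    rewrite /phi max_r // inE1; last first.
      by rewrite -invf_pgt // sa /= -[b]invrK lef_pV2 ?posrE // invr_gt0 (lt_le_trans a_gt0).
    by rewrite /l /r invf_ple // invf_pgt // andbC.
  apply: contraNF => /andP[ls sr]; apply/andP; split.
    by apply: le_trans ls; rewrite lef_pV2 ?posrE // (lt_le_trans a_gt0).
  by apply: lt_le_trans sr _; rewrite lef_pV2.
have e1 : (s \in `[l, r[%classic) = (s \in `[l, r[) by rewrite mem_setE.
have e2 : (s \in `[b^-1, a^-1[%classic) = (s \in `[b^-1, a^-1[) by rewrite mem_setE.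
have e3 : (s \in phi @^-1` `]x, y]%classic) = (x < phi s <= y).
  by apply/idP/idP; rewrite inE /= in_itv.
rewrite e1 e2 e3 lrs; have [sI|sI] := boolP (s \in `[b^-1, a^-1[) => /=; last first.
  by rewrite mulr0; case: ifP.
rewrite mulr1 max_r //; by move: sI; rewrite in_itv /= => /andP[].
Qed.

(** Lebesgue measure is determined by its values on half-open intervals; [rho]
plus Lebesgue measure off ]a, b] has the same values. *)
Lemma inversion_measure E : measurable E -> E `<=` `]a, b]%classic ->
  lambda E = rho E.
Proof.
move=> mE Eab.
have mC : measurable (~` `]a, b]%classic : set (measurableTypeR R)).
  exact: measurableC.
pose m := measure_add rho
  [the {measure set (measurableTypeR R) -> \bar R} of mrestr lambda mC].
have mA A : m A = (rho A + lambda (A `&` ~` `]a, b]%classic))%E.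
  exact: measure_addE.
have lm : forall X, ocitv X -> lambda X = m X.
  move=> _ [[x y]] _ <- /=; rewrite mA.
  have [xy|yx] := leP x y; last first.
    by rewrite set_itv_ge ?bnd_simp -?leNgt ?ltW // set0I !measure0 adde0.
  by rewrite inversion_ocitv // -setDE addeC -measureDI.
have lE : lambda E = m E := lebesgue_measure_unique lm mE.
rewrite lE mA (_ : E `&` ~` _ = set0) ?measure0 ?adde0 //.
by apply/seteqP; split=> // r [/Eab].
Qed.

Lemma inversion_ge0 f : (forall r, 0 <= f r) -> measurable_fun setT f ->
  (\int[lambda]_(r in `[a, b]) (f r)%:E =
   \int[lambda]_(s in `[(b^-1)%R, (a^-1)%R]) (s ^- 2 * f s^-1)%:E)%E.
Proof.
move=> f0 mf.
rewrite -integral_itv_obnd_cbnd; last by apply/measurable_EFinP; exact: measurable_funTS.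
rewrite (eq_measure_integral rho); last by move=> A mA Aab; exact: inversion_measure.
rewrite ge0_integral_pushforward //; last 2 first.
- by apply/measurable_EFinP; exact: measurable_funTS.
- by move=> r _; rewrite lee_fin.
rewrite integral_mkcond.
pose g := (f \o phi) \_ (phi @^-1` `]a, b]%classic).
have mphiI : measurable (phi @^-1` `]a, b]%classic).
  by rewrite -[X in measurable X]setTI; exact: mphi.
transitivity (\int[weighted lambda h_ge0 mh]_s (g s)%:E)%E.
  by apply: eq_integral => s _; rewrite /g !patchE; case: ifP.
rewrite integral_weighted; last 2 first.
- by move=> s; rewrite /g patchE; case: ifP => _; [exact: f0|exact: lexx].
- rewrite /g; apply/(measurable_restrictT _ _).1; first exact: mphiI.
  by apply: measurable_funTS; exact: measurableT_comp.
rewrite -integral_itv_bndo_bndc; last first.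
  apply/measurable_EFinP; apply: (eq_measurable_fun (fun s => phi s ^+ 2 * f (phi s))).
    move=> s; rewrite inE /= in_itv /= => /andP[bs _].
    by rewrite /phi max_r // exprVn.
  apply: measurable_funTS; apply: measurable_funM; first exact: measurable_funX.
  exact: measurableT_comp.
rewrite [RHS]integral_mkcond; apply: eq_integral => s _.
have e2 : (s \in `[b^-1, a^-1[%classic) = (b^-1 <= s < a^-1).
  by rewrite mem_setE in_itv.
have e1 : (s \in `[b^-1, a^-1[%classic) -> (s \in phi @^-1` `]a, b]%classic).
  rewrite e2 inE /= in_itv /= /phi => /andP[bs sa].
  have s0 : 0 < s by apply: lt_le_trans bs; rewrite invr_gt0 (lt_le_trans a_gt0).
  rewrite max_r // -invf_pgt // sa /= -[leRHS]invrK lef_pV2 ?posrE // invr_gt0.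
  exact: lt_le_trans ab.
rewrite /g !patchE /h indicE.
have [sI|sI] := boolP (s \in `[b^-1, a^-1[%classic); last by rewrite !mulr0.
rewrite (e1 sI) mulr1; move: sI; rewrite e2 => /andP[bs _].
by rewrite /phi /= max_r // mulrC.
Qed.

End Inversion.

Section PrimitiveInversion.
Variable R : realType.
Notation lambda := (@lebesgue_measure R).
Implicit Types (a b c x y r s : R) (f v dv w dw : R -> R).

Lemma measurable_inversion a b f : 0 < a -> measurable_fun setT f ->
  measurable_fun (`[a, b] : set (measurableTypeR R)) (fun s => s ^- 2 * f s^-1).
Proof.
move=> a0 mf; pose phi s := (Num.max a s)^-1.
have mphi : measurable_fun (setT : set (measurableTypeR R)) phi.
  apply: measurable_realfun.continuous_measurable_fun => s.
  apply: continuousV; first by rewrite gt_eqF // lt_max a0.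
  by apply: (@continuous_max _ _ (cst a) id); [exact: cst_continuous|exact: cvg_id].
apply: (eq_measurable_fun (fun s => phi s ^+ 2 * f (phi s))).
  move=> s; rewrite inE /= in_itv /= => /andP[bs _].
  by rewrite /phi max_r // exprVn.
apply: measurable_funTS; apply: measurable_funM; first exact: measurable_funX.
exact: measurableT_comp.
Qed.

(** The substitution rule on the subintervals of [1/b, 1/a]. *)
Lemma primitive_inversion_ge0 a b f : 0 < a -> a <= b ->
  (forall r, 0 <= f r) -> measurable_fun setT f ->
  lambda.-integrable `[a, b] (EFin \o f) ->
  primitive b^-1 a^-1 (fun s => \int[lambda]_(r in `[a, s^-1]) f r)
    (fun s => - (s ^- 2) * f s^-1).
Proof.
move=> a0 ab f0 mf fi.
have b0 := lt_le_trans a0 ab.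
have gi : lambda.-integrable `[b^-1, a^-1] (EFin \o (fun s => s ^- 2 * f s^-1)).
  apply/integrableP; split.
    by apply/measurable_EFinP; apply: measurable_inversion; rewrite ?invr_gt0.
  under eq_integral => s _.
    rewrite /= ger0_norm; last by rewrite mulr_ge0 // invr_ge0 sqr_ge0.
    over.
  rewrite -inversion_ge0 //; case/integrableP: fi => _.
  by under eq_integral => s _ do rewrite /= ger0_norm //.
have gi' : lambda.-integrable `[b^-1, a^-1] (EFin \o (fun s => - (s ^- 2) * f s^-1)).
  apply: eq_integrable (integrableZ_segment (-1) gi) => // s _ /=.
  by rewrite mulrA mulN1r.
split=> // x y bx xy ya.
have x0 : 0 < x by apply: lt_le_trans bx; rewrite invr_gt0.
have y0 := lt_le_trans x0 xy.
have yx' : y^-1 <= x^-1 by rewrite lef_pV2.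
have ay : a <= y^-1 by rewrite invf_pge.
have xb : x^-1 <= b by rewrite invf_ple.
rewrite (Rintegral_segment_split ay yx') //; last first.
  by apply: integrable_segment fi.
rewrite opprD addrA subrr sub0r.
have -> : \int[lambda]_(r in `[y^-1, x^-1]) f r =
    \int[lambda]_(s in `[x, y]) (s ^- 2 * f s^-1).
  by rewrite /Rintegral inversion_ge0 ?invr_gt0 // !invrK.
rewrite -mulN1r -RintegralZl //; last exact: integrable_segment gi.
by apply: eq_Rintegral => s _; rewrite mulrA mulN1r.
Qed.

(** By splitting the derivative into its positive and negative part. *)
Lemma primitive_inversion a b w dw : 0 < a -> a <= b -> primitive a b w dw ->
  primitive b^-1 a^-1 (fun s => w s^-1) (fun s => - (s ^- 2) * dw s^-1).
Proof.
move=> a0 ab [dwi wE].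
have b0 := lt_le_trans a0 ab.
pose f := dw \_ `[a, b].
have mf : measurable_fun setT f.
  apply/(measurable_restrictT _ _).1 => //.
  by apply/measurable_EFinP; exact: measurable_int dwi.
have fE r : a <= r <= b -> f r = dw r.
  by move=> rab; rewrite /f patchE mem_set //= in_itv.
pose fp r := Num.max (f r) 0; pose fn r := Num.max (- f r) 0.
have fpn r : f r = fp r - fn r.
  by rewrite /fp /fn; case: (leP (f r : R) 0) => f0; case: (leP (- f r : R) 0) => g0; lra.
have fi : lambda.-integrable `[a, b] (EFin \o f).
  apply: eq_integrable dwi => // r; rewrite inE /= in_itv /= => rab.
  by rewrite fE.
have mfp : measurable_fun setT fp by exact: measurable_maxr.
have mfn : measurable_fun setT fn.
  by apply: measurable_maxr => //; exact: measurable_funN.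
have fpi : lambda.-integrable `[a, b] (EFin \o fp).
  apply: le_integrable fi => //; first by apply/measurable_EFinP; exact: measurable_funTS.
  move=> r _ /=; rewrite lee_fin /fp; case: (leP (f r) 0) => [|/ltW] fr.
    by rewrite normr0.
  by [].
have fni : lambda.-integrable `[a, b] (EFin \o fn).
  apply: le_integrable fi => //; first by apply/measurable_EFinP; exact: measurable_funTS.
  move=> r _ /=; rewrite lee_fin /fn -normrN; case: (leP (- f r) 0) => [|/ltW] fr.
    by rewrite normrN normr0.
  by rewrite normrN (normrN (f r)).
have fp0 r : 0 <= fp r by rewrite le_max lexx orbT.
have fn0 r : 0 <= fn r by rewrite le_max lexx orbT.
have := primitiveD (primitive_cst b^-1 a^-1 (w a))
  (primitiveD (primitive_inversion_ge0 a0 ab fp0 mfp fpi)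
   (primitiveZ (-1) (primitive_inversion_ge0 a0 ab fn0 mfn fni))).
apply: primitive_eq => s /andP[bs sa].
have s0 : 0 < s by apply: lt_le_trans bs; rewrite invr_gt0.
have as_ : a <= s^-1 by rewrite invf_pge.
have sb : s^-1 <= b by rewrite invf_ple.
split; last first.
  by rewrite add0r mulN1r -mulrBr -fpn fE // as_.
rewrite mulN1r -RintegralB //; first last.
- exact: integrable_segment fni.
- exact: integrable_segment fpi.
rewrite -[RHS](subrK (w a)) addrC wE //; congr (_ + _).
apply: eq_Rintegral => r; rewrite inE /= in_itv /= => /andP[ar rs].
by rewrite -fpn fE // ar (le_trans rs).
Qed.

End PrimitiveInversion.

(** * Times of change *)

Section ChangeTimes.
Variables (R : realType) (n : nat).
Notation V := 'rV[R]_n.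
Implicit Types (u : R -> V) (t : nat -> R) (c : nat -> V).

Lemma locally_affine_derive1 u (r : R) (b : V) :
  (\forall s \near r, u s = u r + (s - r) *: b) -> derive1 u r = b.
Proof.
move=> /nbhs_ballP[e /= e0 ue]; rewrite /derive1; apply: lim_near_cst.
  exact: norm_hausdorff.
exists e => //= h /=; rewrite sub0r normrN => he h0.
rewrite ue; last by rewrite /ball /= opprD addrCA subrr addr0 normrN.
by rewrite addrAC subrr add0r addrK scalerA mulVf // scale1r.
Qed.

Lemma interior_piece N t (r : R) : increasing_times N t -> t 0%N < r ->
  (forall k, (0 < k <= N)%N -> r != t k) ->
  exists i (e : R), [/\ (i <= N)%N, 0 < e &
    forall s, `|s - r| < e -> piece N t i s].
Proof.
move=> tP tr rt; have [i iN [tir rti]] := piece_exists N tr.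
have [iN'|Ni] := ltnP i N.
  have rti' : r < t i.+1 by rewrite lt_neqAle rti // rt.
  exists i, (Num.min (r - t i) (t i.+1 - r)); split=> //.
    by rewrite lt_min !subr_gt0 tir.
  move=> s; rewrite lt_min ltr_norml => /andP[/andP[s1 _]].
  by rewrite ltr_norml => /andP[_ s2]; split=> [|_]; lra.
exists i, (r - t i); split=> //; first by rewrite subr_gt0.
move=> s; rewrite ltr_norml => /andP[s1 _]; split; first by lra.
by rewrite ltnNge Ni.
Qed.

Lemma vertex_near N t k (e : R) : increasing_times N t -> (k < N)%N -> 0 < e ->
  exists x y : R, [/\ x < t k.+1, t k.+1 < y, `|x - t k.+1| < e,
    `|y - t k.+1| < e & piece N t k x /\ piece N t k.+1 y].
Proof.
move=> tP kN e0.
have t1 : t k < t k.+1 by apply: tP; exact: ltnW.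
have t2 : t k.+1 < t k.+2 by exact: tP.
pose d := Num.min (e / 2) (Num.min ((t k.+1 - t k) / 2) (t k.+2 - t k.+1)).
have d0 : 0 < d by rewrite !lt_min !divr_gt0 ?subr_gt0.
have [d1 [d2 d3]] : d <= e / 2 /\ d <= (t k.+1 - t k) / 2 /\ d <= t k.+2 - t k.+1.
  by rewrite !ge_min !lexx !orbT.
exists (t k.+1 - d), (t k.+1 + d); split; try lra.
- by rewrite addrAC subrr add0r normrN gtr0_norm //; lra.
- by rewrite addrAC subrr add0r gtr0_norm //; lra.
- by split; split=> [|_]; lra.
Qed.

(** If the curve is affine around a vertex, then both adjacent slopes equal its
slope there. *)
Lemma broken_line_change_times u N t c : t 0%N = 0 -> increasing_times N t ->
  broken_line u N t c -> (forall i, (i < N)%N -> c i != c i.+1) ->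
  change_times N t (locally_affine u).
Proof.
move=> t0 tP bl cc r r0; split; last first.
  move=> [[|k] // /andP[_ kN] ->] [b /nbhs_ballP[e /= e0 be]].
  have [x [y [xt ty xe ye [px py]]]] := vertex_near tP kN e0.
  move/eqP: (cc k kN); apply.
  have bx : u x = u (t k.+1) + (x - t k.+1) *: b by apply: be; rewrite /ball /= distrC.
  have by' : u y = u (t k.+1) + (y - t k.+1) *: b by apply: be; rewrite /ball /= distrC.
  have tk : u (t k.+1) = u (t k) + (t k.+1 - t k) *: c k.
    by apply: bl; [exact: ltnW|split=> //; rewrite ltW // tP // ltnW].
  have ux : u x = u (t k.+1) + (x - t k.+1) *: c k.
    rewrite tk (bl k x (ltnW kN) (piece_closed px)) -addrA -scalerDl.
    by congr (_ + _ *: _); ring.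
  have uy := bl k.+1 y kN (piece_closed py).
  transitivity b.
    apply: (@scalerI _ _ (x - t k.+1)); first by rewrite subr_eq0 lt_eqF.
    by apply: (@addrI _ (u (t k.+1))); rewrite -ux bx.
  apply: (@scalerI _ _ (y - t k.+1)); first by rewrite subr_eq0 gt_eqF.
  by apply: (@addrI _ (u (t k.+1))); rewrite -uy by'.
move=> Nr; apply: contrapT => H; apply: Nr.
have [||i [e [iN e0 pe]]] := @interior_piece N t r tP.
- by rewrite t0.
- by move=> k kN; apply/eqP => rk; apply: H; exists k.
have pr := piece_closed (pe r _); rewrite subrr normr0 in pr.
exists (c i); apply/nbhs_ballP; exists e => // s; rewrite /ball /= distrC => se.
rewrite (bl i s iN (piece_closed (pe s se))) (bl i r iN (pr e0)).
by rewrite -addrA -scalerDl; congr (_ + _ *: _); ring.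
Qed.

Lemma broken_line_derive1 u N t c (r : R) : t 0%N = 0 -> increasing_times N t ->
  broken_line u N t c -> 0 < r -> (forall k, (0 < k <= N)%N -> r != t k) ->
  derive1 u r = step N t c r.
Proof.
move=> t0 tP bl r0 rt.
have [|i [e [iN e0 pe]]] := @interior_piece N t r tP _ rt; first by rewrite t0.
have pr := pe r; rewrite subrr normr0 in pr; have {}pr := pr e0.
rewrite (step_piece c tP iN pr); apply: locally_affine_derive1.
apply/nbhs_ballP; exists e => // s; rewrite /ball /= distrC => se.
rewrite (bl i s iN (piece_closed (pe s se))) (bl i r iN (piece_closed pr)).
by rewrite -addrA -scalerDl; congr (_ + _ *: _); ring.
Qed.

Lemma step_change_times u N t c : t 0%N = 0 -> increasing_times N t ->
  (forall i r, (i <= N)%N -> piece N t i r -> u r = c i) ->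
  (forall i, (i < N)%N -> c i != c i.+1) ->
  change_times N t (locally_constant u).
Proof.
move=> t0 tP uc cc r r0; split; last first.
  move=> [[|k] // /andP[_ kN] ->] /nbhs_ballP[e /= e0 be].
  have [x [y [xt ty xe ye [px py]]]] := vertex_near tP kN e0.
  move/eqP: (cc k kN); apply.
  rewrite -(uc _ _ (ltnW kN) px) -(uc _ _ kN py).
  by rewrite !be // /ball /= distrC.
move=> Nr; apply: contrapT => H; apply: Nr.
have [||i [e [iN e0 pe]]] := @interior_piece N t r tP.
- by rewrite t0.
- by move=> k kN; apply/eqP => rk; apply: H; exists k.
have pr := pe r; rewrite subrr normr0 in pr; have {}pr := pr e0.
apply/nbhs_ballP; exists e => // s; rewrite /ball /= distrC => se.
by rewrite (uc i s iN (pe s se)) (uc i r iN pr).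
Qed.

End ChangeTimes.

(** * Distributional derivatives of step functions *)

Section Pairings.
Variables (R : realType) (n : nat).
Notation V := 'rV[R]_n.
Notation lambda := (@lebesgue_measure R).
Implicit Types (u v w dw F dF g : R -> V) (t : nat -> R) (c phi : nat -> V).

(** The derivative of a broken line is known off the vertices only. *)
Lemma measurable_off_finite (D : set R) (g h : R -> R) (s : seq R) :
  measurable D -> measurable_fun D h ->
  (forall r, D r -> r \notin s -> g r = h r) -> measurable_fun D g.
Proof.
move=> mD; elim: s h => [|x s IHs] h mh gh.
  by apply: eq_measurable_fun mh => r; rewrite inE => Dr; rewrite gh.
pose h' r := h r + (g x - h x) * \1_[set x] r.
apply: (IHs h').
  apply: measurable_funD => //; apply: measurable_funM; first exact: measurable_cst.
  by apply: measurable_funTS; exact: measurable_indic.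
move=> r Dr rs; rewrite /h' indicE.
have [->|rx] := eqVneq r x; first by rewrite mem_set // mulr1 addrC subrK.
rewrite memNset ?mulr0 ?addr0; last by move=> /= rxE; rewrite rxE eqxx in rx.
by apply: gh => //; rewrite inE negb_or rx.
Qed.

Lemma test_primitive w dw a b j : 0 < a -> a <= b -> test w dw ->
  primitive a b (fun r => w r 0 j) (fun r => dw r 0 j).
Proof.
move=> a0 ab [W _]; apply: W11loc_primitive W => // r /andP[ar _].
by rewrite /= in_itv /= andbT (lt_le_trans a0).
Qed.

Lemma test_mulr w dw : test w dw ->
  test (fun r => r *: w r) (fun r => w r + r *: dw r).
Proof.
move=> tw; have [W [a [b [a0 ab w0]]]] := tw; split.
  apply: primitive_W11loc => x y j; rewrite /= !in_itv /= !andbT => x0 y0 xy.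
  have := primitiveM xy (primitive_id x y) (test_primitive j x0 xy tw).
  by apply: primitive_eq => r _; rewrite !mxE mulr1 addrC.
exists a, b; split=> // r r0 rab; have [-> ->] := w0 r r0 rab.
by rewrite !scaler0 addr0.
Qed.

Lemma test_inversion w dw : test w dw ->
  test (fun s => w s^-1) (fun s => - (s ^- 2) *: dw s^-1).
Proof.
move=> tw; have [W [a [b [a0 ab w0]]]] := tw; split.
  apply: primitive_W11loc => x y j; rewrite /= !in_itv /= !andbT => x0 y0 xy.
  have yx : y^-1 <= x^-1 by rewrite lef_pV2.
  have y'0 : 0 < y^-1 by rewrite invr_gt0.
  have := primitive_inversion y'0 yx (test_primitive j y'0 yx tw).
  by rewrite !invrK; apply: primitive_eq => r _; rewrite !mxE.
have b0 := lt_le_trans a0 ab.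
exists b^-1, a^-1; split; rewrite ?invr_gt0 ?lef_pV2 // => r r0 rab.
have [||-> ->] := w0 r^-1; first by rewrite invr_gt0.
  by rewrite invf_pge // invf_ple // andbC.
by rewrite scaler0.
Qed.

Lemma Rintegral_support (h : R -> R) (a b A B : R) : 0 < A -> A <= a -> b <= B ->
  (forall r, 0 < r -> ~~ (a <= r <= b) -> h r = 0) ->
  \int[lambda]_(r in `]0, +oo[) h r = \int[lambda]_(r in `[A, B]) h r.
Proof.
move=> A0 Aa bB h0; rewrite Rintegral_mkcond [RHS]Rintegral_mkcond.
apply: eq_Rintegral => r _; rewrite !patchE !mem_setE !in_itv /= andbT.
have [/andP[Ar rB]|rAB] := boolP (A <= r <= B); first by rewrite (lt_le_trans A0).
have [r0|//] := ltP 0 r; apply: h0 => //; apply: contra rAB => /andP[ar rb].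
by rewrite (le_trans Aa) // (le_trans rb).
Qed.

Lemma Rintegral_after (f : R -> R) (A B x : R) : A <= x -> x <= B ->
  lambda.-integrable `[A, B] (EFin \o f) ->
  \int[lambda]_(r in `[A, B]) ((x < r)%R%:R * f r) = \int[lambda]_(r in `[x, B]) f r.
Proof.
move=> Ax xB fi.
have xfi : lambda.-integrable `[A, B] (EFin \o (fun r => (x < r)%R%:R * f r)).
  have fi' := fi; apply: le_integrable fi' => //.
    apply/measurable_EFinP; apply: measurable_funM.
      by have [/(measurable_int lambda)/measurable_EFinP] := primitive_ramp A B x.
    by apply/measurable_EFinP; exact: measurable_int fi.
  move=> r _ /=; rewrite lee_fin; case: (x < r); first by rewrite mul1r.
  by rewrite mul0r normr0.
rewrite (Rintegral_segment_split Ax xB) //.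
have -> : \int[lambda]_(r in `[A, x]) ((x < r)%R%:R * f r) = 0.
  transitivity (\int[lambda]_(r in `[A, x]) (0 : R)).
    apply: eq_Rintegral => r; rewrite inE /= in_itv /= => /andP[_ rx].
    by rewrite ltNge rx mul0r.
  by rewrite Rintegral_cst // mul0r.
rewrite add0r.
rewrite -Rintegral_itv_obnd_cbnd; last first.
  apply: integrableS xfi => //; apply: subset_itv; rewrite bnd_simp //.
rewrite -[RHS]Rintegral_itv_obnd_cbnd; last first.
  apply: integrableS fi => //; apply: subset_itv; rewrite bnd_simp //.
apply: eq_Rintegral => r; rewrite inE /= in_itv /= => /andP[-> _].
by rewrite mul1r.
Qed.

(** A step function is a constant plus multiples of indicators of half-lines
]t_k, +oo[; against these, dF integrates to - F (t_k), since F vanishes at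
infinity. *)
Lemma step_pairing N t c F dF g : t 0%N = 0 -> increasing_times N t ->
  (forall a b j, 0 < a -> measurable_fun (`[a, b] : set (measurableTypeR R))
     (fun r => g r 0 j)) ->
  {ae lambda, forall r, 0 < r -> g r = step N t c r} -> test F dF ->
  \int[lambda]_(r in `]0, +oo[) dotp (dF r) (g r) =
    - \sum_(k < N) dotp (c k.+1 - c k) (F (t k.+1)).
Proof.
move=> t0 tP mg gE tF; have [_ [a [b [a0 ab F0]]]] := tF.
have t1 : 0 < t 1%N by rewrite -t0 tP.
pose A := Num.min (a / 2) (t 1%N); pose B := Num.max (b + 1) (t N).
have A0 : 0 < A by rewrite lt_min t1 divr_gt0.
have [Aa At] : A <= a / 2 /\ A <= t 1%N by rewrite !ge_min !lexx orbT.
have [bB tB] : b + 1 <= B /\ t N <= B by rewrite !le_max !lexx orbT.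
have AB : A <= B by lra.
have tk (k : 'I_N) : A <= t k.+1 <= B.
  rewrite (le_trans At) /=; last by apply: (increasing_times_le tP); rewrite ltnS leqW.
  by apply: le_trans tB; apply: (increasing_times_le tP); rewrite leqnSn andbT.
have FA : F A = 0.
  by have [->] : F A = 0 /\ dF A = 0 by apply: F0 => //; apply/negP => /andP[]; lra.
have FB : F B = 0.
  have [->] : F B = 0 /\ dF B = 0; last by [].
  by apply: F0; [lra|apply/negP => /andP[]; lra].
rewrite (@Rintegral_support _ a b A B) //; [|lra|lra|]; last first.
  by move=> r r0 rab; have [_ ->] := F0 r r0 rab; rewrite dotp0l.
have Fp j := test_primitive j A0 AB tF.
have dFi j : lambda.-integrable `[A, B] (EFin \o (fun r => dF r 0 j)).
  by have [] := Fp j.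
have mdF j : measurable_fun (`[A, B] : set (measurableTypeR R)) (fun r => dF r 0 j).
  by apply/measurable_EFinP; exact: measurable_int (dFi j).
transitivity (\int[lambda]_(r in `[A, B]) dotp (dF r) (step N t c r)).
  congr fine; apply: ae_eq_integral => //.
  - apply/measurable_EFinP; apply: measurable_sum => j.
    by apply: measurable_funM; [exact: mdF|exact: mg].
  - apply/measurable_EFinP; apply: measurable_sum => j.
    by apply: measurable_funM; [exact: mdF|exact: measurable_step].
  - apply: aeS gE => r gr; rewrite /= in_itv /= => /andP[Ar _].
    by rewrite gr // (lt_le_trans A0).
have dotpi (x : V) : lambda.-integrable `[A, B] (EFin \o (fun r => dotp x (dF r))) /\
    forall y, A <= y -> y <= B ->
    \int[lambda]_(r in `[y, B]) dotp x (dF r) = dotp x (F B - F y).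
  have [i E] := primitive_sum (index_enum 'I_n) xpredT
    (fun j => primitiveZ (x 0 j) (Fp j)).
  split=> // y Ay yB; rewrite /dotp -E // -sumrB.
  by apply: eq_bigr => j _; rewrite !mxE mulrBr.
have ramp_i (x : V) (s : R) : lambda.-integrable `[A, B]
    (EFin \o (fun r => (s < r)%R%:R * dotp x (dF r))).
  have [xi _] := dotpi x; have xi' := xi.
  apply: le_integrable xi' => //.
    apply/measurable_EFinP; apply: measurable_funM.
      by have [/(measurable_int lambda)/measurable_EFinP] := primitive_ramp A B s.
    by apply/measurable_EFinP; exact: measurable_int xi.
  move=> r _ /=; rewrite lee_fin; case: (s < r); first by rewrite mul1r.
  by rewrite mul0r normr0.
transitivity (\int[lambda]_(r in `[A, B]) (dotp (c 0%N) (dF r) +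
    \sum_(k < N) (t k.+1 < r)%R%:R * dotp (c k.+1 - c k) (dF r))).
  apply: eq_Rintegral => r _; rewrite dotpC /step dotpDl dotp_suml; congr (_ + _).
  by apply: eq_bigr => k _; rewrite dotpZl.
have sumi (s : seq 'I_N) : lambda.-integrable `[A, B] (EFin \o
     (fun r => \sum_(k <- s) (t k.+1 < r)%R%:R * dotp (c k.+1 - c k) (dF r))) /\
   \int[lambda]_(r in `[A, B])
     (\sum_(k <- s) (t k.+1 < r)%R%:R * dotp (c k.+1 - c k) (dF r)) =
   - \sum_(k <- s) dotp (c k.+1 - c k) (F (t k.+1)).
  elim: s => [|k s [IHi IHE]].
    split.
      apply: eq_integrable (integrable_cst_segment A B 0) => // r _ /=.
      by rewrite big_nil.
    under eq_Rintegral do rewrite big_nil.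
    by rewrite Rintegral_cst // mul0r big_nil oppr0.
  split.
    apply: eq_integrable (integrableD_segment (ramp_i (c k.+1 - c k) (t k.+1)) IHi) => //.
    by move=> r _ /=; rewrite big_cons.
  under eq_Rintegral do rewrite big_cons.
  rewrite RintegralD // IHE big_cons opprD; congr (_ + _).
  have /andP[Atk tkB] := tk k; have [xi xE] := dotpi (c k.+1 - c k).
  by rewrite Rintegral_after // xE // FB sub0r dotpNr.
have [c0i c0E] := dotpi (c 0%N); have [si sE] := sumi (index_enum 'I_N).
by rewrite RintegralD // c0E // sE FA FB subrr dotp0r add0r.
Qed.

(** The sum starts at 1: a peak at t_0 = 0 is invisible to test functions on
]0, +oo[. *)
Definition peaks (L : vdistribution R n) N t phi := forall w dw, test w dw ->
  L w dw = \sum_(k < N) dotp (phi k.+1) (w (t k.+1)).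

Lemma t_second_derivative_peaks u N t c : t 0%N = 0 -> increasing_times N t ->
  broken_line u N t c ->
  peaks (t_second_derivative u) N t (fun i => t i *: (c i - c i.-1)).
Proof.
move=> t0 tP bl w dw tw; rewrite /t_second_derivative.
rewrite (@step_pairing N t c (fun r => r *: w r)) //; last exact: test_mulr.
- by rewrite opprK; apply: eq_bigr => k _; rewrite dotpZl dotpZr.
- move=> a b j a0.
  apply: (@measurable_off_finite _ _ (fun r => step N t c r 0 j)
     [seq t k | k <- iota 1 N]) => //; first exact: measurable_step.
  move=> r; rewrite /= in_itv /= => /andP[ar _] rt.
  rewrite (broken_line_derive1 t0 tP bl) ?(lt_le_trans a0) // => k /andP[k0 kN].
  by apply: contraNneq rt => ->; apply: map_f; rewrite mem_iota k0 add1n ltnS.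
- have H : {ae lambda, forall r, forall k : 'I_N.+1, r != t k}.
    by apply: ae_forall_ord => k; exact: ae_neq.
  apply: aeS H => r rt r0; apply: (broken_line_derive1 t0 tP bl) => // k /andP[_ kN].
  by have := rt (Ordinal (kN : (k < N.+1)%N)).
Qed.

Lemma distr_derivative_peaks v N t c : t 0%N = 0 -> increasing_times N t ->
  (forall a b j, 0 < a -> measurable_fun (`[a, b] : set (measurableTypeR R))
     (fun r => v r 0 j)) ->
  {ae lambda, forall r, 0 < r -> v r = step N t c r} ->
  peaks (distr_derivative v) N t (fun i => c i - c i.-1).
Proof.
move=> t0 tP mv vE w dw tw; rewrite /distr_derivative.
under eq_Rintegral do rewrite dotpC.
by rewrite (step_pairing t0 tP mv vE tw) opprK.
Qed.

Lemma invert_peaks L N t phi : peaks L N t phi ->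
  peaks (invert L) N (fun i => (t i)^-1) phi.
Proof. by move=> LP w dw tw; rewrite /invert LP //; exact: test_inversion. Qed.

End Pairings.

(** * Polar decompositions of finitely many peaks *)

Section FinitePolar.
Variables (R : realType) (n N : nat).
Notation V := 'rV[R]_n.
Variables (s : nat -> R) (phi : nat -> V).
Hypothesis s_gt0 : forall k, (k < N)%N -> 0 < s k.
Hypothesis s_inj : forall k l, (k < N)%N -> (l < N)%N -> s k = s l -> k = l.
Hypothesis phi_neq0 : forall k, (k < N)%N -> phi k != 0.
Implicit Types (L : vdistribution R n) (w dw : R -> V).

Lemma enorm_ge0 (u : V) : 0 <= enorm u.
Proof. exact: sqrtr_ge0. Qed.

Lemma enorm_eq0 (u : V) : (enorm u == 0) = (u == 0).
Proof.
apply/eqP/eqP => [u0|->]; last by rewrite /enorm dotp0l sqrtr0.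
by apply: dotp_le0; rewrite -enorm_sqr u0 expr0n.
Qed.

Definition point_masses : {measure set (measurableTypeR R) -> \bar R} :=
  msum (fun k => mscale (NngNum (enorm_ge0 (phi k))) (dirac (s k : measurableTypeR R))) N.

Definition directions (r : R) : V :=
  \sum_(k < N) (r == s k)%:R *: ((enorm (phi k))^-1 *: phi k).

Lemma point_massesE (A : set (measurableTypeR R)) :
  point_masses A = (\sum_(k < N) enorm (phi k) * (s k \in A)%:R)%:E.
Proof.
rewrite /point_masses /= /msum -sumEFin; apply: eq_bigr => k _.
by rewrite EFinM /mscale /=; congr (_ * _)%E; rewrite /dirac indicE.
Qed.

Lemma directionsE k : (k < N)%N ->
  directions (s k) = (enorm (phi k))^-1 *: phi k.
Proof.
move=> kN; rewrite /directions (bigD1 (Ordinal kN)) //= eqxx scale1r big1 ?addr0 //.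
move=> l lk; case: eqP => [/s_inj E|_]; last by rewrite scale0r.
by move/eqP: lk; case; apply: val_inj; rewrite /= E.
Qed.

Lemma point_masses_point k : (k < N)%N ->
  point_masses [set s k] = (enorm (phi k))%:E.
Proof.
move=> kN; rewrite point_massesE (bigD1 (Ordinal kN)) //= mem_set // mulr1.
rewrite big1 ?addr0 // => l lk; rewrite memNset ?mulr0 //= => /s_inj E.
by move/eqP: lk; case; apply: val_inj; rewrite /= E.
Qed.

Lemma point_masses_lty (A : set (measurableTypeR R)) : (point_masses A < +oo)%E.
Proof. by rewrite point_massesE ltry. Qed.

Lemma point_masses_polar L :
  (forall w dw, test w dw -> L w dw = \sum_(k < N) dotp (phi k) (w (s k))) ->
  polar_decomposition L point_masses directions.
Proof.
move=> LP; split.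
- split; last by move=> a b _; exact: point_masses_lty.
  rewrite point_massesE big1 // => k _; rewrite memNset ?mulr0 //=.
  by apply/negP; rewrite -ltNge s_gt0.
- move=> j.
  rewrite (_ : (fun r => _) = fun r =>
      \sum_(k < N) ((r == s k)%:R *: ((enorm (phi k))^-1 *: phi k)) 0 j); last first.
    by apply/funext => r; rewrite summxE.
  apply: measurable_sum => k.
  apply: (eq_measurable_fun (fun r : measurableTypeR R =>
     \1_[set s k] r * ((enorm (phi k))^-1 *: phi k) 0 j)).
    move=> r _; rewrite !mxE indicE; congr (_ * _).
    have [->|rs] := eqVneq r (s k); first by rewrite mem_set.
    by rewrite memNset //= => E; rewrite E eqxx in rs.
  apply: measurable_funM; last exact: measurable_cst.
  by apply: measurable_funTS; exact: measurable_indic.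
- exists (~` (\bigcup_(k in `I_N) [set s k])); split.
  + by apply: measurableC; apply: bigcup_measurable => k _; exact: measurable_set1.
  + rewrite point_massesE big1 // => k _; rewrite memNset ?mulr0 //=.
    by apply; exists (val k) => //=.
  + move=> r /=; apply: contra_not => -[k /= kN ->].
    have x0 : enorm (phi k) != 0 by rewrite enorm_eq0 phi_neq0.
    have xx : dotp (phi k) (phi k) = enorm (phi k) * enorm (phi k).
      by rewrite -enorm_sqr expr2.
    by rewrite directionsE // {1}/enorm dotpZl dotpZr xx mulKf // mulVf // sqrtr1.
- move=> w dw tw; rewrite LP //.
  pose a k := dotp (w (s k)) (directions (s k)).
  transitivity (\int[point_masses]_(r in `]0, +oo[)
      (\sum_(k < N) a k * \1_[set s k] r)); last first.
    apply: eq_Rintegral => r _.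
    have [[k kN ->]|rs] := pselect (exists2 k, (k < N)%N & r = s k).
      rewrite (bigD1 (Ordinal kN)) //= indicE mem_set // mulr1 big1 ?addr0 //.
      move=> l lk; rewrite indicE memNset ?mulr0 //= => /s_inj E.
      by move/eqP: lk; case; apply: val_inj; rewrite /= E.
    rewrite big1 => [|k _]; last first.
      rewrite indicE memNset ?mulr0 //= => E; apply: rs; by exists k.
    rewrite /directions big1 ?dotp0r // => k _; case: eqP => [E|_]; last by rewrite scale0r.
    by case: rs; exists k.
  have ind_i (c : R) k : point_masses.-integrable `]0, +oo[
      (EFin \o (fun r => c * \1_[set s k] r)).
    apply: measurable_bounded_integrable => //.
    - exact: point_masses_lty.
    - apply: measurable_funM; first exact: measurable_cst.
      by apply: measurable_funTS; exact: measurable_indic.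
    - exists `|c|; split; first exact: num_real.
      move=> M cM r _ /=; apply: le_trans (ltW cM).
      rewrite normrM indicE; case: (_ \in _); first by rewrite normr1 mulr1.
      by rewrite normr0 mulr0.
  have ind_E (c : R) (k : 'I_N) : \int[point_masses]_(r in `]0, +oo[)
      (c * \1_[set s k] r) = c * enorm (phi k).
    rewrite RintegralZl //; last first.
      by have := ind_i 1 k; apply: eq_integrable => // r _ /=; rewrite mul1r.
    congr (_ * _); rewrite /Rintegral integral_indic // setIidl.
      by rewrite point_masses_point.
    by move=> r ->; rewrite /= in_itv /= s_gt0.
  have sumi (l : seq 'I_N) : point_masses.-integrable `]0, +oo[
      (EFin \o (fun r => \sum_(k <- l) a k * \1_[set s k] r)) /\
    \int[point_masses]_(r in `]0, +oo[) (\sum_(k <- l) a k * \1_[set s k] r) =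
      \sum_(k <- l) a k * enorm (phi k).
    elim: l => [|k l [IHi IHE]].
      split.
        have := @integrable0 _ _ _ point_masses `]0, +oo[%classic.
        by apply: eq_integrable => // r _ /=; rewrite big_nil.
      under eq_Rintegral do rewrite big_nil.
      by rewrite Rintegral_cst // mul0r big_nil.
    split.
      apply: eq_integrable (integrableD _ (ind_i (a k) k) IHi) => // r _ /=.
      by rewrite big_cons EFinD.
    under eq_Rintegral do rewrite big_cons.
    by rewrite RintegralD // IHE big_cons ind_E.
  rewrite (sumi (index_enum 'I_N)).2; apply: eq_bigr => k _.
  rewrite /a directionsE // dotpZr mulrC mulrA divff ?mul1r ?enorm_eq0 ?phi_neq0 //.
  exact: dotpC.
Qed.

End FinitePolar.

(** * Masses of points in an arbitrary polar decomposition *)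

Section Hat.
Variable R : realType.
Implicit Types (x e r : R).

(** The tent of height 1 at x that vanishes outside [x - e, x + e], as a
combination of ramps, whose derivatives are known. *)
Definition hat x e r : R := e^-1 * (Num.max (r - (x - e)) 0 +
  (- 2 * Num.max (r - x) 0 + Num.max (r - (x + e)) 0)).

Definition hat' x e r : R := e^-1 * ((x - e < r)%R%:R +
  (- 2 * (x < r)%R%:R + (x + e < r)%R%:R)).

Lemma primitive_hat a b x e : primitive a b (hat x e) (hat' x e).
Proof.
apply: primitiveZ; apply: primitiveD; first exact: primitive_ramp.
by apply: primitiveD; [apply: primitiveZ|]; exact: primitive_ramp.
Qed.

Lemma hat_center x e : 0 < e -> hat x e x = 1.
Proof.
move=> e0; rewrite /hat max_l; last lra.
rewrite max_r; last lra.
rewrite max_r; last lra.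
by rewrite mulr0 !addr0 opprB addrC subrK mulVf // gt_eqF.
Qed.

Lemma hat_out x e r : 0 < e -> ~~ (x - e <= r <= x + e) ->
  hat x e r = 0 /\ hat' x e r = 0.
Proof.
move=> e0; rewrite negb_and -!ltNge => /orP[rx|xr].
  rewrite /hat /hat' !max_r; try lra.
  have /negbTE -> : ~~ (x - e < r) by rewrite -leNgt ltW.
  have /negbTE -> : ~~ (x < r) by rewrite -leNgt; lra.
  have /negbTE -> : ~~ (x + e < r) by rewrite -leNgt; lra.
  by rewrite !mulr0 !addr0 !mulr0.
rewrite /hat /hat' !max_l; try lra.
have -> : x - e < r by lra.
have -> : x < r by lra.
by rewrite xr; split; rewrite [X in _ * X](_ : _ = 0) ?mulr0 //=; lra.
Qed.

Lemma hat_bounds x e r : 0 < e -> 0 <= hat x e r <= 1.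
Proof.
move=> e0; rewrite /hat.
set X := (X in _ * X); have /andP[X0 Xe] : 0 <= X <= e.
  rewrite /X; case: (leP (r - (x - e)) 0); case: (leP (r - x) 0);
    case: (leP (r - (x + e)) 0); lra.
by rewrite mulr_ge0 ?invr_ge0 ?(ltW e0) //= mulrC ler_pdivrMr // mul1r.
Qed.

End Hat.

Section PolarUnique.
Variables (R : realType) (n : nat).
Notation V := 'rV[R]_n.
Implicit Types (L : vdistribution R n).

Lemma test_hat x e j : 0 < e -> e < x ->
  test (fun r => hat x e r *: (delta_mx 0 j : V))
       (fun r => hat' x e r *: (delta_mx 0 j : V)).
Proof.
move=> e0 ex; split.
  apply: primitive_W11loc => a b k _ _ _.
  have := primitiveZ ((delta_mx 0 j : V) 0 k) (primitive_hat a b x e).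
  apply: primitive_eq => r _; rewrite [in RHS]mxE [in X in _ /\ _ = X]mxE.
  by rewrite !(mulrC (hat _ _ _)) (mulrC (hat' _ _ _)).
exists (x - e), (x + e); split; try lra.
by move=> r _ /(hat_out e0)[-> ->]; rewrite !scale0r.
Qed.

Lemma coord_le_enorm (u : V) j : `|u 0 j| <= enorm u.
Proof. by rewrite -sqrtr_sqr ler_wsqrtr // sqr_coord_le. Qed.

(** By dominated convergence, narrowing the tents around x isolates the mass at
x. *)
Lemma polar_point L (mu : {measure set (measurableTypeR R) -> \bar R}) psi
    (x : R) (p : V) : 0 < x ->
  (exists2 e0 : R, 0 < e0 & forall (e : R) j, 0 < e -> e < e0 -> e < x ->
     L (fun r => hat x e r *: delta_mx 0 j) (fun r => hat' x e r *: delta_mx 0 j)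
     = p 0 j) ->
  polar_decomposition L mu psi -> p = fine (mu [set x]) *: psi x.
Proof.
move=> x0 [e0 e00 Lp] [[_ mu_fin] mpsi psi1 LE].
apply/rowP => j; rewrite mxE.
pose m := Num.min e0 (x / 2).
have m0 : 0 < m by rewrite lt_min e00 divr_gt0.
have [me mx] : m <= e0 /\ m <= x / 2 by rewrite !ge_min !lexx orbT.
pose e k : R := m * k.+2%:R^-1.
have e_gt0 k : 0 < e k by rewrite mulr_gt0.
have e_lt k : e k < m.
  by rewrite /e gtr_pMr // invf_lt1 // ltr1n.
pose D : set (measurableTypeR R) := `]0, +oo[%classic.
pose f_ k (r : measurableTypeR R) := (hat x (e k) r * psi r 0 j)%:E.
pose f (r : measurableTypeR R) := (\1_[set x] r * psi r 0 j)%:E.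
pose g (r : measurableTypeR R) := (\1_`[x / 2, 2 * x] r : R)%:E.
have mD : measurable D by exact: measurable_itv.
have mf_ k : measurable_fun D (f_ k).
  apply/measurable_EFinP; apply: measurable_funM; last exact: mpsi.
  apply: measurable_funTS; apply: measurable_funM; first exact: measurable_cst.
  apply: measurable_funD; first by apply: measurable_maxr => //; exact: measurable_funB.
  apply: measurable_funD; last by apply: measurable_maxr => //; exact: measurable_funB.
  apply: measurable_funM; first exact: measurable_cst.
  by apply: measurable_maxr => //; exact: measurable_funB.
have mf : measurable_fun D f.
  apply/measurable_EFinP; apply: measurable_funM; last exact: mpsi.
  by apply: measurable_funTS; exact: measurable_indic.
have fcv : {ae mu, forall r, D r -> f_ ^~ r @ \oo --> f r}.
  apply: aeW => r _; rewrite /f_ /f; apply/cvg_EFin; first exact: nearW.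
  apply: cvgMl; rewrite indicE.
  have [->|rx] := eqVneq r x.
    rewrite mem_set //; apply: cvg_near_cst; apply: nearW => k.
    by apply/eqP; rewrite hat_center.
  rewrite memNset; last by move=> /= rE; rewrite rE eqxx in rx.
  apply: cvg_near_cst.
  have d0 : 0 < `|r - x| / m by rewrite divr_gt0 // normr_gt0 subr_eq0.
  have [K _ KP] := near_infty_natSinv_lt (PosNum d0).
  exists K => // k /= Kk; apply/eqP.
  have ed : e k < `|r - x|.
    have := KP k Kk; rewrite /= ltr_pdivlMr // mulrC; apply: le_lt_trans.
    by rewrite /e ler_pM2l // lef_pV2 ?posrE // ler_nat.
  have [|-> _ //] := @hat_out R x (e k) r (e_gt0 k).
  apply/negP => /andP[r1 r2]; move: ed; rewrite ltNge ler_norml => /negP; apply.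
  by apply/andP; split; lra.
have gi : mu.-integrable D g.
  apply/integrableP; split.
    by apply/measurable_EFinP; apply: measurable_funTS; exact: measurable_indic.
  under eq_integral do rewrite /g /= ger0_norm //.
  rewrite integral_indic //; apply: le_lt_trans (mu_fin (x / 2) (2 * x) _).
    by apply: le_measure; rewrite ?inE //; apply: measurableI.
  by rewrite divr_gt0.
have dom : {ae mu, forall r, forall k, D r -> (`|f_ k r| <= g r)%E}.
  case: psi1 => Z [mZ Z0 psiZ]; exists Z; split=> // r /= H; apply: psiZ => /= psi_r.
  apply: H => k _; rewrite /f_ /g lee_fin normrM indicE.
  have [rI|rI] := boolP (x - e k <= r <= x + e k); last first.
    by have [-> _] := hat_out (e_gt0 k) rI; rewrite normr0 mul0r.
  have ek := e_lt k.
  rewrite mem_set; last by rewrite /= in_itv /=; apply/andP; split; lra.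
  have /andP[h0 h1] := hat_bounds x r (e_gt0 k).
  rewrite ger0_norm // -[leRHS]mulr1; apply: ler_pM => //.
  by rewrite -psi_r; exact: coord_le_enorm.
have [fi _ cv] := dominated_convergence mD mf_ mf fcv gi dom.
have intf_ k : (\int[mu]_(r in D) f_ k r = (p 0 j)%:E)%E.
  (* A constant sequence converges, so its dominated limit is integrable. *)
  have fki : mu.-integrable D (f_ k).
    have [|||||//] := @dominated_convergence _ _ _ mu D mD (fun=> f_ k) (f_ k) g.
    - by move=> _; exact: mf_.
    - exact: mf_.
    - by apply: aeW => r _; exact: cvg_cst.
    - exact: gi.
    - case: dom => Z [mZ Z0 domZ]; exists Z; split=> // r /= H; apply: domZ => /= H2.
      by apply: H => _; exact: H2.
  rewrite -[LHS]fineK; last exact: integrable_fin_num.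
  congr EFin; rewrite -(Lp (e k) j) //; last 2 first.
  - exact: lt_le_trans (e_lt k) me.
  - have := e_lt k; lra.
  rewrite LE; last first.
    by apply: test_hat => //; have := e_lt k; lra.
  by apply: eq_Rintegral => r _; rewrite dotpZl dotpC dotp_delta.
have intf : (\int[mu]_(r in D) f r = (fine (mu [set x]) * psi x 0 j)%:E)%E.
  have mux : (mu [set x] < +oo)%E.
    by apply: le_lt_trans (mu_fin x x x0); rewrite set_itv1.
  transitivity (\int[mu]_(r in D) ((psi x 0 j)%:E * (\1_[set x] r)%:E))%E.
    apply: eq_integral => r _; rewrite /f indicE -EFinM mulrC.
    have [->//|rx] := eqVneq r x; congr EFin.
    by rewrite memNset ?mulr0 // => /= rE; rewrite rE eqxx in rx.
  rewrite integralZl //; last first.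
    apply/integrableP; split.
      by apply/measurable_EFinP; apply: measurable_funTS; exact: measurable_indic.
    under eq_integral do rewrite /= ger0_norm //.
    rewrite integral_indic //; apply: le_lt_trans mux.
    by apply: le_measure; rewrite ?inE //; apply: measurableI.
  rewrite integral_indic // setIidl; last by move=> r ->; rewrite /D /= in_itv /= andbT.
  by rewrite EFinM fineK ?ge0_fin_numE // muleC.
have : (p 0 j)%:E = (fine (mu [set x]) * psi x 0 j)%:E.
  rewrite -intf; apply: (cvg_unique _ _ cv) => //.
  by apply: cvg_near_cst; apply: nearW => k; exact: intf_.
by case.
Qed.

End PolarUnique.

(** * The spectral decomposition given by finitely many peaks *)

Section SpectralDecomposition.
Variables (R : realType) (n : nat).
Notation V := 'rV[R]_n.

Lemma W11loc_cst (I : set R) (u : V) : W11loc I (fun=> u) (fun=> 0).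
Proof.
apply: primitive_W11loc => a b j _ _ _.
by apply: primitive_eq (primitive_cst a b (u 0 j)) => r _; rewrite mxE.
Qed.

Lemma spectral_of_peaks (J : V -> \bar R) f L Lfreq N t phi :
  t 0%N = 0 -> increasing_times N t -> phi 0%N = 0 ->
  (forall k, (k < N)%N -> phi k.+1 != 0) ->
  peaks L N t phi -> peaks Lfreq N (fun i => (t i)^-1) phi ->
  f = P0 J f + \sum_(i < N.+1) phi i ->
  spectral_decomposition J f L Lfreq N t phi.
Proof.
move=> t0 tP phi0 phiN LP FP fE.
have tpos k : (k < N)%N -> 0 < t k.+1.
  move=> kN; rewrite -t0; apply: (increasing_times_mono tP).
  by rewrite /= ltnS ltnW.
have dp : delta_peaks L N t phi.
  move=> v dv Wv; pose b := Num.max (t 1%N) (t N).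
  exists (t 1%N), b; split.
  - by rewrite -t0 tP.
  - by rewrite le_max lexx.
  move=> w dw tw wv; rewrite LP // big_ord_recl phi0 dotp0l add0r.
  apply: eq_bigr => k _; rewrite wv // le_max.
  apply/andP; split; first by apply: (increasing_times_le tP); rewrite /= ltnS ltnW.
  by apply/orP; right; apply: (increasing_times_le tP); rewrite leqnSn andbT.
split=> //.
- exists (\sum_(i < N.+1) phi i) => // j.
  have := dp _ _ (@W11loc_cst `]0, +oo[%classic (delta_mx 0 j)).
  suff -> : \sum_(i < N.+1) dotp (phi i) (delta_mx 0 j) = (\sum_(i < N.+1) phi i) 0 j by [].
  by rewrite -dotp_suml dotp_delta.
- exists (point_masses N (fun k => (t k.+1)^-1) (fun k => phi k.+1)),
    (directions N (fun k => (t k.+1)^-1) (fun k => phi k.+1)).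
  apply: point_masses_polar => //.
  + by move=> k kN; rewrite invr_gt0 tpos.
  + move=> k l kN lN /invr_inj; case: (ltngtP k l) => // kl E.
      have := @increasing_times_mono _ _ _ k.+1 l.+1 tP.
      by rewrite ltnS kl ltnS (ltnW lN) E ltxx => /(_ isT).
    have := @increasing_times_mono _ _ _ l.+1 k.+1 tP.
    by rewrite ltnS kl ltnS (ltnW kN) E ltxx => /(_ isT).
- move=> mu psi polar [|k] kN; first by exists 0; rewrite phi0 scale0r.
  exists (fine (mu [set (t k.+1)^-1])).
  apply: (polar_point _ _ polar); first by rewrite invr_gt0 tpos.
  (* A tent narrower than the distance to the other peaks sees only one. *)
  pose d (l : 'I_N) := if l == k :> nat then 1 else `|(t l.+1)^-1 - (t k.+1)^-1|.
  have dE (l : 'I_N) : 0 < d l.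
    rewrite /d; case: eqP => [//|/eqP lk]; rewrite normr_gt0 subr_eq0.
    apply: contra lk => /eqP/invr_inj E.
    case: (ltngtP (l : nat) k) => // kl.
      have := @increasing_times_mono _ _ _ l.+1 k.+1 tP.
      by rewrite ltnS kl ltnS (ltnW kN) E ltxx => /(_ isT).
    have := @increasing_times_mono _ _ _ k.+1 l.+1 tP.
    by rewrite ltnS kl ltnS ltnW // E ltxx => /(_ isT).
  exists (\big[Num.min/1]_l d l); first by apply: lt_bigmin.
  move=> e j e0 ed ex; rewrite FP; last exact: test_hat.
  rewrite (bigD1 (Ordinal kN)) //= hat_center // scale1r dotp_delta big1 ?addr0 //.
  move=> l lk; have [|-> _] := @hat_out R (t k.+1)^-1 e (t l.+1)^-1 e0; last first.
    by rewrite scale0r dotp0r.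
  have : e < d l by apply: lt_le_trans ed _; exact: bigmin_le_cond.
  have /negbTE lk' : (l : nat) != k by apply: contra lk => /eqP E; apply/eqP/val_inj.
  rewrite /d lk' ltNge ler_norml; apply: contra => /andP[l1 l2].
  by apply/andP; split; lra.
Qed.

End SpectralDecomposition.

(** * The three methods *)

Section SeminormMethods.
Variables (R : realType) (n : nat) (J : 'rV[R]_n -> \bar R) (S : seq 'rV[R]_n).
Variable f : 'rV[R]_n.
Notation V := 'rV[R]_n.
Notation lambda := (@lebesgue_measure R).
Hypothesis J_ge0 : forall u, (0 <= J u)%E.
Hypothesis J_convex : convex_ereal J.
Hypothesis J_lsc : lower_semicontinuous J.
Hypothesis J_homogeneous : abs_one_homogeneous J.
Hypothesis J_hull : conv_hull S = subdiff J 0.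
Implicit Types (u p q : R -> V) (t : nat -> R) (c : nat -> V).

Local Notation J0 := (seminorm0 J_homogeneous).
Local Notation subdiffP := (subdiff_homogeneousP J_ge0 J_homogeneous).
Local Notation subdiff0 := (subdiff0P J_homogeneous).
Local Notation cells := (subdiff_cells J_ge0 J_convex J_lsc J_homogeneous J_hull).

Lemma seminorm_fin (w : V) : J w = (fine (J w))%:E.
Proof.
have [i iP] := active_generator J_ge0 J_homogeneous J_hull w.
by rewrite (seminorm_active J_ge0 J_convex J_lsc J_homogeneous J_hull iP).
Qed.

Lemma subdiff_fineP (w x : V) : subdiff J w x <->
  (forall y, dotp x y <= fine (J y)) /\ fine (J w) <= dotp x w.
Proof.
split=> [/subdiffP[/subdiff0 xK Jw]|[xK Jw]].
  split=> [y|]; first by have := xK y; rewrite (seminorm_fin y) lee_fin.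
  by rewrite Jw.
apply/subdiffP; split.
  by apply/subdiff0 => y; rewrite (seminorm_fin y) lee_fin.
by rewrite seminorm_fin; congr EFin; apply/eqP; rewrite eq_le Jw xK.
Qed.

(** Pass to the limit in <S_i, .> <= J <= <x, .> along the segment, with S_i a
generator that is maximal in direction w. *)
Lemma subdiff_closed (w z x : V) :
  (forall s : R, 0 < s < 1 -> subdiff J (w + s *: (z - w)) x) -> subdiff J w x.
Proof.
move=> H.
have half : 0 < (2^-1 : R) < 1 by rewrite invr_gt0 ltr0n /= invf_lt1 ?ltr1n.
have /subdiff_fineP[xK _] := H _ half; apply/subdiff_fineP; split=> //.
have [i iP] := active_generator J_ge0 J_homogeneous J_hull w.
rewrite (seminorm_active J_ge0 J_convex J_lsc J_homogeneous J_hull iP) /=.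
pose D := dotp (x - S`_i) (z - w).
apply: (@le_small_slope _ _ _ (D / 2)) => a /andP[a0 a1].
have a2 : 0 < a / 2 < 1 by apply/andP; split; lra.
have /subdiff_fineP[_] := H _ a2.
have : dotp S`_i (w + (a / 2) *: (z - w)) <= fine (J (w + (a / 2) *: (z - w))).
  by have /subdiff0/(_ (w + (a / 2) *: (z - w))) := generator_subdiff0 J_hull i;
    rewrite seminorm_fin lee_fin.
move=> h1 /(le_trans h1); rewrite /D !dotpE; lra.
Qed.

Lemma subdiff_value_closed (w z x : V) :
  (forall s : R, 0 < s < 1 -> subdiff J x (w + s *: (z - w))) -> subdiff J x w.
Proof.
move=> H; apply/subdiff_fineP.
have lim (y : V) (b : R) : (forall s, 0 < s < 1 -> b <= dotp (w + s *: (z - w)) y) ->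
    b <= dotp w y.
  move=> by'; apply: (@le_small_slope _ _ _ (dotp (z - w) y / 2)) => a /andP[a0 a1].
  have a2 : 0 < a / 2 < 1 by apply/andP; split; lra.
  by have := by' _ a2; rewrite dotpDl dotpZl; lra.
split=> [y|].
  rewrite -[leLHS]opprK -dotpNr lerNl; apply: lim => s sP.
  rewrite dotpNr lerN2; by have /subdiff_fineP[-> _] := H s sP.
by apply: lim => s sP; have /subdiff_fineP[_ ->] := H s sP.
Qed.

Lemma subdiff0_orthogonal (x z : V) : subdiff J 0 x -> J z = 0%E -> dotp x z = 0.
Proof.
move=> /subdiff0 xK Jz.
have JNz : J (- z) = 0%E by rewrite -scaleN1r J_homogeneous Jz mule0.
have := xK z; have := xK (- z); rewrite Jz JNz !lee_fin dotpNr => h1 h2.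
by apply/eqP; rewrite eq_le h2 /=; lra.
Qed.

Lemma kernel_sub (x y : V) : J x = 0%E -> J y = 0%E -> J (x - y) = 0%E.
Proof.
move=> Jx Jy; apply/eqP; rewrite eq_le J_ge0 andbT.
apply: (seminorm_hull_le J_ge0 J_convex J_lsc J_homogeneous J_hull) => k.
have SK := generator_subdiff0 J_hull k.
by rewrite dotpDr dotpNr !subdiff0_orthogonal // subrr.
Qed.

Lemma P0_eq (w : V) : J w = 0%E -> (forall z, J z = 0%E -> dotp (f - w) z = 0) ->
  P0 J f = w.
Proof.
move=> Jw fw; rewrite /P0.
case: xgetP => [x _ [Jx fx]|H]; last by case: (H w).
apply/eqP; rewrite -subr_eq0; apply/eqP/dotp_le0.
have Jxw := kernel_sub Jx Jw.
have -> : dotp (x - w) (x - w) = dotp (f - w) (x - w) - dotp (f - x) (x - w).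
  by rewrite !dotpE; ring.
by rewrite fx // fw // subrr.
Qed.

Lemma subdiff_resolvent (w : V) (t : R) : 0 < t ->
  exists x y, subdiff J x y /\ w = x + t *: y.
Proof. by move=> t0; exact: resolvent_exists J_ge0 J0 J_convex J_lsc t0. Qed.

(** Summation by parts. *)
Lemma broken_line_peaks_sum u N t c : t 0%N = 0 -> increasing_times N t ->
  broken_line u N t c -> c N = 0 ->
  \sum_(i < N.+1) t i *: (c i - c i.-1) = u 0 - u (t N).
Proof.
move=> t0 tP bl cN.
have H k : (k <= N)%N -> \sum_(i < k.+1) t i *: (c i - c i.-1) =
    t k *: c k + (u 0 - u (t k)).
  elim: k => [|k IHk] kN; first by rewrite big_ord1 t0 !scale0r subrr addr0.
  rewrite big_ord_recr IHk ?(ltnW kN) //= (bl k (t k.+1)) ?(ltnW kN) //; last first.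
    by split=> //; rewrite ltW // tP // ltnW.
  by apply/rowP => j; rewrite !mxE; ring.
by rewrite H // cN scaler0 add0r.
Qed.

Lemma peaks_of_broken_line u N t c : t 0%N = 0 -> increasing_times N t ->
  broken_line u N t c -> (forall i, (i < N)%N -> c i != c i.+1) -> c N = 0 ->
  P0 J f = u (t N) -> u 0 = f ->
  spectral_decomposition J f (t_second_derivative u)
    (invert (t_second_derivative u)) N t (fun i => t i *: (c i - c i.-1)).
Proof.
move=> t0 tP bl cc cN fN u0.
have LP := t_second_derivative_peaks t0 tP bl.
apply: spectral_of_peaks => //.
- by rewrite t0 scale0r.
- move=> k kN /=; rewrite scaler_eq0 subr_eq0 [c _ == _]eq_sym (negbTE (cc k kN)) orbF.
  by rewrite gt_eqF // -t0 (increasing_times_mono tP) //= ltnS ltnW.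
- exact: invert_peaks.
- by rewrite (broken_line_peaks_sum t0 tP bl cN) u0 fN addrC subrK.
Qed.

Lemma ray_bounded (x y : V) (B : R) :
  (forall s j, 0 <= s -> `|(x + s *: y) 0 j| <= B) -> y = 0.
Proof.
move=> H; apply/rowP => j; rewrite mxE.
have lin s : 0 <= s -> s * `|y 0 j| <= B + `|x 0 j|.
  move=> s0; have := H s j s0; rewrite !mxE => h.
  rewrite -[X in X * _]ger0_norm // -normrM.
  have -> : s * y 0 j = (x 0 j + s * y 0 j) - x 0 j by ring.
  by apply: (le_trans (ler_normB _ _)); rewrite lerD2r.
have [//|yn] := eqVneq (y 0 j) 0.
have y0 : 0 < `|y 0 j| by rewrite normr_gt0.
have B0 : 0 <= B + `|x 0 j| by have := lin 0 (lexx 0); rewrite mul0r.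
have s0 : 0 <= (B + `|x 0 j| + 1) / `|y 0 j| by apply: divr_ge0; lra.
by have := lin _ s0; rewrite divfK ?gt_eqF //; lra.
Qed.

(** Variational method: the minimisers are the resolvents of the
subdifferential, with the step size as parameter. *)
Lemma variational_resolvent u : variational_method J f u ->
  forall r, 0 <= r -> exists x, subdiff J (u r) x /\ f = u r + r *: x.
Proof.
move=> um r; rewrite le_eqVlt => /orP[/eqP <-|r0].
  have u0 : u 0 = f.
    apply/eqP; rewrite -subr_eq0; apply/eqP/dotp_le0.
    have := um 0 (lexx 0) f; rewrite !mul0e !adde0 lee_fin !enorm_sqr subrr dotp0l.
    lra.
  have [x fx] := subdiff_nonempty J_ge0 J_convex J_lsc J_homogeneous J_hull f.
  by exists x; rewrite u0 scale0r addr0.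
exists (r^-1 *: (f - u r)); split.
  apply: (proximal_subdiff J_ge0 J0 J_convex r0) => w.
  by have := um r (ltW r0) w; rewrite !enorm_sqr.
by rewrite scalerA divff ?gt_eqF // scale1r addrC subrK.
Qed.

Lemma resolvent_variational u :
  (forall r, 0 <= r -> exists x, subdiff J (u r) x /\ f = u r + r *: x) ->
  variational_method J f u.
Proof.
move=> uP r; rewrite le_eqVlt => /orP[/eqP <-|r0] w.
  have [x [_]] := uP 0 (lexx 0); rewrite scale0r addr0 => fE.
  rewrite !mul0e !adde0 lee_fin !enorm_sqr -fE subrr dotp0l mulr0.
  by rewrite mulr_ge0 ?dotp_ge0 // invr_ge0.
have [x [ux fE]] := uP r (ltW r0).
by rewrite !enorm_sqr; exact: (subdiff_proximal w J_ge0 J0 r0 ux fE).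
Qed.

Lemma variational_exists : exists u, variational_method J f u.
Proof.
have /choice[u uP] : forall r : R, exists v, 0 <= r ->
    exists x, subdiff J v x /\ f = v + r *: x.
  move=> r; have [r0|r0|<-] := ltgtP 0 r.
  - by have [v [x [vx ->]]] := subdiff_resolvent f r0; exists v => _; exists x.
  - by exists 0.
  - have [x fx] := subdiff_nonempty J_ge0 J_convex J_lsc J_homogeneous J_hull f.
    by exists f => _; exists x; rewrite scale0r addr0.
by exists u; apply: resolvent_variational.
Qed.

Let subdiff_mono (w z x y : V) : subdiff J w x -> subdiff J z y ->
  0 <= dotp (x - y) (w - z).
Proof. exact: subdiff_monotone. Qed.

(** The resolvent curve stays at distance at most |f| from f, so that its last
slope vanishes. *)
Lemma variational_decomposition : exists (N : nat) (t : nat -> R) (phi : nat -> V),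
  [/\ times N t,
      exists u, variational_method J f u &
      forall u, variational_method J f u ->
      [/\ u (t 0%N) = f,
          change_times N t (locally_affine u),
          forall i r, (i <= N)%N -> piece N t i r ->
            u r = u (t i) + (r - t i) *: slope u (t i) (t i.+1),
          forall i, (i <= N)%N ->
            phi i = t i *: (slope u (t i) (t i.+1) - slope u (t i.-1) (t i)) &
          spectral_decomposition J f (t_second_derivative u)
            (invert (t_second_derivative u)) N t phi]].
Proof.
have [u0 u0m] := variational_exists; have u0P := variational_resolvent u0m.
have [N1 [t1 [c1 [t10 t1P bl1]]]] := resolvent_broken_line cells
  (@active_cell_convex _ _ _) (@hull_cell_convex _ _ _) subdiff_mono u0P.
have [N [t [c [t0 tP bl0 cc]]]] := broken_line_reduced t1P bl1.
rewrite t10 in t0.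
exists N, t, (fun i => t i *: (c i - c i.-1)); split=> //; first by exists u0.
move=> u um; have uP := variational_resolvent um.
have uE r : 0 <= r -> u r = u0 r.
  move=> r0; have [x [ux fx]] := uP r r0; have [y [uy fy]] := u0P r r0.
  by apply: (resolvent_unique subdiff_mono r0 ux uy); rewrite -fx.
have tge i : (i <= N.+1)%N -> 0 <= t i.
  by move=> iN; rewrite -t0 (increasing_times_le tP).
have bl : broken_line u N t c.
  move=> i r iN [ir ri]; rewrite !uE ?tge ?(leqW iN) //; first exact: bl0.
  exact: le_trans (tge i (leqW iN)) ir.
have uf : u 0 = f.
  by have [x [_]] := uP 0 (lexx 0); rewrite scale0r addr0.
have slopeE i : (i <= N)%N -> slope u (t i) (t i.+1) = c i.
  move=> iN; rewrite /slope (bl i (t i.+1) iN); last first.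
    by split=> //; rewrite ltW // tP.
  rewrite addrAC subrr add0r scalerA mulVf ?scale1r // subr_eq0 gt_eqF //.
  exact: tP.
have tN r : t N <= r -> u r = u (t N) + (r - t N) *: c N.
  by move=> Nr; apply: bl => //; split=> //; rewrite ltnn.
have bound r j : 0 <= r -> `|(u r - f) 0 j| <= enorm f.
  move=> r0; rewrite -sqrtr_sqr; apply: ler_wsqrtr.
  apply: (le_trans (sqr_coord_le _ _)).
  have := um r r0 0; rewrite J0 mule0 adde0 !enorm_sqr sub0r dotpNl dotpNr opprK.
  rewrite (seminorm_fin (u r)) -EFinM -EFinD lee_fin.
  have : 0 <= r * fine (J (u r)) by rewrite mulr_ge0 // fine_ge0.
  lra.
have cN : c N = 0.
  apply: (@ray_bounded (u (t N) - f) _ (enorm f)) => s j s0.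
  have -> : u (t N) - f + s *: c N = u (t N + s) - f.
    rewrite (tN (t N + s)) ?lerDl // [_ + s - _]addrAC subrr add0r.
    by rewrite addrAC.
  by apply: bound; rewrite addr_ge0 // tge.
have uN r : t N <= r -> u r = u (t N) by move=> /tN ->; rewrite cN scaler0 addr0.
(* The parameters t_(N+1) and 2 t_(N+1) have the same resolvent v; the
   corresponding subgradients x and y satisfy x = 2 y, so that
   J v = <x, v> = <y, v> forces J v = 0. *)
have P0E : P0 J f = u (t N).
  have s0 : 0 < t N.+1 by rewrite -t0 (increasing_times_mono tP) //= ltnS.
  have sN : t N <= t N.+1 by rewrite ltW // tP.
  have [x [ux fx]] := uP _ (ltW s0).
  have s20 : 0 <= 2 * t N.+1 by rewrite mulr_ge0 // ltW.
  have sN2 : t N <= 2 * t N.+1 by lra.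
  have [y [uy fy]] := uP _ s20.
  rewrite uN // in ux fx; rewrite uN // in uy fy.
  apply: P0_eq => [|z Jz].
    have /subdiffP[_ Jx] := ux; have /subdiffP[_ Jy] := uy.
    rewrite Jx; congr EFin.
    have xy : dotp y (u (t N)) = dotp x (u (t N)) by move: Jy; rewrite Jx => -[].
    have : t N.+1 *: x = (2 * t N.+1) *: y.
      by apply: (@addrI _ (u (t N))); rewrite -fx.
    move/(congr1 (fun v => dotp v (u (t N)))); rewrite !dotpZl xy => E.
    apply: (mulfI (lt0r_neq0 s0)); lra.
  have /subdiffP[xK _] := ux.
  by rewrite {1}fx addrAC subrr add0r dotpZl (subdiff0_orthogonal xK Jz) mulr0.
split.
- by rewrite t0.
- exact: broken_line_change_times t0 tP bl cc.
- by move=> i r iN /piece_closed ri; rewrite slopeE //; exact: bl.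
- move=> [|i] iN; first by rewrite t0 !scale0r.
  by rewrite !slopeE // ltnW.
- exact: peaks_of_broken_line.
Qed.

(** The trajectory of the subdifferential from f, which a broken line follows,
is the only gradient flow. *)
Lemma gradient_flow_decomposition : exists (N : nat) (t : nat -> R) (phi : nat -> V),
  [/\ times N t,
      exists u p, gradient_flow J f u p &
      forall u p, gradient_flow J f u p ->
      change_times N t (locally_affine u) /\
      (exists pt : R -> V,
       [/\ pt (t 0%N) = 0,
           {ae lambda, forall r, 0 < r -> p r = pt r},
           forall r, 0 < r -> subdiff J (u r) (pt r),
           forall i r, (i <= N)%N -> piece N t i r ->
             pt r = pt (t i.+1) /\
             u r = u (t i) - (r - t i) *: pt (t i.+1) &
           forall i, (i <= N)%N -> phi i = t i *: (pt (t i) - pt (t i.+1))]) /\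
      spectral_decomposition J f (t_second_derivative u)
        (invert (t_second_derivative u)) N t phi].
Proof.
have [x0 fx0] := subdiff_nonempty J_ge0 J_convex J_lsc J_homogeneous J_hull f.
have [N [t [c [U [t0 tP U0 bl [Up cc]]]]]] := trajectory_exists cells
  (@active_cell_convex _ _ _) (@hull_cell_convex _ _ _) subdiff_mono
  subdiff_closed (fun w _ s s0 _ => subdiff_resolvent w s0) fx0.
pose W := polyline f N t c.
have WE r : 0 <= r -> W r = U r.
  move=> r0; rewrite -t0 in U0 r0.
  apply: (broken_line_ext tP _ bl) r0; first exact: polyline_broken_line.
  by rewrite /W polyline0.
have tge i : (i <= N.+1)%N -> 0 <= t i.
  by move=> iN; rewrite -t0 (increasing_times_le tP).
have stepE i r : (i <= N)%N -> piece N t i r -> step N t c r = c i.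
  by move=> iN; exact: step_piece.
have Wsub r : 0 < r -> subdiff J (W r) (- step N t c r).
  move=> r0; have [|i iN ri] := @piece_exists R N t r; first by rewrite t0.
  rewrite (stepE i) // WE ?ltW //; apply: Up => //; exact: piece_closed.
have Wflow : gradient_flow J f W (fun r => - step N t c r).
  split.
  - by rewrite WE.
  - rewrite (_ : (fun r => - - step N t c r) = step N t c); last first.
      by apply/funext => r; rewrite opprK.
    exact: polyline_W11loc.
  - by apply: aeW => r; exact: Wsub.
have ptc i : (i <= N)%N -> piece N t i (t i.+1) by move=> iN; split=> //; exact: tP.
(* On the last piece J u = <- c_N, u> is nonnegative and decreases at the rate
   |c_N|^2 for all times. *)
have cN : c N = 0.
  apply: dotp_le0; apply: (@le_small_slope _ _ 0 (dotp (- c N) (U (t N)))) => a /andP[a0 a1].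
  have sub : subdiff J (U (t N + a^-1)) (- c N).
    apply: Up => //; split; last by rewrite ltnn.
    by rewrite lerDl invr_ge0 ltW.
  have UE : U (t N + a^-1) = U (t N) + a^-1 *: c N.
    rewrite (bl N) //; last by split; [rewrite lerDl invr_ge0 ltW|rewrite ltnn].
    by rewrite [_ + _ - _]addrAC subrr add0r.
  have := subdiff_ge0 J_ge0 J_homogeneous sub.
  rewrite UE dotpDr dotpZr [dotp (- c N) (c N)]dotpNl => h.
  have := mulr_ge0 (ltW a0) h; rewrite mulrDr mulrA divff ?gt_eqF // mul1r; lra.
have P0E : P0 J f = U (t N).
  have UN : subdiff J (U (t N)) (- c N).
    by apply: Up => //; split=> //; rewrite ltnn.
  apply: P0_eq => [|z Jz].
    by have /subdiffP[_ ->] := UN; rewrite cN oppr0 dotp0l.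
  (* f - u (t_k) is a combination of subgradients. *)
  have orth k : (k <= N)%N -> dotp (f - U (t k)) z = 0.
    elim: k => [|k IHk] kN; first by rewrite t0 U0 subrr dotp0l.
    have /subdiffP[ck _] := Up k (t k) (ltnW kN)
      (conj (lexx _) (fun _ => ltW (tP k (ltnW kN)))).
    have := IHk (ltnW kN).
    rewrite (bl k (t k.+1)) ?(ltnW kN) //; last first.
      by split=> //; rewrite ltW // tP // ltnW.
    have := subdiff0_orthogonal ck Jz; rewrite !dotpE => /eqP.
    rewrite oppr_eq0 => /eqP ->; lra.
  exact: orth.
exists N, t, (fun i => t i *: (c i - c i.-1)); split=> //.
  by exists W, (fun r => - step N t c r).
move=> u p [u0 uW up].
have [W0 WW _] := Wflow.
have [uE pE] : (forall r, 0 <= r -> u r = W r) /\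
    {ae lambda, forall r, 0 < r -> - p r = - - step N t c r}.
  apply: monotone_flow_unique uW WW _ _; first by rewrite u0 W0.
  apply: aeS up => r ur r0.
  have -> : - p r - - - step N t c r = - (p r - - step N t c r).
    by apply/rowP => j; rewrite !mxE; ring.
  rewrite dotpNr oppr_le0 dotpC; apply: subdiff_mono; [exact: ur|exact: Wsub].
have blu : broken_line u N t c.
  move=> i r iN [ir ri].
  have ti := tge i (leqW iN).
  by rewrite !uE ?(le_trans ti) // !WE ?(le_trans ti) //; exact: bl.
split; first exact: broken_line_change_times t0 tP blu cc.
split; last first.
  apply: peaks_of_broken_line => //.
  by rewrite uE ?tge // WE ?tge.
pose pt r : V := if r <= 0 then 0 else - step N t c r.
have ptE r : 0 < r -> pt r = - step N t c r by move=> r0; rewrite /pt leNgt r0.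
have tgt i : (i <= N)%N -> 0 < t i.+1.
  by move=> iN; rewrite -t0 (increasing_times_mono tP).
have pt_vertex i : (i <= N)%N -> pt (t i.+1) = - c i.
  by move=> iN; rewrite ptE ?tgt // (stepE i) //; exact: ptc.
exists pt; split.
- by rewrite /pt t0 lexx.
- by apply: aeS pE => r pr r0; rewrite ptE // -[p r]opprK pr // opprK.
- by move=> r r0; rewrite ptE // uE ?ltW //; exact: Wsub.
- move=> i r iN ri; rewrite pt_vertex //.
  have r0 : 0 < r by apply: le_lt_trans ri.1; rewrite tge // leqW.
  rewrite ptE // (stepE i) //; split=> //.
  by rewrite scalerN opprK; apply: blu => //; exact: piece_closed.
- move=> [|i] iN; first by rewrite t0 !scale0r.
  by rewrite !pt_vertex ?(ltnW iN) // opprK addrC.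
Qed.

(** The times 0 and 1/s_N < ... < 1/s_1, for 0 = s_0 < s_1 < ... < s_N,
followed by some later time. *)
Definition inverse_times N (s : nat -> R) (i : nat) : R :=
  if (i <= N)%N then if i is 0%N then 0 else (s (N.+1 - i)%N)^-1
  else if N is 0%N then 1 else (s 1%N)^-1 + 1.

Lemma inverse_timesE N s i : (i < N)%N ->
  inverse_times N s i.+1 = (s (N - i)%N)^-1.
Proof. by move=> iN; rewrite /inverse_times iN subSS. Qed.

Lemma inverse_times_increasing N s : s 0%N = 0 -> increasing_times N s ->
  increasing_times N (inverse_times N s).
Proof.
move=> s0 sP.
have spos k : (0 < k <= N)%N -> 0 < s k.
  move=> /andP[k0 kN]; rewrite -s0; apply: (increasing_times_mono sP).
  by rewrite k0 leqW.
move=> [_|i iN].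
  rewrite {1}/inverse_times /=; case: N sP spos => [|N] sP spos.
    by rewrite /inverse_times /=.
  by rewrite inverse_timesE // invr_gt0 spos // subn0 /= leqnn.
have iN' : (i < N)%N by [].
rewrite inverse_timesE //; have [i2|i2] := ltnP i.+1 N.
  have si : 0 < s (N - i)%N by rewrite spos // subn_gt0 iN' leq_subr.
  have si1 : 0 < s (N - i.+1)%N by rewrite spos // subn_gt0 i2 leq_subr.
  rewrite inverse_timesE // ltf_pV2 //; apply: (increasing_times_mono sP).
  by rewrite ltn_sub2l //= leqW // leq_subr.
have -> : N = i.+1 by apply/eqP; rewrite eqn_leq i2.
by rewrite subSnn /inverse_times ltnn ltrDl.
Qed.

(** Pieces contain their right end point in t, hence their left one in s = 1/t;
closed pieces cover both conventions. *)
Lemma inverse_times_piece N s i (r : R) : s 0%N = 0 -> increasing_times N s ->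
  (i <= N)%N -> 0 < r -> piece N (inverse_times N s) i r^-1 ->
  closed_piece N s (N - i) r.
Proof.
move=> s0 sP iN r0 [ir ri].
have spos k : (0 < k <= N)%N -> 0 < s k.
  move=> /andP[k0 kN]; rewrite -s0; apply: (increasing_times_mono sP).
  by rewrite k0 leqW.
split.
  have [iN'|Ni] := ltnP i N; last first.
    by have -> : (N - i = 0)%N; [apply/eqP; rewrite subn_eq0|rewrite s0 ltW].
  have := ri iN'; rewrite inverse_timesE // lef_pV2 // ?posrE //.
  by rewrite spos // subn_gt0 iN' leq_subr.
case: i iN ir {ri} => [|i] iN; first by rewrite subn0 ltnn.
rewrite inverse_timesE // => ir _.
have -> : (N - i.+1).+1 = (N - i)%N by rewrite -subSn // subSS.
have si : 0 < s (N - i)%N by rewrite spos // subn_gt0 iN leq_subr.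
by apply: ltW; move: ir; rewrite ltf_pV2.
Qed.

(** Inverse scale space flow: the trajectory from 0 of the operator
q |-> {v - f | q in subdiff J v}. *)
Lemma inverse_scale_space_trajectory : exists N s d (q : R -> V),
  [/\ s 0%N = 0, increasing_times N s, q 0 = 0, broken_line q N s d &
   (forall i r, (i <= N)%N -> closed_piece N s i r ->
      subdiff J (f - d i) (q r)) /\
   forall i, (i < N)%N -> d i != d i.+1].
Proof.
pose A w x := subdiff J (x + f) w.
have start : A 0 (- f) by rewrite /A addNr; exact: subdiff00.
have Acells w x : A w x <-> exists I : {set 'I_(size S)},
    hull_cell I w /\ active_cell I (x + f).
  by rewrite /A cells; split=> -[I [a b]]; exists I.
have Xconvex (I : {set 'I_(size S)}) (x y : V) (a : R) : 0 <= a <= 1 ->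
    active_cell I (x + f) -> active_cell I (y + f) ->
    active_cell I (a *: x + (1 - a) *: y + f).
  move=> a01 xI yI; have := active_cell_convex a01 xI yI.
  by congr (active_cell _ _); apply/rowP => j; rewrite !mxE; ring.
have Amono w z x y : A w x -> A z y -> 0 <= dotp (x - y) (w - z).
  move=> wx zy; rewrite dotpC; have := subdiff_mono wx zy.
  by rewrite opprD addrACA subrr addr0.
have Aclosed w z x : (forall s : R, 0 < s < 1 -> A (w + s *: (z - w)) x) -> A w x.
  exact: subdiff_value_closed.
have Ares (w y : V) (s : R) : 0 < s -> A w y -> exists x z, A x z /\ w = x + s *: z.
  (* Subgradients at v are subgradients at v / s. *)
  move=> s0 _; have [v [p [vp gE]]] := subdiff_resolvent (w + s *: f) ltr01.
  exists p, (s^-1 *: v - f); split.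
    rewrite /A subrK; move: vp => /subdiffP[pK Jv]; apply/subdiffP; split=> //.
    by rewrite J_homogeneous Jv gtr0_norm ?invr_gt0 // dotpZr EFinM.
  rewrite scalerBr scalerA divff ?gt_eqF // scale1r.
  by apply/rowP => j; move/rowP/(_ j): gE; rewrite !mxE; lra.
have [N [s [d [q [s0 sP q0 bl [qP dd]]]]]] := trajectory_exists Acells
  (@hull_cell_convex _ _ _) Xconvex Amono Aclosed Ares start.
exists N, s, d, q; split=> //; split=> // i r iN ri.
by have := qP i r iN ri; rewrite /A addrC.
Qed.

(** The broken line q = Q has slopes d_i = f - v, and v takes the values
f - d_0, ..., f - d_N = f, in the opposite order as a function of t = 1/s. *)
Lemma inverse_scale_space_decomposition :
  exists (N : nat) (t : nat -> R) (phi : nat -> V),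
  [/\ times N t,
      exists v q, inverse_scale_space J f v q &
      forall v q, inverse_scale_space J f v q ->
      (exists ut : R -> V,
       [/\ ut (t 0%N) = f,
           {ae lambda, forall s, 0 < s -> v s = ut s^-1} /\
           (forall s, 0 < s -> subdiff J (ut s^-1) (q s)),
           change_times N t (locally_constant ut),
           forall i r, (i <= N)%N -> piece N t i r -> ut r = ut (t i.+1) &
           forall i, (i <= N)%N -> phi i = ut (t i) - ut (t i.+1)]) /\
      spectral_decomposition J f (invert (distr_derivative v))
        (distr_derivative v) N t phi].
Proof.
have [N [s [d [Q [s0 sP Q0 bl [Qp dd]]]]]] := inverse_scale_space_trajectory.
pose q0 := polyline 0 N s d; pose v0 r := f - step N s d r.
have qE r : 0 <= r -> q0 r = Q r.
  move=> r0; rewrite -s0 in Q0 r0.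
  apply: (broken_line_ext sP _ bl) r0; first exact: polyline_broken_line.
  by rewrite /q0 polyline0.
have sge i : (i <= N.+1)%N -> 0 <= s i.
  by move=> iN; rewrite -s0 (increasing_times_le sP).
have v0E i r : (i <= N)%N -> piece N s i r -> v0 r = f - d i.
  by move=> iN ri; rewrite /v0 (step_piece d sP iN).
have q0W : W11loc `[0, +oo[ q0 (fun r => f - v0 r).
  rewrite (_ : (fun r => f - v0 r) = step N s d); first exact: polyline_W11loc.
  by apply/funext => r; rewrite /v0 subKr.
have v0sub r : 0 < r -> subdiff J (v0 r) (q0 r).
  move=> r0; have [|i iN ri] := @piece_exists R N s r; first by rewrite s0.
  by rewrite (v0E i) // qE ?ltW //; apply: Qp => //; exact: piece_closed.
have flow0 : inverse_scale_space J f v0 q0.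
  by split; [rewrite qE|exact: q0W|apply: aeW => r; exact: v0sub].
(* Q stays in the bounded set conv S. *)
have dN : d N = 0.
  have [B B0 KB] := hull_bounded J_hull.
  apply: (@ray_bounded (Q (s N)) _ B) => r j r0.
  have sr : closed_piece N s N (s N + r) by split; [rewrite lerDl|rewrite ltnn].
  have -> : Q (s N) + r *: d N = Q (s N + r).
    by rewrite (bl N (s N + r)) // [s N + r - _]addrAC subrr add0r.
  by apply: KB; have /subdiffP[] := Qp N _ (leqnn N) sr.
(* Q 0 = 0 is a subgradient at the first value of v, and d_0 = Q (s_1) / s_1 is
   a multiple of a subgradient. *)
have P0E : P0 J f = f - d 0%N.
  have p0 : closed_piece N s 0 0 by split; [rewrite s0|move=> N0; rewrite -s0 ltW // sP].
  have p1 : closed_piece N s 0 (s 1%N) by split=> //; rewrite ltW // sP.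
  have s1 : 0 < s 1%N by rewrite -{1}s0 sP.
  apply: P0_eq => [|z Jz].
    have /subdiffP[_ ->] := Qp 0%N 0 (leq0n N) p0.
    by rewrite Q0 dotp0l.
  rewrite subKr; have /subdiffP[QK _] := Qp 0%N _ (leq0n N) p1.
  have := subdiff0_orthogonal QK Jz; rewrite (bl 0%N) // s0 Q0 add0r subr0 dotpZl.
  by move/eqP; rewrite mulf_eq0 gt_eqF //= => /eqP.
pose t := inverse_times N s; pose e i := f - d (N - i)%N.
have tP : increasing_times N t by exact: inverse_times_increasing.
have t0 : t 0%N = 0 by [].
have ee i : (i < N)%N -> e i != e i.+1.
  move=> iN; rewrite /e; apply/eqP => /addrI/oppr_inj E.
  have iN' : (N - i.+1 < N)%N by rewrite subnSK // leq_subr.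
  by have := dd _ iN'; rewrite subnSK // E eqxx.
pose ut := step N t e.
have utE i r : (i <= N)%N -> piece N t i r -> ut r = e i.
  by move=> iN; exact: step_piece.
have tc i : (i <= N)%N -> piece N t i (t i.+1) by move=> iN; split=> //; exact: tP.
have utt i : (i <= N)%N -> ut (t i.+1) = e i by move=> iN; apply: utE => //; exact: tc.
have ut0 : ut 0 = f.
  rewrite /ut /step big1 ?addr0; first by rewrite /e subn0 dN subr0.
  move=> k _; have /negbTE -> : ~~ (t k.+1 < 0); last by rewrite scale0r.
  rewrite -leNgt -t0; apply: (increasing_times_le tP).
  by rewrite /= ltnS ltnW.
exists N, t, (fun i => e i.-1 - e i); split=> //; first by exists v0, q0.
move=> v q [qq0 qW vq].
have [qqE vE] : (forall r, 0 <= r -> q r = q0 r) /\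
    {ae lambda, forall r, 0 < r -> f - v r = f - v0 r}.
  apply: monotone_flow_unique qW q0W _ _; first by rewrite qq0 qE.
  apply: aeS vq => r vr r0.
  have -> : f - v r - (f - v0 r) = - (v r - v0 r).
    by apply/rowP => j; rewrite !mxE; ring.
  by rewrite dotpNr oppr_le0; apply: subdiff_mono; [exact: vr|exact: v0sub].
have vstep : {ae lambda, forall r, 0 < r -> v r = step N s (fun i => f - d i) r}.
  apply: aeS vE => r vr r0; have /addrI/oppr_inj -> := vr r0.
  have [|i iN ri] := @piece_exists R N s r; first by rewrite s0.
  by rewrite (v0E i) // (step_piece _ sP iN ri).
have utsub r : 0 < r -> exists2 i, (i <= N)%N &
    closed_piece N s (N - i) r /\ ut r^-1 = f - d (N - i)%N.
  move=> r0; have [|i iN ri] := @piece_exists R N t r^-1; first by rewrite t0 invr_gt0.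
  exists i => //; split; last exact: utE.
  exact: inverse_times_piece.
have mv a b j : 0 < a -> measurable_fun (`[a, b] : set (measurableTypeR R))
    (fun r => v r 0 j).
  move=> a0; have [ab|ba] := leP a b; last first.
    by rewrite set_itv_ge ?bnd_simp -?ltNge //; exact: measurable_fun_set0.
  have Iab r : a <= r <= b -> [set` `[(0 : R), +oo[] r.
    by move=> /andP[ar _]; rewrite /= in_itv /= andbT (le_trans (ltW a0)).
  have [/(measurable_int lambda)/measurable_EFinP mfv _] :=
    W11loc_primitive j Iab ab qW.
  apply: (eq_measurable_fun (fun r => f 0 j - (f - v r) 0 j)).
    by move=> r _; rewrite !mxE opprB addrC subrK.
  by apply: measurable_funB => //; exact: measurable_cst.
have FP : peaks (distr_derivative v) N (fun i => (t i)^-1) (fun i => e i.-1 - e i).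
  move=> w dw tw; rewrite (distr_derivative_peaks s0 sP mv vstep tw).
  rewrite (reindex_inj rev_ord_inj) /=; apply: eq_bigr => k _.
  have -> : (N - k.+1).+1 = (N - k)%N by rewrite subnSK.
  by rewrite /t inverse_timesE // invrK /e.
split; last first.
  apply: spectral_of_peaks => //.
  - by rewrite subrr.
  - by move=> k kN /=; rewrite subr_eq0 ee.
  - have := invert_peaks FP; rewrite /peaks => H w dw tw.
    by rewrite H //; apply: eq_bigr => k _; rewrite invrK.
  - have -> : \sum_(i < N.+1) (e i.-1 - e i) = e 0%N - e N.
      elim: (N) => [|k IHk]; first by rewrite big_ord1.
      by rewrite big_ord_recr IHk /= addrA subrK.
    by rewrite P0E /e subnn subn0 dN subr0 addrC subrK.
exists ut; split.
- by rewrite t0.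
- split.
    have H : {ae lambda, forall r, forall k : 'I_N.+1, r != s k}.
      by apply: ae_forall_ord => k; exact: ae_neq.
    apply: aeS (aeI H vstep) => r [rs vr] r0; rewrite vr //.
    have [i iN [[si ri] ->]] := utsub r r0.
    apply: (step_piece _ sP (leq_subr i N)); split=> //.
    rewrite lt_neqAle si andbT eq_sym.
    have kN : (N - i < N.+1)%N by rewrite ltnS leq_subr.
    exact: (rs (Ordinal kN)).
  move=> r r0; have [i iN [ri ->]] := utsub r r0.
  rewrite qqE ?qE ?ltW //; apply: Qp => //; exact: leq_subr.
- exact: step_change_times t0 tP utE ee.
- by move=> i r iN ri; rewrite utt // (utE i).
- move=> [|i] iN; first by rewrite t0 ut0 utt // /e subn0 dN subr0.
  by rewrite !utt // ltnW.
Qed.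

End SeminormMethods.

Theorem mainTheorem7 (R : realType) (n : nat) (J : 'rV[R]_n -> \bar R)
    (f : 'rV[R]_n)
    (J_ge0 : forall u, (0 <= J u)%E)
    (J_proper : proper_ereal J)
    (J_convex : convex_ereal J)
    (J_lsc : lower_semicontinuous J)
    (J_homogeneous : abs_one_homogeneous J)
    (J_polyhedral : polyhedral J) :
  [/\ (* variational method; slope u (t 0) (t 0) = 0, as if u (t_(-1)) = f *)
      exists (N : nat) (t : nat -> R) (phi : nat -> 'rV[R]_n),
      [/\ times N t,
          exists u, variational_method J f u &
          forall u, variational_method J f u ->
          [/\ u (t 0%N) = f,
              change_times N t (locally_affine u),
              forall i r, (i <= N)%N -> piece N t i r ->
                u r = u (t i) + (r - t i) *: slope u (t i) (t i.+1),
              forall i, (i <= N)%N ->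
                phi i = t i *: (slope u (t i) (t i.+1) -
                                slope u (t i.-1) (t i)) &
              spectral_decomposition J f (t_second_derivative u)
                (invert (t_second_derivative u)) N t phi]],
      (* gradient flow; pt is the left-continuous representative of p *)
      exists (N : nat) (t : nat -> R) (phi : nat -> 'rV[R]_n),
      [/\ times N t,
          exists u p, gradient_flow J f u p &
          forall u p, gradient_flow J f u p ->
          change_times N t (locally_affine u) /\
          (exists pt : R -> 'rV[R]_n,
           [/\ pt (t 0%N) = 0,
               {ae @lebesgue_measure R, forall r, 0 < r -> p r = pt r},
               forall r, 0 < r -> subdiff J (u r) (pt r),
               forall i r, (i <= N)%N -> piece N t i r ->
                 pt r = pt (t i.+1) /\
                 u r = u (t i) - (r - t i) *: pt (t i.+1) &
               forall i, (i <= N)%N ->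
                 phi i = t i *: (pt (t i) - pt (t i.+1))]) /\
          spectral_decomposition J f (t_second_derivative u)
            (invert (t_second_derivative u)) N t phi] &
      (* inverse scale space flow; ut is the left-continuous representative of
         t |-> v (1/t) *)
      exists (N : nat) (t : nat -> R) (phi : nat -> 'rV[R]_n),
      [/\ times N t,
          exists v q, inverse_scale_space J f v q &
          forall v q, inverse_scale_space J f v q ->
          (exists ut : R -> 'rV[R]_n,
           [/\ ut (t 0%N) = f,
               {ae @lebesgue_measure R, forall s, 0 < s -> v s = ut s^-1} /\
               (forall s, 0 < s -> subdiff J (ut s^-1) (q s)),
               change_times N t (locally_constant ut),
               forall i r, (i <= N)%N -> piece N t i r -> ut r = ut (t i.+1) &
               forall i, (i <= N)%N -> phi i = ut (t i) - ut (t i.+1)]) /\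
          spectral_decomposition J f (invert (distr_derivative v))
            (distr_derivative v) N t phi]].
Proof.
have [S J_hull] := J_polyhedral; split.
- exact: (variational_decomposition f J_ge0 J_convex J_lsc J_homogeneous J_hull).
- exact: (gradient_flow_decomposition f J_ge0 J_convex J_lsc J_homogeneous J_hull).
- exact: (inverse_scale_space_decomposition f J_ge0 J_convex J_lsc J_homogeneous
    J_hull).
Qed.
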